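(* Let $\mathbb{k}$ be an algebraically closed field of characteristic $0$ and let $C$ be a modular category over $\mathbb{k}$. Let $F\colon C\boxtimes C^{bop}\to Z(C)$ be the tautological functor, let $G\colon Z(C)\to C\boxtimes C^{bop}$ be the functor with $G(X,\gamma)=\bigoplus_{i\in O(C)} i^{\star}\boxtimes I_{i,(X,\gamma)}$, and let $d\colon 1\to GF$, $q\colon GF\to 1$, $b\colon 1\to FG$, $p\colon FG\to 1$ be the natural transformations, all as defined in the context. Then $G$ is a factorization of the Drinfeld center $Z(C)$. More precisely, $G$ is an inverse functor of $F$, witnessed by the natural transformations $b,d,p,q$: $d$ and $q$ are mutually inverse natural isomorphisms between $1_{C\boxtimes C^{bop}}$ and $GF$, and $b$ and $p$ are mutually inverse natural isomorphisms between $1_{Z(C)}$ and $FG$.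
   Context: **Conventions.** $\mathbb{k}$ is an algebraically closed field of characteristic $0$. A premodular category is a ribbon fusion category over $\mathbb{k}$ (equivalently, a braided fusion category with a spherical structure); its braiding is $c_{A,B}\colon A\otimes B\to B\otimes A$. Associators are suppressed and $A$ is identified with $A^{\star\star}$ by the spherical structure, so for each object $A$ there are morphisms $coev_A\colon \mathbb{1}\to A\otimes A^{\star}$, $ev_A\colon A^{\star}\otimes A\to\mathbb{1}$, and $\widetilde{coev}_A\colon\mathbb{1}\to A^{\star}\otimes A$, $\widetilde{ev}_A\colon A\otimes A^{\star}\to\mathbb{1}$. $Tr$ is the quantum trace, $Tr(f)=\widetilde{ev}_A\circ(f\otimes 1_{A^{\star}})\circ coev_A\in\mathbb{k}$, and $dim(A)=Tr(1_A)$. $O(C)$ is a fixed finite set of representatives of the isomorphism classes of simple objects, and $dim(\Omega)=\sum_{j\in O(C)}dim(j)^2$, which is nonzero. $C$ is modular if it is premodular and the matrix $(Tr(c_{Y,X}c_{X,Y}))_{X,Y\in O(C)}$ is invertible. For each $i\in O(C)$ a square root $\sqrt{dim(i)}$ is fixed. **Center and $F$.** Objects of the Drinfeld center $Z(C)$ are pairs $(X,\gamma)$ with $\gamma$ a half-braiding: natural isomorphisms $\gamma_Z\colon Z\otimes X\to X\otimes Z$ with $\gamma_{Z\otimes W}=(\gamma_Z\otimes 1_W)(1_Z\otimes\gamma_W)$. Morphisms are the $C$-morphisms commuting with half-braidings. $C^{bop}$ is the fusion category $C$ with the opposite braiding $c^{-1}_{B,A}\colon A\otimes B\to B\otimes A$,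 and $\boxtimes$ is the Deligne product. $F\colon C\boxtimes C^{bop}\to Z(C)$ sends $X\boxtimes Y$ to $X\otimes Y$ with half-braiding $(1_X\otimes (c_{Y,Z})^{-1})\circ(c_{Z,X}\otimes 1_Y)\colon Z\otimes X\otimes Y\to X\otimes Y\otimes Z$, and $f\boxtimes g$ to $f\otimes g$. $C$ is factorizable if $F$ is an equivalence; an inverse functor of $F$ is called a factorization of $Z(C)$. **The morphism $\Gamma$.** For $(X,\gamma)\in Z(C)$ and $i\in O(C)$, $\Gamma_{i,(X,\gamma)}\colon i\otimes X\to i\otimes X$ is $$\frac{1}{dim(\Omega)}\sum_{j\in O(C)}dim(j)\,(1_{i\otimes X}\otimes\widetilde{ev}_j)\circ((c_{i\otimes X,j})^{-1}\otimes 1_{j^{\star}})\circ(1_{j\otimes i}\otimes\gamma_{j^{\star}})\circ(1_j\otimes c_{j^{\star},i}\otimes 1_X)\circ(coev_j\otimes 1_{i\otimes X}).$$ It is idempotent. Let $I_{i,(X,\gamma)}$ be its image, with canonical maps $\pi\colon i\otimes X\twoheadrightarrow I_{i,(X,\gamma)}$ and $\iota\colon I_{i,(X,\gamma)}\hookrightarrow i\otimes X$, $\Gamma_{i,(X,\gamma)}=\iota\circ\pi$. **The functor $G$.** $G\colon Z(C)\to C\boxtimes C^{bop}$ sends $(X,\gamma)$ to $\bigoplus_{i\in O(C)}i^{\star}\boxtimes I_{i,(X,\gamma)}$ and $\phi\colon(X,\gamma)\to(Y,\beta)$ to $\bigoplus_i 1_{i^{\star}}\boxtimes(\pi\circ\Gamma_{i,(Y,\beta)}\circ(1_i\otimes\phi)\circ\Gamma_{i,(X,\gamma)}\circ\iota)$.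 **Dual bases.** For $X\in C$ and $i\in O(C)$ let $\{\alpha_{i,k}\}_k$ be a basis of $Hom_C(X,i^{\star})$ and $\{\alpha_i^k\}_k$ the basis of $Hom_C(i^{\star},X)$ dual to it under the nondegenerate pairing $(\phi,\psi)\mapsto Tr(\psi\circ\phi)$. **The transformations $d$ and $q$.** They are defined on objects $X\boxtimes Y$ (and extended additively). Write $I_i=I_{i,F(X\boxtimes Y)}$. Then $d_{X\boxtimes Y}\colon X\boxtimes Y\to GF(X\boxtimes Y)=\bigoplus_i i^{\star}\boxtimes I_i$ has $i$-component $$\frac{1}{\sqrt{dim(i)}}\sum_k \alpha_{i,k}\boxtimes\Big(\pi\circ\big(((1_i\otimes\alpha_i^k)\circ coev_i)\otimes 1_Y\big)\Big),$$ and $q_{X\boxtimes Y}\colon GF(X\boxtimes Y)\to X\boxtimes Y$ has restriction to the $i$-summand $$\frac{1}{\sqrt{dim(i)}}\sum_k \alpha_i^k\boxtimes\Big(\big((\widetilde{ev}_i\circ(1_i\otimes\alpha_{i,k}))\otimes 1_Y\big)\circ\iota\Big).$$ **The transformations $b$ and $p$.** $FG(X,\gamma)=\bigoplus_i i^{\star}\otimes I_{i,(X,\gamma)}$ with the half-braiding given by $F$. $b_{(X,\gamma)}\colon (X,\gamma)\to FG(X,\gamma)$ has $i$-component $\sqrt{dim(i)}\,(1_{i^{\star}}\otimes(\pi\circ\Gamma_{i,(X,\gamma)}))\circ(\widetilde{coev}_i\otimes 1_X)$, and $p_{(X,\gamma)}\colon FG(X,\gamma)\to(X,\gamma)$ has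 restriction to the $i$-summand $\sqrt{dim(i)}\,(ev_i\otimes 1_X)\circ(1_{i^{\star}}\otimes(\Gamma_{i,(X,\gamma)}\circ\iota))$.
   Formalization: The dual bases are taken dual under Tr(ψ∘φ)/dim(i) instead of Tr(ψ∘φ): with the literal pairing and the given coefficients 1/√dim(i), q∘d would be Σ_i dim(i)^{-2} P_i ⊠ 1 (P_i: projection to the i*-isotypic part), not the identity (e.g. Fibonacci). *)

(* Defs.v *)
From HB Require Import structures.
From mathcomp Require Import all_boot all_algebra.
From Stdlib Require Import FunctionalExtensionality ProofIrrelevance.

Set Implicit Arguments.
Unset Strict Implicit.
Unset Printing Implicit Defensive.

Import GRing.Theory.
Local Open Scope ring_scope.

Declare Scope cat_scope.
Delimit Scope cat_scope with cat.

Reserved Notation "X \ot Y" (at level 40, left associativity).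
Reserved Notation "f \om g" (at level 40, left associativity).

Record category := Category {
  cob :> Type;
  chom : cob -> cob -> Type;
  cid : forall X, chom X X;
  ccomp : forall X Y Z, chom Y Z -> chom X Y -> chom X Z;
  ccompA : forall X Y Z W (h : chom Z W) (g : chom Y Z) (f : chom X Y),
    ccomp h (ccomp g f) = ccomp (ccomp h g) f;
  ccomp1f : forall X Y (f : chom X Y), ccomp (cid Y) f = f;
  ccompf1 : forall X Y (f : chom X Y), ccomp f (cid X) = f }.

(* The raw data of a functor; functoriality is the predicate [is_functor]. *)
Record prefunctor (A B : category) := PreFunctor {
  fob :> A -> B;
  fmor : forall X Y : A, chom X Y -> chom (fob X) (fob Y) }.

Definition is_functor (A B : category) (F : prefunctor A B) : Prop :=
  (forall X : A, fmor F (cid X) = cid (F X)) /\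
  (forall (X Y Z : A) (g : chom Y Z) (f : chom X Y),
     fmor F (ccomp g f) = ccomp (fmor F g) (fmor F f)).

Definition idF (A : category) : prefunctor A A :=
  @PreFunctor A A (fun X => X) (fun X Y f => f).

Definition compF (A B D : category) (G : prefunctor B D) (F : prefunctor A B) :
    prefunctor A D :=
  @PreFunctor A D (fun X => G (F X)) (fun X Y f => fmor G (fmor F f)).

Definition transf (A B : category) (F G : prefunctor A B) : Type :=
  forall X : A, chom (F X) (G X).

Definition natural (A B : category) (F G : prefunctor A B) (t : transf F G) :
    Prop :=
  forall (X Y : A) (f : chom X Y),
    ccomp (t Y) (fmor F f) = ccomp (fmor G f) (t X).

Definition mutually_inverse (A B : category) (F G : prefunctor A B)
    (s : transf F G) (t : transf G F) : Prop :=
  (forall X, ccomp (t X) (s X) = cid (F X)) /\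
  (forall X, ccomp (s X) (t X) = cid (G X)).

Definition inverse_nat_isos (A B : category) (F G : prefunctor A B)
    (s : transf F G) (t : transf G F) : Prop :=
  [/\ natural s, natural t & mutually_inverse s t].

Definition inverse_functor (A B : category) (F : prefunctor A B)
    (G : prefunctor B A) : Prop :=
  [/\ is_functor G,
      exists (d : transf (idF A) (compF G F)) (q : transf (compF G F) (idF A)),
        inverse_nat_isos d q
    & exists (b : transf (idF B) (compF F G)) (p : transf (compF F G) (idF B)),
        inverse_nat_isos b p].

Record lincat (k : fieldType) := LinCat {
  ob :> Type;
  hom : ob -> ob -> vectType k;
  idm : forall X, hom X X;
  comp : forall X Y Z, hom Y Z -> hom X Y -> hom X Z;
  compA : forall X Y Z W (h : hom Z W) (g : hom Y Z) (f : hom X Y),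
    comp h (comp g f) = comp (comp h g) f;
  comp1f : forall X Y (f : hom X Y), comp (idm Y) f = f;
  compf1 : forall X Y (f : hom X Y), comp f (idm X) = f;
  comp_linl : forall X Y Z (f : hom X Y), linear (fun g : hom Y Z => comp g f);
  comp_linr : forall X Y Z (g : hom Y Z), linear (fun f : hom X Y => comp g f) }.

Arguments idm {k C} X : rename.
Notation "g \o f" := (comp g f) : cat_scope.
Notation "'1_ X" := (idm X) (at level 8, X at level 2, format "''1_' X") :
  cat_scope.
Local Open Scope cat_scope.

Section LinCatDefs.
Variables (k : fieldType) (C : lincat k).
Implicit Types X Y Z K W : C.

Definition is_iso X Y (f : hom X Y) : Prop :=
  exists g : hom Y X, g \o f = '1_X /\ f \o g = '1_Y.

Definition isomorphic X Y : Prop := exists f : hom X Y, is_iso f.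

Definition mono X Y (f : hom X Y) : Prop :=
  forall W (g h : hom W X), f \o g = f \o h -> g = h.

Definition epi X Y (f : hom X Y) : Prop :=
  forall W (g h : hom Y W), g \o f = h \o f -> g = h.

Definition is_kernel X Y (f : hom X Y) K (m : hom K X) : Prop :=
  f \o m = 0 /\
  forall W (g : hom W X), f \o g = 0 -> exists! h : hom W K, m \o h = g.

Definition is_cokernel X Y (f : hom X Y) K (e : hom Y K) : Prop :=
  e \o f = 0 /\
  forall W (g : hom Y W), g \o f = 0 -> exists! h : hom K W, h \o e = g.

Definition simple X : Prop :=
  '1_X <> 0 /\ forall W (m : hom W X), mono m -> '1_W = 0 \/ is_iso m.

(* Chosen finite direct sums; n = 0 gives a zero object. *)
Record biproducts := Biproducts {
  dsum : forall n, ('I_n -> C) -> C;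
  dinj : forall n (X : 'I_n -> C) a, hom (X a) (dsum X);
  dproj : forall n (X : 'I_n -> C) a, hom (dsum X) (X a);
  dproj_inj : forall n (X : 'I_n -> C) a, dproj X a \o dinj X a = '1_(X a);
  dproj_inj0 : forall n (X : 'I_n -> C) a b,
    a <> b -> dproj X b \o dinj X a = 0;
  dsum_id : forall n (X : 'I_n -> C),
    \sum_(a < n) (dinj X a \o dproj X a) = '1_(dsum X) }.

(* What is required of an additive category in order to be abelian. *)
Definition abelian : Prop :=
  [/\ forall X Y (f : hom X Y), exists K (m : hom K X), is_kernel f m,
      forall X Y (f : hom X Y), exists K (e : hom Y K), is_cokernel f e,
      forall X Y (m : hom X Y), mono m ->
        exists Z (f : hom Y Z), is_kernel f m
    & forall X Y (e : hom X Y), epi e ->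
        exists Z (f : hom Z X), is_cokernel f e].

Definition semisimple (B : biproducts) : Prop :=
  forall X, exists n (S : 'I_n -> C),
    (forall a, simple (S a)) /\ isomorphic X (dsum B S).

End LinCatDefs.

Record monoidal (k : fieldType) := Monoidal {
  mcat :> lincat k;
  one : mcat;
  tens : mcat -> mcat -> mcat;
  tensm : forall X X' Y Y' : mcat,
    hom X X' -> hom Y Y' -> hom (tens X Y) (tens X' Y');
  tensm1 : forall X Y : mcat, tensm '1_X '1_Y = '1_(tens X Y);
  tensmM : forall (X X' X'' Y Y' Y'' : mcat)
    (f' : hom X' X'') (f : hom X X') (g' : hom Y' Y'') (g : hom Y Y'),
    tensm (f' \o f) (g' \o g) = tensm f' g' \o tensm f g;
  tensm_linl : forall (X X' Y Y' : mcat) (g : hom Y Y'),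
    linear (fun f : hom X X' => tensm f g);
  tensm_linr : forall (X X' Y Y' : mcat) (f : hom X X'),
    linear (fun g : hom Y Y' => tensm f g);
  asc : forall X Y Z : mcat, hom (tens (tens X Y) Z) (tens X (tens Y Z));
  asci : forall X Y Z : mcat, hom (tens X (tens Y Z)) (tens (tens X Y) Z);
  ascK : forall X Y Z : mcat, asci X Y Z \o asc X Y Z = '1_(tens (tens X Y) Z);
  asciK : forall X Y Z : mcat, asc X Y Z \o asci X Y Z = '1_(tens X (tens Y Z));
  asc_nat : forall (X X' Y Y' Z Z' : mcat)
    (f : hom X X') (g : hom Y Y') (h : hom Z Z'),
    asc X' Y' Z' \o tensm (tensm f g) h = tensm f (tensm g h) \o asc X Y Z;
  lun : forall X : mcat, hom (tens one X) X;
  luni : forall X : mcat, hom X (tens one X);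
  lunK : forall X : mcat, luni X \o lun X = '1_(tens one X);
  luniK : forall X : mcat, lun X \o luni X = '1_X;
  lun_nat : forall (X Y : mcat) (f : hom X Y),
    lun Y \o tensm '1_one f = f \o lun X;
  run : forall X : mcat, hom (tens X one) X;
  runi : forall X : mcat, hom X (tens X one);
  runK : forall X : mcat, runi X \o run X = '1_(tens X one);
  runiK : forall X : mcat, run X \o runi X = '1_X;
  run_nat : forall (X Y : mcat) (f : hom X Y),
    run Y \o tensm f '1_one = f \o run X;
  pentagon : forall X Y Z W : mcat,
    tensm '1_X (asc Y Z W) \o (asc X (tens Y Z) W \o tensm (asc X Y Z) '1_W)
    = asc X Y (tens Z W) \o asc (tens X Y) Z W;
  triangle : forall X Y : mcat,
    tensm '1_X (lun Y) \o asc X one Y = tensm (run X) '1_Y }.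

Arguments one {k} M : rename.
Notation "X \ot Y" := (tens X Y) : cat_scope.
Notation "f \om g" := (tensm f g) : cat_scope.

Record braiding (k : fieldType) (M : monoidal k) := Braiding {
  br : forall X Y : M, hom (X \ot Y) (Y \ot X);
  bri : forall X Y : M, hom (Y \ot X) (X \ot Y);
  brK : forall X Y : M, bri X Y \o br X Y = '1_(X \ot Y);
  briK : forall X Y : M, br X Y \o bri X Y = '1_(Y \ot X);
  br_nat : forall (X X' Y Y' : M) (f : hom X X') (g : hom Y Y'),
    br X' Y' \o (f \om g) = (g \om f) \o br X Y;
  br_hexl : forall X Y Z : M,
    br (X \ot Y) Z
    = asc Z X Y \o ((br X Z \om '1_Y)
        \o (asci X Z Y \o (('1_X \om br Y Z) \o asc X Y Z)));
  br_hexr : forall X Y Z : M,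
    br X (Y \ot Z)
    = asci Y Z X \o (('1_Y \om br X Z)
        \o (asc Y X Z \o ((br X Y \om '1_Z) \o asci X Y Z))) }.

Record fusion (k : fieldType) := Fusion {
  fmon :> monoidal k;
  bip : biproducts fmon;
  fabelian : abelian fmon;
  fsemisimple : semisimple bip;
  one_simple : simple (one fmon);
  (* left duals; with a braiding present, right duals follow *)
  dual : fmon -> fmon;
  ev : forall X : fmon, hom (dual X \ot X) (one fmon);
  coev : forall X : fmon, hom (one fmon) (X \ot dual X);
  zigzag1 : forall X : fmon,
    run X \o (('1_X \om ev X) \o (asc X (dual X) X
      \o ((coev X \om '1_X) \o luni X))) = '1_X;
  zigzag2 : forall X : fmon,
    lun (dual X) \o ((ev X \om '1_(dual X)) \o (asci (dual X) X (dual X)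
      \o (('1_(dual X) \om coev X) \o runi (dual X)))) = '1_(dual X);
  (* O(C): simple objects representing every isomorphism class exactly once *)
  rk : nat;
  irr : 'I_rk -> fmon;
  irr_simple : forall i, simple (irr i);
  irr_distinct : forall i j, isomorphic (irr i) (irr j) -> i = j;
  irr_exhaust : forall X : fmon, simple X -> exists i, isomorphic X (irr i) }.

Definition dualm (k : fieldType) (C : fusion k) (X Y : C) (f : hom X Y) :
    hom (dual Y) (dual X) :=
  lun (dual X) \o ((ev Y \om '1_(dual X)) \o (asci (dual Y) Y (dual X)
    \o (('1_(dual Y) \om (f \om '1_(dual X)))
    \o (('1_(dual Y) \om coev X) \o runi (dual Y))))).

(* A ribbon fusion category. *)
Record premodular (k : fieldType) := Premodular {
  pfus :> fusion k;
  pbr : braiding pfus;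
  twist : forall X : pfus, hom X X;
  twist_iso : forall X : pfus, is_iso (twist X);
  twist_nat : forall (X Y : pfus) (f : hom X Y),
    twist Y \o f = f \o twist X;
  twist_tens : forall X Y : pfus,
    twist (X \ot Y) = br pbr Y X \o (br pbr X Y \o (twist X \om twist Y));
  twist_dual : forall X : pfus, twist (dual X) = dualm (twist X) }.

Section Premodular.
Variables (k : fieldType) (C : premodular k).
Implicit Types X Y : C.

Definition cbr X Y : hom (X \ot Y) (Y \ot X) := br (pbr C) X Y.
Definition cbri X Y : hom (Y \ot X) (X \ot Y) := bri (pbr C) X Y.

(* The second pair of (co)evaluations coming from the spherical structure
   of a ribbon category: with the associated pivotal isomorphism
   psi_X : X -> X^**, evt X = ev (X^* ) \o (psi_X \om 1). *)
Definition evt X : hom (X \ot dual X) (one C) :=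
  ev X \o (cbr X (dual X) \o (twist X \om '1_(dual X))).
Definition coevt X : hom (one C) (dual X \ot X) :=
  ('1_(dual X) \om twist X) \o (cbr X (dual X) \o coev X).

(* The unit being simple and k algebraically closed, End(1) is the line
   spanned by the identity; [scal f] is the scalar by which f acts. *)
Definition scal (f : hom (one C) (one C)) : k := coord [tuple '1_(one C)] ord0 f.

Definition Tr X (f : hom X X) : k :=
  scal (evt X \o ((f \om '1_(dual X)) \o coev X)).

Definition qdim X : k := Tr '1_X.

Definition dimOmega : k := \sum_(j < rk C) qdim (irr j) ^+ 2.

Definition modular : Prop :=
  \matrix_(i, j) Tr (cbr (irr j) (irr i) \o cbr (irr i) (irr j))
    \in unitmx (n := rk C).

End Premodular.

Section LinearMaps.
Variable k : fieldType.

Lemma lin_sum (U V : lmodType k) (f : U -> V) (lf : linear f) I r (P : pred I) F :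
  f (\sum_(i <- r | P i) F i) = \sum_(i <- r | P i) f (F i).
Proof.
pose L := GRing.isLinear.Build _ _ _ _ f lf.
pose g : {linear U -> V} := HB.pack f L.
exact: (linear_sum g).
Qed.

Lemma lin_scale (U V : lmodType k) (f : U -> V) (lf : linear f) a u :
  f (a *: u) = a *: f u.
Proof.
pose L := GRing.isLinear.Build _ _ _ _ f lf.
pose g : {linear U -> V} := HB.pack f L.
exact: (linearZ_LR g).
Qed.

Lemma lin0 (U V : lmodType k) (f : U -> V) (lf : linear f) : f 0 = 0.
Proof. by rewrite -(scale0r 0) lin_scale // scale0r. Qed.

End LinearMaps.

Section LinCalculus.
Variables (k : fieldType) (C : lincat k).
Implicit Types X Y Z A : C.

Lemma compE2 X Y Y' (f : hom X Y) (g : hom Y Y') h :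
  g \o f = h -> forall A (u : hom A X), g \o (f \o u) = h \o u.
Proof. by move=> <- A u; rewrite compA. Qed.

Lemma comp0l X Y Z (f : hom X Y) : (0 : hom Y Z) \o f = 0.
Proof. exact: (lin0 (comp_linl f)). Qed.
Lemma comp0r X Y Z (g : hom Y Z) : g \o (0 : hom X Y) = 0.
Proof. exact: (lin0 (comp_linr g)). Qed.
Lemma comp_suml X Y Z (f : hom X Y) I r (P : pred I) (G : I -> hom Y Z) :
  (\sum_(i <- r | P i) G i) \o f = \sum_(i <- r | P i) (G i \o f).
Proof. exact: (lin_sum (comp_linl f)). Qed.
Lemma comp_sumr X Y Z (g : hom Y Z) I r (P : pred I) (G : I -> hom X Y) :
  g \o (\sum_(i <- r | P i) G i) = \sum_(i <- r | P i) (g \o G i).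
Proof. exact: (lin_sum (comp_linr g)). Qed.

End LinCalculus.

Section MonCalculus.
Variables (k : fieldType) (M : monoidal k).
Implicit Types X Y Z W A B : M.

Lemma tensm_suml X X' Y Y' (g : hom Y Y') I r (P : pred I) (G : I -> hom X X') :
  (\sum_(i <- r | P i) G i) \om g = \sum_(i <- r | P i) (G i \om g).
Proof. exact: (lin_sum (tensm_linl g)). Qed.
Lemma tensm_sumr X X' Y Y' (f : hom X X') I r (P : pred I) (G : I -> hom Y Y') :
  f \om (\sum_(i <- r | P i) G i) = \sum_(i <- r | P i) (f \om G i).
Proof. exact: (lin_sum (tensm_linr f)). Qed.
Lemma tensm0l X X' Y Y' (g : hom Y Y') : (0 : hom X X') \om g = 0.
Proof. exact: (lin0 (tensm_linl g)). Qed.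
Lemma tensm0r X X' Y Y' (f : hom X X') : f \om (0 : hom Y Y') = 0.
Proof. exact: (lin0 (tensm_linr f)). Qed.

Lemma asci_nat X X' Y Y' Z Z' (f : hom X X') (g : hom Y Y') (h : hom Z Z') :
  asci X' Y' Z' \o (f \om (g \om h)) = ((f \om g) \om h) \o asci X Y Z.
Proof.
rewrite -[LHS]compf1 -(asciK X Y Z) compA -(compA _ _ (asc X Y Z)) -asc_nat.
by rewrite (compA (asci X' Y' Z')) ascK comp1f.
Qed.

Lemma tens_split X X' Y Y' (f : hom X X') (g : hom Y Y') :
  f \om g = (f \om '1_Y') \o ('1_X \om g).
Proof. by rewrite -tensmM compf1 comp1f. Qed.

Lemma tens_swap X X' Y Y' (f : hom X X') (g : hom Y Y') :
  ('1_X' \om g) \o (f \om '1_Y) = (f \om '1_Y') \o ('1_X \om g).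
Proof. by rewrite -!tensmM !compf1 !comp1f. Qed.

Lemma tens1M X Y Y' Y'' (g' : hom Y' Y'') (g : hom Y Y') :
  '1_X \om (g' \o g) = ('1_X \om g') \o ('1_X \om g).
Proof. by rewrite -tensmM comp1f. Qed.

Lemma tensM1 X Y Y' Y'' (g' : hom Y' Y'') (g : hom Y Y') :
  (g' \o g) \om '1_X = (g' \om '1_X) \o (g \om '1_X).
Proof. by rewrite -tensmM comp1f. Qed.

End MonCalculus.

Record half_braiding (k : fieldType) (M : monoidal k) (X : M) := HalfBraiding {
  hb :> forall Z : M, hom (Z \ot X) (X \ot Z);
  hb_nat : forall (Z W : M) (f : hom Z W),
    hb W \o (f \om '1_X) = ('1_X \om f) \o hb Z;
  hb_iso : forall Z : M, is_iso (hb Z);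
  hb_tens : forall Z W : M,
    hb (Z \ot W)
    = asc X Z W \o ((hb Z \om '1_W)
        \o (asci Z X W \o (('1_Z \om hb W) \o asc Z W X))) }.

Section Center.
Variables (k : fieldType) (M : monoidal k).

Record zobj := ZObj { zob :> M; zhb : half_braiding zob }.

Definition zcompat (X Y : zobj) (f : hom X Y) : Prop :=
  forall Z : M, zhb Y Z \o ('1_Z \om f) = (f \om '1_Z) \o zhb X Z.

Record zhom (X Y : zobj) := ZHom { zmor :> hom X Y; zmorP : zcompat zmor }.

Lemma zhom_eq (X Y : zobj) (f g : zhom X Y) : zmor f = zmor g -> f = g.
Proof.
case: f g => [f fP] [g gP] /= E; case: _ / E gP => gP.
by rewrite (proof_irrelevance _ fP gP).
Qed.

Lemma zid_compat (X : zobj) : zcompat '1_X.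
Proof. by move=> Z; rewrite !tensm1 comp1f compf1. Qed.

Lemma zcomp_compat (X Y Z : zobj) (g : zhom Y Z) (f : zhom X Y) :
  zcompat (zmor g \o zmor f).
Proof.
by move=> W; rewrite tens1M tensM1 compA (zmorP g) -!compA (zmorP f).
Qed.

Definition center : category.
Proof.
refine (@Category zobj zhom (fun X => ZHom (@zid_compat X))
  (fun X Y Z g f => ZHom (zcomp_compat g f)) _ _ _).
- by move=> *; apply: zhom_eq; rewrite /= compA.
- by move=> *; apply: zhom_eq; rewrite /= comp1f.
- by move=> *; apply: zhom_eq; rewrite /= compf1.
Defined.

End Center.

Section TensorHalfBraiding.
Variables (k : fieldType) (M : monoidal k).
Implicit Types X Y Z W : M.

Lemma hb_natE X (g : half_braiding X) A Z W (f : hom Z W) (u : hom A (Z \ot X)) :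
  g W \o ((f \om '1_X) \o u) = ('1_X \om f) \o (g Z \o u).
Proof. by rewrite compA hb_nat -compA. Qed.

Lemma is_iso_comp X Y Z (g : hom Y Z) (f : hom X Y) :
  is_iso g -> is_iso f -> is_iso (g \o f).
Proof.
move=> [g' [g1 g2]] [f' [f1 f2]]; exists (f' \o g'); split.
  by rewrite -compA (compA g') g1 comp1f.
by rewrite -compA (compA f) f2 comp1f.
Qed.

Lemma is_iso_tens X X' Y Y' (f : hom X X') (g : hom Y Y') :
  is_iso f -> is_iso g -> is_iso (f \om g).
Proof.
move=> [f' [f1 f2]] [g' [g1 g2]]; exists (f' \om g').
by rewrite -!tensmM f1 f2 g1 g2 !tensm1.
Qed.

Lemma is_iso_id X : is_iso '1_X.
Proof. by exists '1_X; rewrite comp1f. Qed.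

Lemma is_iso_asc X Y Z : is_iso (asc X Y Z).
Proof. by exists (asci X Y Z); rewrite ascK asciK. Qed.

Lemma is_iso_asci X Y Z : is_iso (asci X Y Z).
Proof. by exists (asc X Y Z); rewrite ascK asciK. Qed.

Lemma pentagon_inv X Y Z W :
  (asci X Y Z \om '1_W) \o (asci X (Y \ot Z) W \o ('1_X \om asci Y Z W))
  = asci (X \ot Y) Z W \o asci X Y (Z \ot W).
Proof.
have K1 : (asc X Y Z \om '1_W) \o (asci X Y Z \om '1_W) = '1__.
  by rewrite -tensM1 asciK tensm1.
have K2 : ('1_X \om asc Y Z W) \o ('1_X \om asci Y Z W) = '1__.
  by rewrite -tens1M asciK tensm1.
rewrite -[LHS]comp1f -(ascK (X \ot Y)) -(comp1f (asc (X \ot Y) _ _)).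
rewrite -(ascK X Y (Z \ot W)) -(compA (asci X Y _)) -pentagon -!compA.
by rewrite (compE2 K1) comp1f (compE2 (asciK _ _ _)) comp1f K2 compf1.
Qed.

Variables (X Y : M) (g : half_braiding X) (d : half_braiding Y).

Definition hbT_mor Z : hom (Z \ot (X \ot Y)) ((X \ot Y) \ot Z) :=
  asci X Y Z \o (('1_X \om d Z)
    \o (asc X Z Y \o ((g Z \om '1_Y) \o asci Z X Y))).

Lemma hbT_nat Z W (f : hom Z W) :
  hbT_mor W \o (f \om '1_(X \ot Y)) = ('1_(X \ot Y) \om f) \o hbT_mor Z.
Proof.
rewrite /hbT_mor -!compA -(tensm1 X Y) asci_nat.
rewrite (compA (g W \om _)) -tensM1 hb_nat tensM1 -!compA.
rewrite (compA (asc X W Y)) asc_nat -!compA.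
rewrite (compA ('1_X \om d W)) -tens1M hb_nat tens1M -!compA.
by rewrite (compA (asci X Y W)) asci_nat -!compA.
Qed.

Lemma hbT_iso Z : is_iso (hbT_mor Z).
Proof.
have i1 := is_iso_id; have iT := is_iso_tens.
apply: is_iso_comp; first exact: is_iso_asci.
apply: is_iso_comp; first by apply: iT => //; apply: hb_iso.
apply: is_iso_comp; first exact: is_iso_asc.
apply: is_iso_comp; first by apply: iT => //; apply: hb_iso.
exact: is_iso_asci.
Qed.

Lemma hbT_tens Z W :
  hbT_mor (Z \ot W)
  = asc (X \ot Y) Z W \o ((hbT_mor Z \om '1_W)
      \o (asci Z (X \ot Y) W \o (('1_Z \om hbT_mor W) \o asc Z W (X \ot Y)))).
Proof.
rewrite /hbT_mor !hb_tens !tens1M !tensM1 -!compA.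
have pL : ('1_X \om asc Z W Y) \o (asc X (Z \ot W) Y \o ((asc X Z W \om '1_Y)))
    = asc X Z (W \ot Y) \o asc (X \ot Z) W Y by exact: pentagon.
have {}pL A (u : hom A _) :
    ('1_X \om asc Z W Y) \o (asc X (Z \ot W) Y \o ((asc X Z W \om '1_Y) \o u))
    = asc X Z (W \ot Y) \o (asc (X \ot Z) W Y \o u).
  by rewrite (compA (asc X (Z \ot W) Y)) (compE2 pL) -compA.
rewrite pL.
rewrite (compA (asc (X \ot Z) W Y)) asc_nat tensm1 -!compA.
have E1 : ('1_X \om ('1_Z \om d W)) \o asc X Z (W \ot Y)
    = asc X Z (Y \ot W) \o ('1_(X \ot Z) \om d W).
  by rewrite -asc_nat tensm1.
rewrite (compE2 E1) -!compA.
rewrite (compA ('1_(X \ot Z) \om d W)) tens_swap -!compA.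
have pR : (asci Z X Y \om '1_W) \o (asci Z (X \ot Y) W \o ('1_Z \om asci X Y W))
    = asci (Z \ot X) Y W \o asci Z X (Y \ot W) by exact: pentagon_inv.
have {}pR A (u : hom A _) :
    (asci Z X Y \om '1_W) \o (asci Z (X \ot Y) W \o (('1_Z \om asci X Y W) \o u))
    = asci (Z \ot X) Y W \o (asci Z X (Y \ot W) \o u).
  by rewrite (compA (asci Z (X \ot Y) W)) (compE2 pR) -compA.
rewrite pR.
rewrite (compA (asci Z X (Y \ot W))) asci_nat tensm1 -!compA.
have E2 : ((g Z \om '1_Y) \om '1_W) \o asci (Z \ot X) Y W
    = asci (X \ot Z) Y W \o (g Z \om '1_(Y \ot W)).
  by rewrite -asci_nat tensm1.
rewrite (compE2 E2) -!compA.
have L : asci X Y (Z \ot W) \o (('1_X \om asc Y Z W) \o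
     (('1_X \om (d Z \om '1_W)) \o (('1_X \om asci Z Y W) \o asc X Z (Y \ot W))))
  = asc (X \ot Y) Z W \o ((asci X Y Z \om '1_W) \o
     ((('1_X \om d Z) \om '1_W) \o ((asc X Z Y \om '1_W) \o asci (X \ot Z) Y W))).
  have P1 : ('1_X \om asci Z Y W) \o asc X Z (Y \ot W)
      = asc X (Z \ot Y) W \o ((asc X Z Y \om '1_W) \o asci (X \ot Z) Y W).
    have := pentagon X Z Y W => P.
    rewrite -[asc X Z (Y \ot W)]compf1 -(asciK (X \ot Z) Y W).
    rewrite (compA (asc X Z _)) -P -!compA.
    have K : ('1_X \om asci Z Y W) \o ('1_X \om asc Z Y W) = '1__.
      by rewrite -tens1M ascK tensm1.
    by rewrite (compE2 K) comp1f.
  rewrite P1 (compA ('1_X \om (d Z \om _))) -asc_nat -!compA.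
  have P2 A (u : hom A _) : asci X Y (Z \ot W) \o (('1_X \om asc Y Z W) \o
      (asc X (Y \ot Z) W \o u)) = asc (X \ot Y) Z W \o ((asci X Y Z \om '1_W) \o u).
    rewrite -[u in LHS]comp1f.
    have K : (asc X Y Z \om '1_W) \o (asci X Y Z \om '1_W) = '1__.
      by rewrite -tensM1 asciK tensm1.
    rewrite -K -!compA (compA (asc X _ _)) (compA ('1_X \om _)) pentagon.
    by rewrite -!compA (compE2 (ascK _ _ _)) comp1f.
  by rewrite P2.
have {}L A (u : hom A _) : asci X Y (Z \ot W) \o (('1_X \om asc Y Z W) \o
     (('1_X \om (d Z \om '1_W)) \o (('1_X \om asci Z Y W) \o
       (asc X Z (Y \ot W) \o u))))
  = asc (X \ot Y) Z W \o ((asci X Y Z \om '1_W) \o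
     ((('1_X \om d Z) \om '1_W) \o ((asc X Z Y \om '1_W) \o
       (asci (X \ot Z) Y W \o u)))).
  by have := congr1 (fun h => h \o u) L; rewrite -!compA.
rewrite L; do 6!congr (_ \o _).
have P3 : (asci Z X W \om '1_Y) \o (asci Z (X \ot W) Y \o ('1_Z \om asci X W Y))
    = asci (Z \ot X) W Y \o asci Z X (W \ot Y) by exact: pentagon_inv.
have P4 : asci Z X (W \ot Y) \o ('1_Z \om asc X W Y)
    = asc (Z \ot X) W Y \o ((asci Z X W \om '1_Y) \o asci Z (X \ot W) Y).
  have K : ('1_Z \om asci X W Y) \o ('1_Z \om asc X W Y) = '1__.
    by rewrite -tens1M ascK tensm1.
  rewrite -[LHS]comp1f -(asciK (Z \ot X) W Y) -!compA (compA (asci _ W Y)) -P3.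
  by rewrite -!compA K compf1.
rewrite (compE2 P4) -!compA; do 2!congr (_ \o _).
rewrite (compA (asci Z (X \ot W) Y)) asci_nat -!compA; congr (_ \o _).
have P5 : (asci Z W X \om '1_Y) \o (asci Z (W \ot X) Y \o ('1_Z \om asci W X Y))
    = asci (Z \ot W) X Y \o asci Z W (X \ot Y) by exact: pentagon_inv.
have K : (asc Z W X \om '1_Y) \o (asci Z W X \om '1_Y) = '1__.
  by rewrite -tensM1 asciK tensm1.
rewrite -[asci (Z \ot W) X Y]compf1 -(ascK Z W (X \ot Y)).
by rewrite (compA (asci _ X Y)) -P5 -!compA (compE2 K) comp1f.
Qed.

Definition hbT : half_braiding (X \ot Y) :=
  HalfBraiding hbT_nat hbT_iso hbT_tens.

End TensorHalfBraiding.

Section SumHalfBraiding.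
Variables (k : fieldType) (M : monoidal k) (B : biproducts M).
Variables (n : nat) (X : 'I_n -> M) (g : forall a, half_braiding (X a)).
Implicit Types Z W : M.

Definition hbS_mor Z : hom (Z \ot dsum B X) (dsum B X \ot Z) :=
  \sum_a ((dinj B X a \om '1_Z) \o (g a Z \o ('1_Z \om dproj B X a))).

Lemma hbS_projl Z b :
  (dproj B X b \om '1_Z) \o hbS_mor Z = g b Z \o ('1_Z \om dproj B X b).
Proof.
rewrite comp_sumr (bigD1 b) //= compA -tensM1 dproj_inj tensm1 comp1f.
rewrite big1 ?addr0 // => a /eqP ab.
by rewrite compA -tensM1 dproj_inj0 // tensm0l comp0l.
Qed.

Lemma hbS_injr Z b :
  hbS_mor Z \o ('1_Z \om dinj B X b) = (dinj B X b \om '1_Z) \o g b Z.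
Proof.
rewrite comp_suml (bigD1 b) //= -!compA -tens1M dproj_inj tensm1 compf1.
rewrite big1 ?addr0 // => a /eqP ab.
by rewrite -!compA -tens1M dproj_inj0 ?tensm0r ?comp0r //; apply/nesym.
Qed.

Lemma hbS_nat Z W (f : hom Z W) :
  hbS_mor W \o (f \om '1_(dsum B X)) = ('1_(dsum B X) \om f) \o hbS_mor Z.
Proof.
rewrite comp_suml comp_sumr; apply: eq_bigr => a _; rewrite -!compA.
rewrite tens_swap (compA (g a W)) hb_nat -!compA.
by rewrite (compA (dinj _ _ _ \om _)) -tens_swap -!compA.
Qed.

Lemma hbS_iso Z : is_iso (hbS_mor Z).
Proof.
have [gi giP] : exists gi : forall a, hom (X a \ot Z) (Z \ot X a), forall a,
    gi a \o g a Z = '1_(Z \ot X a) /\ g a Z \o gi a = '1_(X a \ot Z).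
  have gx a : { gi : hom (X a \ot Z) (Z \ot X a) |
      (gi \o g a Z == '1_(Z \ot X a)) && (g a Z \o gi == '1_(X a \ot Z)) }.
    apply: sigW; have [gi [E1 E2]] := hb_iso (g a) Z.
    by exists gi; rewrite E1 E2 !eqxx.
  exists (fun a => sval (gx a)) => a.
  by case: (svalP (gx a)) => /andP[/eqP-> /eqP->].
exists (\sum_a (('1_Z \om dinj B X a) \o (gi a \o (dproj B X a \om '1_Z)))).
split.
  rewrite comp_suml -[RHS]tensm1 -dsum_id tensm_sumr; apply: eq_bigr => a _.
  rewrite -!compA hbS_projl (compA (gi a)) (giP a).1 comp1f.
  by rewrite -tens1M.
rewrite comp_sumr -[RHS]tensm1 -dsum_id tensm_suml; apply: eq_bigr => a _.
rewrite compA hbS_injr -!compA (compA (g a Z)) (giP a).2 comp1f.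
by rewrite -tensM1.
Qed.

Lemma hbS_tens Z W :
  hbS_mor (Z \ot W)
  = asc (dsum B X) Z W \o ((hbS_mor Z \om '1_W)
      \o (asci Z (dsum B X) W \o (('1_Z \om hbS_mor W) \o asc Z W (dsum B X)))).
Proof.
rewrite {3}/hbS_mor tensm_sumr comp_suml !comp_sumr; apply: eq_bigr => a _.
rewrite !tens1M -!compA (compA (asci Z _ W)) asci_nat -!compA.
rewrite (compA (hbS_mor Z \om _)) -tensM1 hbS_injr tensM1 -!compA.
rewrite (compA (asc _ Z W)) asc_nat tensm1 -!compA; congr (_ \o _).
by rewrite hb_tens -!compA -asc_nat tensm1.
Qed.

Definition hbS : half_braiding (dsum B X) :=
  HalfBraiding hbS_nat hbS_iso hbS_tens.

End SumHalfBraiding.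

Lemma hbS_compat (k : fieldType) (M : monoidal k) (B : biproducts M)
    (n m : nat) (X : 'I_n -> M) (Y : 'I_m -> M)
    (g : forall a, half_braiding (X a)) (h : forall b, half_braiding (Y b))
    a b (t : hom (X a) (Y b)) :
  (forall Z : M, h b Z \o ('1_Z \om t) = (t \om '1_Z) \o g a Z) ->
  zcompat (X := ZObj (hbS B g)) (Y := ZObj (hbS B h))
    (dinj B Y b \o (t \o dproj B X a)).
Proof.
move=> tP Z /=; rewrite !tens1M !tensM1 compA hbS_injr -!compA.
by rewrite hbS_projl (compA (h b Z)) tP -compA.
Qed.

Section BraidingHalfBraiding.
Variables (k : fieldType) (M : monoidal k).
Implicit Types X Y Z W : M.

Lemma bri_nat (b : braiding M) X X' Y Y' (f : hom X X') (g : hom Y Y') :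
  bri b X' Y' \o (g \om f) = (f \om g) \o bri b X Y.
Proof.
rewrite -[LHS]compf1 -(briK b X Y) compA -(compA (bri _ _ _)) -br_nat.
by rewrite (compA (bri _ _ _)) brK comp1f.
Qed.

Lemma inv_unique X Y (f : hom X Y) (g h : hom Y X) :
  g \o f = '1_X -> f \o h = '1_Y -> g = h.
Proof. by move=> gf fh; rewrite -[g]compf1 -fh compA gf comp1f. Qed.

(* The opposite braiding c^{-1}_{Y,X} : X (x) Y -> Y (x) X, i.e. C^bop. *)
Definition bop (b : braiding M) : braiding M.
Proof.
refine (@Braiding _ M (fun X Y => bri b Y X) (fun X Y => br b Y X) _ _ _ _ _).
- by move=> X Y; apply: briK.
- by move=> X Y; apply: brK.
- by move=> X X' Y Y' f g; apply: bri_nat.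
- move=> X Y Z; apply: (@inv_unique _ _ (br b Z (X \ot Y))); first exact: brK.
  rewrite br_hexr -!compA.
  have K1 : (br b Z X \om '1_Y) \o (bri b Z X \om '1_Y) = '1__.
    by rewrite -tensM1 briK tensm1.
  have K2 : ('1_X \om br b Z Y) \o ('1_X \om bri b Z Y) = '1__.
    by rewrite -tens1M briK tensm1.
  rewrite (compE2 (ascK _ _ _)) comp1f (compE2 K1) comp1f.
  by rewrite (compE2 (asciK _ _ _)) comp1f (compE2 K2) comp1f ascK.
- move=> X Y Z; apply: (@inv_unique _ _ (br b (Y \ot Z) X)); first exact: brK.
  rewrite br_hexl -!compA.
  have K1 : (br b Y X \om '1_Z) \o (bri b Y X \om '1_Z) = '1__.
    by rewrite -tensM1 briK tensm1.
  have K2 : ('1_Y \om br b Z X) \o ('1_Y \om bri b Z X) = '1__.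
    by rewrite -tens1M briK tensm1.
  rewrite (compE2 (asciK _ _ _)) comp1f (compE2 K2) comp1f.
  by rewrite (compE2 (ascK _ _ _)) comp1f (compE2 K1) comp1f asciK.
Defined.

Variable b : braiding M.

Lemma hbB_nat X Z W (f : hom Z W) :
  br b W X \o (f \om '1_X) = ('1_X \om f) \o br b Z X.
Proof. exact: br_nat. Qed.

Lemma hbB_iso X Z : is_iso (br b Z X).
Proof. by exists (bri b Z X); rewrite brK briK. Qed.

Lemma hbB_tens X Z W :
  br b (Z \ot W) X
  = asc X Z W \o ((br b Z X \om '1_W)
      \o (asci Z X W \o (('1_Z \om br b W X) \o asc Z W X))).
Proof. exact: br_hexl. Qed.

Definition hbB X : half_braiding X :=
  HalfBraiding (@hbB_nat X) (@hbB_iso X) (@hbB_tens X).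

End BraidingHalfBraiding.

Section TensorProduct.
Variable k : fieldType.
Implicit Types U V W : vectType k.

(* U (x) V, in coordinates: the (i, j) entry is the coefficient of
   e_i (x) f_j, for the bases e = vbasis of U and f = vbasis of V. *)
Definition tprod U V : vectType k := 'M[k]_(\dim {:U}, \dim {:V}).

Definition tpure U V (u : U) (v : V) : tprod U V :=
  \matrix_(i, j) (coord (vbasis {:U}) i u * coord (vbasis {:V}) j v).

(* The linear map U (x) V -> W induced by a bilinear map B. *)
Definition tlift U V W (B : U -> V -> W) (t : tprod U V) : W :=
  \sum_i \sum_j t i j *: B (vbasis {:U})`_i (vbasis {:V})`_j.

Definition bilin U V W (B : U -> V -> W) : Prop :=
  (forall v, linear (fun u => B u v)) /\ (forall u, linear (B u)).

Lemma tlift_linear U V W (B : U -> V -> W) : linear (tlift B).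
Proof.
move=> a s t; rewrite /tlift scaler_sumr -big_split; apply: eq_bigr => i _.
rewrite scaler_sumr -big_split; apply: eq_bigr => j _ /=.
by rewrite !mxE scalerDl scalerA.
Qed.

Lemma tlift_pure U V W (B : U -> V -> W) u v :
  bilin B -> tlift B (tpure u v) = B u v.
Proof.
move=> [Bl Br].
rewrite [in RHS](coord_vbasis (memvf u)) (lin_sum (Bl v)).
apply: eq_bigr => i _; rewrite (lin_scale (Bl v)).
rewrite [in RHS](coord_vbasis (memvf v)) (lin_sum (Br _)) scaler_sumr.
by apply: eq_bigr => j _; rewrite (lin_scale (Br _)) mxE scalerA.
Qed.

Lemma tpure_bilin U V : bilin (@tpure U V).
Proof.
split=> [v a u u' | u a v v']; apply/matrixP=> i j; rewrite !mxE linearP /=.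
  by rewrite mulrDl mulrA.
by rewrite mulrDr mulrCA.
Qed.

Lemma tlift_id U V (t : tprod U V) : tlift (@tpure U V) t = t.
Proof.
apply/matrixP=> i j; rewrite /tlift summxE (bigD1 i) //= summxE (bigD1 j) //=.
have cE (T : vectType k) (a b : 'I_(\dim {:T})) :
    coord (vbasis {:T}) a (vbasis {:T})`_b = (b == a)%:R.
  by rewrite coord_free // (basis_free (vbasisP _)).
rewrite !mxE !cE !eqxx !mulr1 big1 => [|j' /negbTE nj]; last first.
  by rewrite !mxE !cE nj !mulr0.
rewrite big1 => [|i' /negbTE ni]; first by rewrite !addr0.
by rewrite summxE big1 // => j' _; rewrite !mxE !cE ni mul0r mulr0.
Qed.

Lemma tens_ext U V W (f g : tprod U V -> W) :
  linear f -> linear g -> (forall u v, f (tpure u v) = g (tpure u v)) -> f =1 g.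
Proof.
move=> lf lg fg t; rewrite -(tlift_id t) /tlift.
rewrite (lin_sum lf) (lin_sum lg); apply: eq_bigr => i _.
rewrite (lin_sum lf) (lin_sum lg); apply: eq_bigr => j _.
by rewrite (lin_scale lf) (lin_scale lg) fg.
Qed.

End TensorProduct.

Section TensorComposition.
Variables (k : fieldType) (C D : lincat k).

(* (h' (x) g') o (h (x) g) = (h' o h) (x) (g' o g), extended bilinearly *)
Definition tcomp (X X' X'' : C) (Y Y' Y'' : D)
    (N : tprod (hom X' X'') (hom Y' Y'')) (M : tprod (hom X X') (hom Y Y')) :
    tprod (hom X X'') (hom Y Y'') :=
  tlift (fun h' g' => tlift (fun h g => tpure (h' \o h) (g' \o g)) M) N.

Lemma linear_comp (U V W : lmodType k) (f : V -> W) (g : U -> V) :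
  linear f -> linear g -> linear (fun u => f (g u)).
Proof. by move=> lf lg a u v; rewrite lg lf. Qed.

Section Fixed.
Variables (X X' X'' : C) (Y Y' Y'' : D).
Implicit Types (N : tprod (hom X' X'') (hom Y' Y'')).
Implicit Types (M : tprod (hom X X') (hom Y Y')).

Lemma tcomp_linl M : linear (fun N => tcomp N M).
Proof. exact: tlift_linear. Qed.

Lemma tpure_bilin2 (h' : hom X' X'') (g' : hom Y' Y'') :
  bilin (fun (h : hom X X') (g : hom Y Y') => tpure (h' \o h) (g' \o g)).
Proof.
have [tl tr] := tpure_bilin (hom X X'') (hom Y Y'').
split=> [g | h].
  exact: (linear_comp (tl _) (comp_linr h')).
exact: (linear_comp (tr _) (comp_linr g')).
Qed.

Lemma tcomp_bilin1 M : bilin (fun (h' : hom X' X'') (g' : hom Y' Y'') =>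
  tlift (fun (h : hom X X') (g : hom Y Y') => tpure (h' \o h) (g' \o g)) M).
Proof.
have [tl tr] := tpure_bilin (hom X X'') (hom Y Y'').
split=> [g' | h'] a u v; rewrite /tlift scaler_sumr -big_split /=;
  apply: eq_bigr => i _; rewrite scaler_sumr -big_split /=;
  apply: eq_bigr => j _; rewrite comp_linl (tl, tr) scalerDr;
  by rewrite !scalerA mulrC.
Qed.

Lemma tcomp_linr N :
  linear (@tcomp X X' X'' Y Y' Y'' N).
Proof.
have tE M : tcomp N M = \sum_i \sum_j N i j *: tlift (fun h g => tpure
  ((vbasis {:hom X' X''})`_i \o h) ((vbasis {:hom Y' Y''})`_j \o g)) M by [].
move=> a s t; rewrite !tE scaler_sumr -big_split /=.
apply: eq_bigr => i _; rewrite scaler_sumr -big_split /=; apply: eq_bigr => j _.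
by rewrite tlift_linear scalerDr !scalerA mulrC.
Qed.

Lemma tcomp_pure (h' : hom X' X'') (g' : hom Y' Y'') (h : hom X X')
    (g : hom Y Y') :
  tcomp (tpure h' g') (tpure h g) = tpure (h' \o h) (g' \o g).
Proof.
rewrite /tcomp tlift_pure; last exact: tcomp_bilin1.
by rewrite tlift_pure //; apply: tpure_bilin2.
Qed.

End Fixed.

Lemma tcompA (X X' X'' X3 : C) (Y Y' Y'' Y3 : D)
    (L : tprod (hom X'' X3) (hom Y'' Y3)) (N : tprod (hom X' X'') (hom Y' Y''))
    (M : tprod (hom X X') (hom Y Y')) :
  tcomp L (tcomp N M) = tcomp (tcomp L N) M.
Proof.
apply: (tens_ext (f := fun L => _) (g := fun L => tcomp (tcomp L N) M)).
- exact: tcomp_linl.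
- exact: (linear_comp (@tcomp_linl _ _ _ _ _ _ M) (@tcomp_linl _ _ _ _ _ _ N)).
move=> l1 l2; set P := tpure l1 l2.
apply: (tens_ext (f := fun N => tcomp P (tcomp N M))
                 (g := fun N => tcomp (tcomp P N) M)).
- exact: (linear_comp (@tcomp_linr _ _ _ _ _ _ P) (@tcomp_linl _ _ _ _ _ _ M)).
- exact: (linear_comp (@tcomp_linl _ _ _ _ _ _ M) (@tcomp_linr _ _ _ _ _ _ P)).
move=> n1 n2; set Q := tpure n1 n2.
apply: (tens_ext (f := fun M => tcomp P (tcomp Q M))
                 (g := tcomp (tcomp P Q))).
- exact: (linear_comp (@tcomp_linr _ _ _ _ _ _ P) (@tcomp_linr _ _ _ _ _ _ Q)).
- exact: tcomp_linr.
by move=> m1 m2; rewrite !tcomp_pure !compA.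
Qed.

Lemma tcomp1f (X X' : C) (Y Y' : D) (M : tprod (hom X X') (hom Y Y')) :
  tcomp (tpure '1_X' '1_Y') M = M.
Proof.
apply: (tens_ext (f := tcomp _) (g := id)); first exact: tcomp_linr.
  by [].
by move=> u v; rewrite tcomp_pure !comp1f.
Qed.

Lemma tcompf1 (X X' : C) (Y Y' : D) (M : tprod (hom X X') (hom Y Y')) :
  tcomp M (tpure '1_X '1_Y) = M.
Proof.
apply: (tens_ext (f := fun M => tcomp M _) (g := id)); first exact: tcomp_linl.
  by [].
by move=> u v; rewrite tcomp_pure !compf1.
Qed.

End TensorComposition.

(* The family equal to [d i] at (i, i) and to [z i j] off the diagonal. *)
Definition on_diag (n : nat) (P : 'I_n -> 'I_n -> Type) (d : forall i, P i i)
    (z : forall i j, P i j) (i j : 'I_n) : P i j :=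
  match i =P j with
  | ReflectT e => match e in _ = j' return P i j' with erefl => d i end
  | ReflectF _ => z i j
  end.

Lemma on_diag_eq n P d z i : @on_diag n P d z i i = d i.
Proof.
rewrite /on_diag; case: (i =P i) => // e.
by rewrite (eq_irrelevance e erefl).
Qed.

Lemma on_diag_neq n P d z i j : i <> j -> @on_diag n P d z i j = z i j.
Proof. by rewrite /on_diag; case: (i =P j). Qed.

Section Deligne.
Variables (k : fieldType) (C D : lincat k).

(* The Deligne product of two fusion categories: objects are finite formal
   direct sums of objects X \boxtimes Y, morphisms are matrices with entries in
     Hom (X \boxtimes Y, X' \boxtimes Y') = Hom (X, X') (x) Hom (Y, Y').
   For semisimple categories over an algebraically closed field this additive
   envelope is already abelian.  It only depends on the underlying linear
   categories, so that C \boxtimes C^bop is [deligne C C]. *)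
Record dobj := DObj { dlen : nat; dfst : 'I_dlen -> C; dsnd : 'I_dlen -> D }.

Arguments dfst : clear implicits.
Arguments dsnd : clear implicits.

Definition dhom (W V : dobj) : Type :=
  forall (a : 'I_(dlen W)) (b : 'I_(dlen V)),
    tprod (hom (dfst W a) (dfst V b)) (hom (dsnd W a) (dsnd V b)).

Definition did (W : dobj) : dhom W W :=
  on_diag (fun a => tpure '1_(dfst W a) '1_(dsnd W a)) (fun a b => 0).

Definition dcomp (W V U : dobj) (N : dhom V U) (M : dhom W V) : dhom W U :=
  fun a c => \sum_b tcomp (N b c) (M a b).

Definition deligne : category.
Proof.
refine (@Category dobj dhom did dcomp _ _ _).
- move=> X Y Z W L N M; apply: functional_extensionality_dep => a.
  apply: functional_extensionality_dep => e; rewrite /dcomp.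
  under eq_bigr do rewrite (lin_sum (@tcomp_linr _ _ _ _ _ _ _ _ _ _)).
  rewrite exchange_big /=; apply: eq_bigr => b _.
  rewrite (lin_sum (@tcomp_linl _ _ _ _ _ _ _ _ _ _)).
  by apply: eq_bigr => c _; rewrite tcompA.
- move=> X Y M; apply: functional_extensionality_dep => a.
  apply: functional_extensionality_dep => b; rewrite /dcomp (bigD1 b) //= /did.
  rewrite on_diag_eq tcomp1f big1 ?addr0 // => c /eqP cb.
  by rewrite on_diag_neq // (lin0 (@tcomp_linl _ _ _ _ _ _ _ _ _ _)).
- move=> X Y M; apply: functional_extensionality_dep => a.
  apply: functional_extensionality_dep => b; rewrite /dcomp (bigD1 a) //= /did.
  rewrite on_diag_eq tcompf1 big1 ?addr0 // => c /eqP ca.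
  rewrite on_diag_neq; last exact/nesym.
  by rewrite (lin0 (@tcomp_linr _ _ _ _ _ _ _ _ _ _)).
Defined.

End Deligne.

Arguments dfst {k C D} W a : rename.
Arguments dsnd {k C D} W a : rename.

Section FunctorF.
Variables (k : fieldType) (C : premodular k).
Implicit Types X Y Z : C.

(* F (X \boxtimes Y): the object X \ot Y with the half-braiding
   (1_X \om c_{Y,Z}^{-1}) \o (c_{Z,X} \om 1_Y) (associators inserted). *)
Definition F1_hb X Y : half_braiding (X \ot Y) :=
  hbT (hbB (pbr C) X) (hbB (bop (pbr C)) Y).

Definition F_obj (W : deligne C C) : center C :=
  ZObj (hbS (bip C) (fun a => F1_hb (dfst W a) (dsnd W a))).

Definition F1_mor X X' Y Y' (t : tprod (hom X X') (hom Y Y')) :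
    hom (X \ot Y) (X' \ot Y') :=
  tlift (fun f g => f \om g) t.

Definition F_mor0 (W V : deligne C C) (M : chom W V) :
    hom (zob (F_obj W)) (zob (F_obj V)) :=
  \sum_a \sum_b
    (dinj (bip C) (fun b => dfst V b \ot dsnd V b) b
     \o (F1_mor (M a b) \o dproj (bip C) (fun a => dfst W a \ot dsnd W a) a)).


Lemma tensm_bilin X X' Y Y' :
  bilin (fun (f : hom X X') (g : hom Y Y') => f \om g).
Proof. by split=> [g | f]; [apply: tensm_linl | apply: tensm_linr]. Qed.

Lemma F1_pure_compat X X' Y Y' (f : hom X X') (g : hom Y Y') Z :
  F1_hb X' Y' Z \o ('1_Z \om (f \om g)) = ((f \om g) \om '1_Z) \o F1_hb X Y Z.
Proof.
rewrite /= /hbT_mor -!compA asci_nat (compA (_ \om '1_Y')) -tensmM /= br_nat.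
have -> : ((f \om '1_Z) \o br (pbr C) Z X) \om ('1_Y' \o g)
    = ((f \om '1_Z) \om g) \o (br (pbr C) Z X \om '1_Y).
  by rewrite -tensmM comp1f compf1.
rewrite -!compA (compA (asc X' Z Y')) asc_nat -!compA.
rewrite (compA ('1_X' \om _)) -tensmM bri_nat.
have -> : ('1_X' \o f) \om ((g \om '1_Z) \o bri (pbr C) Y Z)
    = (f \om (g \om '1_Z)) \o ('1_X \om bri (pbr C) Y Z).
  by rewrite -tensmM comp1f compf1.
by rewrite -!compA (compA (asci X' Y' Z)) asci_nat -!compA.
Qed.

Lemma F1_compat X X' Y Y' (t : tprod (hom X X') (hom Y Y')) Z :
  F1_hb X' Y' Z \o ('1_Z \om F1_mor t) = (F1_mor t \om '1_Z) \o F1_hb X Y Z.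
Proof.
apply: (tens_ext (f := fun t => F1_hb X' Y' Z \o ('1_Z \om F1_mor t))
                 (g := fun t => (F1_mor t \om '1_Z) \o F1_hb X Y Z)).
- apply: (linear_comp (comp_linr _)); apply: (linear_comp (tensm_linr _)).
  exact: tlift_linear.
- apply: (linear_comp (f := fun h => h \o _)); first exact: comp_linl.
  apply: (linear_comp (f := fun h => h \om _)); first exact: tensm_linl.
  exact: tlift_linear.
move=> f g; rewrite /F1_mor tlift_pure ?F1_pure_compat //.
exact: tensm_bilin.
Qed.

Lemma F_compat (W V : deligne C C) (M : chom W V) :
  zcompat (X := F_obj W) (Y := F_obj V) (F_mor0 M).
Proof.
move=> Z; rewrite /F_mor0 tensm_sumr tensm_suml comp_sumr comp_suml.
apply: eq_bigr => a _.
rewrite tensm_sumr tensm_suml comp_sumr comp_suml; apply: eq_bigr => b _.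
by apply: hbS_compat => Z'; apply: F1_compat.
Qed.

Definition functor_F : prefunctor (deligne C C) (center C) :=
  @PreFunctor (deligne C C) (center C) F_obj
    (fun W V M => ZHom (@F_compat W V M)).

Lemma F1_mor_comp X X' X'' Y Y' Y'' (s : tprod (hom X' X'') (hom Y' Y''))
    (t : tprod (hom X X') (hom Y Y')) :
  F1_mor (tcomp s t) = F1_mor s \o F1_mor t.
Proof.
have lF A A' B B' := @tlift_linear k (hom A A') (hom B B') _
  (fun f g => f \om g).
apply: (tens_ext (f := fun s => F1_mor (tcomp s t))
                 (g := fun s => F1_mor s \o F1_mor t)).
- apply: (linear_comp (f := @F1_mor _ _ _ _)); first exact: lF.
  exact: tcomp_linl.
- apply: (linear_comp (f := fun h => h \o F1_mor t)); first exact: comp_linl.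
  exact: lF.
move=> f' g'; set s' := tpure f' g'.
apply: (tens_ext (f := fun t => F1_mor (tcomp s' t))
                 (g := fun t => F1_mor s' \o F1_mor t)).
- apply: (linear_comp (f := @F1_mor _ _ _ _)); first exact: lF.
  exact: tcomp_linr.
- apply: (linear_comp (f := fun h => F1_mor s' \o h)); first exact: comp_linr.
  exact: lF.
move=> f g; rewrite tcomp_pure /F1_mor.
have B A A' D D' := @tensm_bilin A A' D D'.
by rewrite !tlift_pure // tensmM.
Qed.

Lemma functor_F_is_functor : is_functor functor_F.
Proof.
have lF A A' B B' : linear (@F1_mor A A' B B') by apply: tlift_linear.
split=> [W | W V U N M]; apply: zhom_eq; rewrite /= /F_mor0.
  rewrite -[RHS]dsum_id; apply: eq_bigr => a _; rewrite (bigD1 a) //=.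
  rewrite /did on_diag_eq {1}/F1_mor tlift_pure; last exact: tensm_bilin.
  rewrite tensm1 comp1f big1 ?addr0 // => b /eqP ba.
  rewrite on_diag_neq; last exact/nesym.
  by rewrite (lin0 (lF _ _ _ _)) comp0l comp0r.
rewrite comp_sumr; apply: eq_bigr => a _; rewrite comp_sumr.
under [RHS]eq_bigr do rewrite comp_suml.
pose iU := dinj (bip C) (fun c => dfst U c \ot dsnd U c).
pose pW := dproj (bip C) (fun a => dfst W a \ot dsnd W a).
transitivity (\sum_b \sum_c
    (iU c \o (F1_mor (N b c) \o (F1_mor (M a b) \o pW a)))).
  rewrite exchange_big; apply: eq_bigr => c _.
  rewrite /dcomp (lin_sum (lF _ _ _ _)) comp_suml comp_sumr.
  by apply: eq_bigr => b _; rewrite F1_mor_comp -compA.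
apply: eq_bigr => b _; rewrite (bigD1 b) //= [X in _ = _ + X]big1; last first.
  move=> b' /eqP bb'; rewrite comp_suml big1 // => c _.
  rewrite -!compA (compA (dproj _ _ _)).
  by rewrite dproj_inj0 ?comp0l ?comp0r //; apply/nesym.
rewrite addr0 [RHS]comp_suml; apply: eq_bigr => c _; rewrite -!compA.
by rewrite (compA (dproj _ _ _)) dproj_inj comp1f.
Qed.

End FunctorF.

Arguments functor_F {k} C.

Section FunctorG.
Variables (k : fieldType) (C : premodular k).
Implicit Types (i j : 'I_(rk C)) (X Y : center C).

Local Notation dirr i := (dual (irr i)).

(* The j-th summand.  The middle factor applies c_{j^*,i} and then gamma_{j^*},
   i.e. the half-braiding of (i, c_{-,i}) \ot (X, gamma) at j^*. *)
Definition Gamma_loop i X j : hom (irr i \ot zob X) (irr i \ot zob X) :=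
  let iX := irr i \ot zob X in
  run iX \o (('1_iX \om evt (irr j))
  \o (asc iX (irr j) (dirr j)
  \o ((cbri iX (irr j) \om '1_(dirr j))
  \o (asci (irr j) iX (dirr j)
  \o (('1_(irr j) \om asci (irr i) (zob X) (dirr j))
  \o (('1_(irr j) \om ('1_(irr i) \om zhb X (dirr j)))
  \o (('1_(irr j) \om asc (irr i) (dirr j) (zob X))
  \o (('1_(irr j) \om (cbr (dirr j) (irr i) \om '1_(zob X)))
  \o (('1_(irr j) \om asci (dirr j) (irr i) (zob X))
  \o (asc (irr j) (dirr j) iX
  \o ((coev (irr j) \om '1_iX) \o luni iX))))))))))).

Definition Gamma i X : hom (irr i \ot zob X) (irr i \ot zob X) :=
  (dimOmega C)^-1 *: \sum_j qdim (irr j) *: Gamma_loop i X j.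

Record images := Images {
  im : 'I_(rk C) -> center C -> C;
  impi : forall i X, hom (irr i \ot zob X) (im i X);
  imiota : forall i X, hom (im i X) (irr i \ot zob X);
  impi_epi : forall i X, epi (impi i X);
  imiota_mono : forall i X, mono (imiota i X);
  imE : forall i X, Gamma i X = imiota i X \o impi i X }.

Variable I : images.

Definition G_obj (X : center C) : deligne C C :=
  DObj (fun i : 'I_(rk C) => dirr i) (fun i => im I i X).

Definition G_mor (X Y : center C) (phi : chom X Y) :
    chom (G_obj X) (G_obj Y) :=
  on_diag
    (fun i => tpure '1_(dirr i)
       (impi I i Y \o (Gamma i Y \o (('1_(irr i) \om zmor phi)
          \o (Gamma i X \o imiota I i X)))))
    (fun i j => 0).

Definition functor_G : prefunctor (center C) (deligne C C) :=
  @PreFunctor (center C) (deligne C C) G_obj G_mor.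

(* The scalar <phi, psi> such that phi \o psi = <phi, psi> 1_{i^*}, i.e. the
   trace pairing Tr (psi \o phi) divided by dim i.  With the coefficients
   1 / sqrt (dim i) of [trans_d] and [trans_q] this normalization is forced:
   bases dual under Tr (psi \o phi) itself satisfy
   \sum_l alpha_i^l \o alpha_{i,l} = P_i / dim i, with P_i the projection onto
   the i^*-isotypic part, and would give
   q \o d = \sum_i (dim i)^{-2} P_i \boxtimes 1. *)
Definition pairing (X : C) i (phi : hom X (dirr i)) (psi : hom (dirr i) X) :
    k :=
  Tr (psi \o phi) / qdim (irr i).

Record dual_bases := DualBases {
  dbn : C -> 'I_(rk C) -> nat;
  lower : forall (X : C) i, (dbn X i).-tuple (hom X (dirr i));
  upper : forall (X : C) i, (dbn X i).-tuple (hom (dirr i) X);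
  lower_basis : forall (X : C) i, basis_of fullv (lower X i);
  upper_basis : forall (X : C) i, basis_of fullv (upper X i);
  lower_upper : forall (X : C) i (a b : 'I_(dbn X i)),
    pairing (tnth (lower X i) a) (tnth (upper X i) b) = (a == b)%:R }.

Variables (A : dual_bases) (sq : 'I_(rk C) -> k).

Local Notation FG := (compF (functor_F C) functor_G).
Local Notation GF := (compF functor_G (functor_F C)).

(* For W = \bigoplus_a X_a \boxtimes Y_a, the block from a to i is the formula
   for X_a \boxtimes Y_a followed by the map
   I_{i,F(X_a \boxtimes Y_a)} -> I_{i,F(W)} induced by the inclusion X_a \ot Y_a -> F(W). *)
Definition trans_d : transf (idF (deligne C C)) GF :=
  fun (W : deligne C C) (a : 'I_(dlen W)) (i : 'I_(rk C)) =>
  let X := dfst W a in let Y := dsnd W a in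
  (sq i)^-1 *: \sum_(l < dbn A X i)
    tpure (tnth (lower A X i) l)
      (impi I i (functor_F C W)
       \o (('1_(irr i) \om dinj (bip C) (fun a => dfst W a \ot dsnd W a) a)
       \o (asc (irr i) X Y
       \o (((('1_(irr i) \om tnth (upper A X i) l) \o coev (irr i)) \om '1_Y)
       \o luni Y)))).

Definition trans_q : transf GF (idF (deligne C C)) :=
  fun (W : deligne C C) (i : 'I_(rk C)) (a : 'I_(dlen W)) =>
  let X := dfst W a in let Y := dsnd W a in
  (sq i)^-1 *: \sum_(l < dbn A X i)
    tpure (tnth (upper A X i) l)
      (lun Y
       \o (((evt (irr i) \o ('1_(irr i) \om tnth (lower A X i) l)) \om '1_Y)
       \o (asci (irr i) X Y
       \o (('1_(irr i) \om dproj (bip C) (fun a => dfst W a \ot dsnd W a) a)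
       \o imiota I i (functor_F C W))))).

(* The underlying morphisms in C of b and p. *)
Definition b_mor X : hom (zob X) (zob (FG X)) :=
  \sum_i (dinj (bip C) (fun i => dirr i \ot im I i X) i
    \o (sq i *: (('1_(dirr i) \om (impi I i X \o Gamma i X))
         \o (asc (dirr i) (irr i) (zob X)
         \o ((coevt (irr i) \om '1_(zob X)) \o luni (zob X)))))).

Definition p_mor X : hom (zob (FG X)) (zob X) :=
  \sum_i ((sq i *: (lun (zob X)
         \o ((ev (irr i) \om '1_(zob X))
         \o (asci (dirr i) (irr i) (zob X)
         \o ('1_(dirr i) \om (Gamma i X \o imiota I i X))))))
    \o dproj (bip C) (fun i => dirr i \ot im I i X) i).

End FunctorG.

Arguments functor_G {k C} I.
Arguments trans_d {k C} I A sq.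
Arguments trans_q {k C} I A sq.
Arguments b_mor {k C} I sq X.
Arguments p_mor {k C} I sq X.

Definition factorization (k : fieldType) (C : premodular k)
    (G : prefunctor (center C) (deligne C C)) : Prop :=
  inverse_functor (functor_F C) G.

(* Main.v *)
From HB Require Import structures.
Require Import Defs.
From mathcomp Require Import all_boot all_algebra.
From Stdlib Require Import FunctionalExtensionality.
(* Again, because all_algebra redefines [hom]. *)
Require Import Defs.
Import GRing.Theory.
Local Open Scope ring_scope.

Set Implicit Arguments.
Unset Strict Implicit.
Unset Printing Implicit Defensive.

(* For half-braidings a on A and b on B, averaging f : A -> B over the rings
   labelled by all simple objects, weighted by their dimensions, gives by a
   handle slide a morphism (A, a) -> (B, b) in the center; averaging fixes such
   morphisms and commutes with composition by them.  Gamma_{i,X} is the average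
   of the identity of i \ot X from the half-braiding c \ot gamma to the inverse
   braiding.  As every morphism of C is central for the inverse braidings, it
   follows formally that Gamma is idempotent, natural, and fixes every central
   morphism into or out of an object with inverse braiding; so does G become a
   functor and b a central morphism.

   Invertibility of the S-matrix makes the unit the only transparent simple
   object, so the average between the two braidings of an object projects onto
   its unit-isotypic part.  Applied to i \ot i'^* this gives d q = 1, and applied
   to a ring around a single strand it gives p b = 1, whereas q d = 1 is a zigzag
   identity.

   It remains to show b p = 1.  A zigzag gives q G(b) = 1, hence G(b) = d.
   Let p' be the average of p: then p' is central and p' b = 1, so G(p') = q and
   G(b) G(p') = 1.  Naturality of b turns this into b p' = 1, and finally
   p = p b p' = p'. *)

(** * Unfolding the constraints of a monoidal category *)

(** The asymmetry between [b] and [p] has a cause: [Gamma] is central only from the half-braiding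
    [c \ot gamma] to the inverse braiding. Hence [impi], which absorbs [Gamma], is formally central,
    whereas centrality of [imiota] in the opposite direction does not follow formally. This is why
    [p] is replaced by its average until the very end.

    The scalars fit as follows. In [p b] the two square roots give the loop labelled i the weight
    dim i, so that the sum over i becomes a weighted ring around each strand j of the ring inside
    [Gamma]. It leaves only j isomorphic to the unit, and its total mass [dimOmega] cancels the
    normalization of [Gamma]. In [d q] the two inverse roots give 1 / dim i, which is the
    coefficient of the cup after the cap in the projection of [irr i \ot dual (irr i)] onto its unit
    part.

    These divisions require dim i and [dimOmega] to be nonzero; both facts are deduced from the
    invertible S-matrix. *)

Section Words.
Variables (k : fieldType) (M : monoidal k).
Local Open Scope cat_scope.

Lemma tens1M_inj (X Y : M) (f g : hom X Y) :
  f \om '1_(one M) = g \om '1_(one M) -> f = g.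
Proof.
move=> E; rewrite -[f]compf1 -[g]compf1 -(runiK X) !compA -!run_nat.
by rewrite E.
Qed.

Lemma tens1_inj (X Y : M) (f g : hom X Y) :
  '1_(one M) \om f = '1_(one M) \om g -> f = g.
Proof.
move=> E; rewrite -[f]compf1 -[g]compf1 -(luniK X) !compA -!lun_nat.
by rewrite E.
Qed.

Lemma mono_lun (X W : M) (f g : hom W (one M \ot X)) :
  lun X \o f = lun X \o g -> f = g.
Proof. by move=> E; rewrite -[f]comp1f -[g]comp1f -lunK -!compA E. Qed.

(** Kelly's redundancy argument: after tensoring with the unit on the left, the pentagon for [one],
    [one], X, Y and two instances of the triangle bring both sides to the same morphism. *)
Lemma lun_tens (X Y : M) : lun (X \ot Y) \o asc (one M) X Y = lun X \om '1_Y.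
Proof.
apply: tens1_inj; rewrite -[LHS]compf1.
have K : asc (one M) (one M \ot X) Y \o ((asc (one M) (one M) X \om '1_Y)
   \o ((asci (one M) (one M) X \om '1_Y) \o asci (one M) (one M \ot X) Y)) = '1__.
  by rewrite (compA (_ \om '1_Y)) -tensM1 asciK tensm1 comp1f asciK.
rewrite -[RHS]compf1 -K tens1M -(compA _ ('1__ \om asc _ _ _)).
rewrite (compA (asc _ (_ \ot X) _)) (compA ('1__ \om asc _ _ _)) pentagon.
rewrite -(compA (asc _ _ _)) (compA ('1__ \om lun _)) triangle.
rewrite (compA (_ \om '1__)) -(tensm1 X Y) -asc_nat -triangle.
rewrite -!compA (compA ('1__ \om _)) -asc_nat -!compA; congr (_ \o _).
by rewrite tensM1 -!compA.
Qed.

(** Naturality of [lun] along itself identifies the two ways of removing one of two leading units;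
    [lun_tens] and the triangle then compare [lun] with [run]. *)
Lemma lun_run1 : lun (one M) = run (one M).
Proof.
have K : '1_(one M) \om lun (one M) = lun (one M \ot one M).
  by apply: mono_lun; rewrite lun_nat.
apply: tens1M_inj; rewrite -lun_tens -K triangle //.
Qed.

(* A word is an object X together with a functor [tl], isomorphic to
   X \ot -, in which all the associativity and unit constraints of X have been
   unfolded: [tl] of (X \ot Y) is [tl] of X after [tl] of Y, on the nose.
   Canonical instances reify tensor products, so that a morphism of M becomes,
   by [T] below, a family of maps between right-nested tensor products on which
   every structural isomorphism acts as an identity. *)
Structure word := Word {
  wob :> M;
  tl : M -> M;
  tlm : forall W W' : M, hom W W' -> hom (tl W) (tl W');
  can : forall W, hom (wob \ot W) (tl W);
  cani : forall W, hom (tl W) (wob \ot W);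
  canK : forall W, cani W \o can W = '1_(wob \ot W);
  caniK : forall W, can W \o cani W = '1_(tl W);
  can_nat : forall W W' (h : hom W W'), can W' \o ('1_wob \om h) = tlm h \o can W }.

Lemma cani_nat (E : word) W W' (h : hom W W') :
  cani E W' \o tlm E h = ('1_E \om h) \o cani E W.
Proof.
rewrite -[LHS]compf1 -caniK -compA (compA (tlm E h)) -can_nat -!compA.
by rewrite (compE2 (canK _ _)) comp1f.
Qed.

Lemma tlm1 (E : word) W : tlm E '1_W = '1_(tl E W).
Proof. by rewrite -[LHS]compf1 -caniK compA -can_nat tensm1 compf1. Qed.

Lemma tlmM (E : word) W W' W'' (g : hom W' W'') (f : hom W W') :
  tlm E (g \o f) = tlm E g \o tlm E f.
Proof.
rewrite -[LHS]compf1 -[in RHS](compf1 (tlm E f)) -caniK !compA -can_nat.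
by rewrite -(compA _ (tlm E f)) -can_nat compA -can_nat tens1M -!compA.
Qed.

Definition T_def (E E' : word) (f : hom E E') W : hom (tl E W) (tl E' W) :=
  can E' W \o ((f \om '1_W) \o cani E W).
Fact T_key : unit. Proof. by []. Qed.
Definition T := locked_with T_key T_def.
Lemma T_unlock : T = T_def. Proof. exact: unlock. Qed.
Arguments T E E' f W : clear implicits.

(** The fallback instance, for an object that is neither the unit nor a tensor product: nothing is
    unfolded, so [can] is an identity. *)
Canonical atom (X : M) : word :=
  @Word X (fun W => X \ot W) (fun W W' h => '1_X \om h)
    (fun W => '1_(X \ot W)) (fun W => '1_(X \ot W))
    (fun W => comp1f _) (fun W => comp1f _)
    (fun W W' h => etrans (comp1f _) (esym (compf1 _))).

Canonical oneW : word.
Proof.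
refine (@Word (one M) (fun W => W) (fun W W' h => h) (@lun k M) (@luni k M) _ _ _).
- exact: lunK.
- exact: luniK.
- exact: lun_nat.
Defined.

Canonical tensW (E E' : word) : word.
Proof.
refine (@Word (E \ot E') (fun W => tl E (tl E' W))
  (fun W W' h => tlm E (tlm E' h))
  (fun W => can E (tl E' W) \o (('1_E \om can E' W) \o asc E E' W))
  (fun W => asci E E' W \o (('1_E \om cani E' W) \o cani E (tl E' W))) _ _ _).
- move=> W; rewrite -!compA (compE2 (canK _ _)) comp1f.
  have K : ('1_E \om cani E' W) \o ('1_E \om can E' W) = '1__.
    by rewrite -tens1M canK tensm1.
  by rewrite (compE2 K) comp1f ascK.
- move=> W; rewrite -!compA (compE2 (asciK _ _ _)) comp1f.
  have K : ('1_E \om can E' W) \o ('1_E \om cani E' W) = '1__.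
    by rewrite -tens1M caniK tensm1.
  by rewrite (compE2 K) comp1f caniK.
- move=> W W' h; rewrite -!compA -tensm1 asc_nat compA -(compA _ ('1_E \om _)).
  by rewrite (compA ('1_E \om _)) -tens1M can_nat tens1M -!compA (compA (can E
    _)) can_nat !compA.
Defined.

Section TLaws.
Implicit Types E : word.

(** Entry point of the calculus: tensoring with the unit is faithful, so an equation in [M] may be
    checked after [T], at the single tail [one M]. *)
Lemma T_inj E E' (f g : hom E E') :
  T E E' f (one M) = T E E' g (one M) -> f = g.
Proof.
move=> H; apply: tens1M_inj; rewrite -[LHS]comp1f -[RHS]comp1f -canK -!compA.
congr (_ \o _); rewrite -[LHS]compf1 -[RHS]compf1 -canK.
by have := congr1 (fun u => u \o can E _) H; rewrite T_unlock /T_def -!compA.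
Qed.

Lemma T_nat E E' (f : hom E E') W W' (h : hom W W') :
  T E E' f W' \o tlm E h = tlm E' h \o T E E' f W.
Proof.
by rewrite T_unlock /T_def -!compA cani_nat (compA (f \om _)) -tens_swap -!compA
  (compA (can _ _)) can_nat -!compA.
Qed.

Lemma T_id E W : T E E '1_E W = '1_(tl E W).
Proof. by rewrite T_unlock /T_def tensm1 comp1f caniK. Qed.

Lemma T_comp E E' E'' (g : hom E' E'') (f : hom E E') W :
  T E E'' (g \o f) W = T E' E'' g W \o T E E' f W.
Proof.
by rewrite T_unlock /T_def tensM1 -!compA (compE2 (canK _ _)) comp1f.
Qed.

Lemma T_tens E1 E1' E2 E2' (f : hom E1 E1') (g : hom E2 E2') W :
  T (tensW E1 E2) (tensW E1' E2') (f \om g) W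
  = T E1 E1' f (tl E2' W) \o tlm E1 (T E2 E2' g W).
Proof.
rewrite T_unlock /T_def /= -!compA cani_nat.
rewrite (compA (asc _ _ _)) asc_nat -!compA (compE2 (asciK _ _ _)) comp1f.
rewrite (tens_split f) -!compA (compA ('1_E1' \om can _ _)) tens_swap -!compA.
by do 2!congr (_ \o _); rewrite !tens1M -!compA.
Qed.

(** The pentagon says exactly that [asc] becomes an identity once the tensor products are unfolded
    in front of a tail. *)
Lemma T_asc E1 E2 E3 W :
  T (tensW (tensW E1 E2) E3) (tensW E1 (tensW E2 E3)) (asc E1 E2 E3) W
  = '1_(tl E1 (tl E2 (tl E3 W))).
Proof.
rewrite T_unlock /T_def /= -!compA.
have -> : '1_(E1 \ot E2) \om cani E3 W = ('1_E1 \om '1_E2) \om cani E3 W.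
  by rewrite tensm1.
rewrite (compA (_ \om cani E3 W)) -asci_nat -!compA.
rewrite (compA ('1_E1 \om ('1_E2 \om _))) -tens1M.
have P : ('1_E1 \om asc E2 E3 W) \o (asc E1 (E2 \ot E3) W \o
   ((asc E1 E2 E3 \om '1_W) \o (asci (E1 \ot E2) E3 W \o asci E1 E2 (E3 \ot W))))
   = '1__.
  rewrite (compA (asc _ (_ \ot _) _)) (compA ('1_E1 \om _)) pentagon -!compA.
  by rewrite (compE2 (asciK _ _ _)) comp1f asciK.
have {}P A (u : hom A _) : ('1_E1 \om asc E2 E3 W) \o (asc E1 (E2 \ot E3) W \o
   ((asc E1 E2 E3 \om '1_W) \o (asci (E1 \ot E2) E3 W
     \o (asci E1 E2 (E3 \ot W) \o u)))) = u.
  by have := congr1 (fun h => h \o u) P; rewrite -!compA comp1f.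
rewrite 2!tens1M -!compA P.
have {}P : (can E2 (tl E3 W) \o ('1_E2 \om can E3 W)) \o
   (('1_E2 \om cani E3 W) \o cani E2 (tl E3 W)) = '1__.
  rewrite -compA (compE2 (_ : _ = '1__)) ?comp1f ?caniK //.
  by rewrite -tens1M caniK tensm1.
rewrite (compA ('1_E1 \om can _ _)) -tens1M (compA ('1_E1 \om _)) -tens1M.
by rewrite P tensm1 comp1f caniK.
Qed.

Lemma T_asci E1 E2 E3 W :
  T (tensW E1 (tensW E2 E3)) (tensW (tensW E1 E2) E3) (asci E1 E2 E3) W
  = '1_(tl E1 (tl E2 (tl E3 W))).
Proof.
have := T_comp (E := tensW (tensW E1 E2) E3) (E' := tensW E1 (tensW E2 E3))
  (E'' := tensW (tensW E1 E2) E3) (asci E1 E2 E3) (asc E1 E2 E3) W.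
rewrite ascK T_id T_asc => H; exact: etrans (esym (compf1 _)) (esym H).
Qed.

Lemma T_lun E W : T (tensW oneW E) E (lun E) W = '1_(tl E W).
Proof.
rewrite T_unlock /T_def /= -lun_tens -!compA (compE2 (asciK _ _ _)) comp1f.
rewrite (compA (lun _)) lun_nat -!compA.
by rewrite luniK compf1 caniK.
Qed.

Lemma T_luni E W : T E (tensW oneW E) (luni E) W = '1_(tl E W).
Proof.
have := T_comp (E' := tensW oneW E) (lun E) (luni E) W.
rewrite luniK T_id T_lun => H; exact: etrans (esym (comp1f _)) (esym H).
Qed.

Lemma T_run E W : T (tensW E oneW) E (run E) W = '1_(tl E W).
Proof.
rewrite T_unlock /T_def /= -triangle -!compA (compE2 (asciK _ _ _)) comp1f.
by rewrite (compA ('1_E \om _)) -tens1M luniK tensm1 comp1f caniK.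
Qed.

Lemma T_runi E W : T E (tensW E oneW) (runi E) W = '1_(tl E W).
Proof.
have := T_comp (E' := tensW E oneW) (run E) (runi E) W.
rewrite runiK T_id T_run => H; exact: etrans (esym (comp1f _)) (esym H).
Qed.

Lemma T_linear E E' W : linear (fun f => T E E' f W).
Proof. by move=> a f g; rewrite T_unlock /T_def tensm_linl comp_linl comp_linr. Qed.

Lemma T_sum E E' W I r (P : pred I) (F : I -> hom E E') :
  T E E' (\sum_(i <- r | P i) F i) W = \sum_(i <- r | P i) T E E' (F i) W.
Proof. exact: (lin_sum (@T_linear E E' W)). Qed.

Lemma T_scale E E' W a (f : hom E E') : T E E' (a *: f) W = a *: T E E' f W.
Proof. exact: (lin_scale (@T_linear E E' W)). Qed.

End TLaws.

Definition TE := (T_id, T_comp, T_tens, T_asc, T_asci, T_lun, T_luni, T_run,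
  T_runi, tlm1, comp1f, compf1).
End Words.
Arguments T {k M} E E' f W : simpl never.
Notation "f \@ W" := (T _ _ f W) (at level 39, left associativity) : cat_scope.

(** * Half-braidings and central morphisms *)

Section HalfBraidings.
Variables (k : fieldType) (M : monoidal k).
Implicit Types (X Y Z W A B : M) (E : word M).
Local Open Scope cat_scope.

Lemma T_iso E E' (f : hom E E') (g : hom E' E) W :
  g \o f = '1_E -> g \@ W \o f \@ W = '1_(tl E W).
Proof. by move=> gf; rewrite -T_comp gf T_id. Qed.

Lemma hb_word_nat Y (g : half_braiding Y) E E' (f : hom E E') W :
  g E' \@ W \o f \@ (Y \ot W) = ('1_Y \om f \@ W) \o g E \@ W.
Proof.
have := congr1 (fun h => T (tensW E (atom Y)) (tensW (atom Y) E') h W) (hb_nat g f).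
by rewrite !TE /=.
Qed.

Lemma hb_word_tens Y (g : half_braiding Y) E E' W :
  g (E \ot E') \@ W = g E \@ (tl E' W) \o tlm E (g E' \@ W).
Proof.
have := congr1 (fun h => T (tensW (tensW E E') (atom Y))
  (tensW (atom Y) (tensW E E')) h W) (hb_tens g E E').
by rewrite !TE /=.
Qed.

(** Tensoriality at two units and naturality along [lun] make the component at the unit idempotent;
    being invertible, it is the identity. *)
Lemma hb_one Y (g : half_braiding Y) W : g (one M) \@ W = '1_(Y \ot W).
Proof.
have N := hb_word_nat g (lun (one M)) W.
rewrite hb_word_tens !TE /= tensm1 comp1f in N.
have [h [h1 h2]] := hb_iso g (one M).
have /= I := T_iso (E := tensW (oneW M) (atom Y)) (E' := tensW (atom Y) (oneW
  M)) W h1.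
have := congr1 (fun u => h \@ W \o u) N.
by rewrite compA /= I comp1f.
Qed.

(** [hb_iso] only asserts existence; since equality in a [vectType] is decidable, an inverse can be
    extracted by choice. *)
Lemma hbi_ex Y (g : half_braiding Y) Z : {h : hom (Y \ot Z) (Z \ot Y) |
  (h \o g Z == '1_(Z \ot Y)) && (g Z \o h == '1_(Y \ot Z))}.
Proof.
apply: sigW; have [h [h1 h2]] := hb_iso g Z.
by exists h; rewrite h1 h2 !eqxx.
Qed.

Definition hbi Y (g : half_braiding Y) Z := sval (hbi_ex g Z).

Lemma hbiK Y (g : half_braiding Y) Z : hbi g Z \o g Z = '1_(Z \ot Y).
Proof. by case/andP: (svalP (hbi_ex g Z)) => /eqP. Qed.
Lemma hbKi Y (g : half_braiding Y) Z : g Z \o hbi g Z = '1_(Y \ot Z).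
Proof. by case/andP: (svalP (hbi_ex g Z)) => _ /eqP. Qed.

Lemma hbiK_tail Y (g : half_braiding Y) Z W :
  hbi g Z \@ W \o g Z \@ W = '1_(Z \ot (Y \ot W)).
Proof. exact: (T_iso (E := tensW (atom Z) (atom Y)) _ (hbiK g Z)). Qed.
Lemma hbKi_tail Y (g : half_braiding Y) Z W :
  g Z \@ W \o hbi g Z \@ W = '1_(Y \ot (Z \ot W)).
Proof. exact: (T_iso (E := tensW (atom Y) (atom Z)) _ (hbKi g Z)). Qed.

Lemma hbi_move Y (g : half_braiding Y) Z W V (u : hom V (Z \ot (Y \ot W))) v :
  u = hbi g Z \@ W \o v <-> g Z \@ W \o u = v.
Proof.
split=> [-> | <-]; first by rewrite (compE2 (hbKi_tail g Z W)) comp1f.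
by rewrite (compE2 (hbiK_tail g Z W)) comp1f.
Qed.

Lemma hbi_nat Y (g : half_braiding Y) Z Z' (f : hom Z Z') :
  hbi g Z' \o ('1_Y \om f) = (f \om '1_Y) \o hbi g Z.
Proof.
rewrite -[LHS]compf1 -(hbKi g Z) compA -(compA _ ('1_Y \om f)) -hb_nat.
by rewrite !compA hbiK comp1f.
Qed.

(** The condition of [zcompat] with the half-braidings as arguments, because one object is used
    below with several of them. *)
Definition cpt A B (a : half_braiding A) (b : half_braiding B) (f : hom A B) :=
  forall Z, b Z \o ('1_Z \om f) = (f \om '1_Z) \o a Z.

Section Cpt.
Variables (A B D : M).
Variables (a : half_braiding A) (b : half_braiding B) (d : half_braiding D).

Lemma cpt_tail f : cpt a b f -> forall Z W,
  b Z \@ W \o ('1_Z \om f \@ W) = f \@ (Z \ot W) \o a Z \@ W.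
Proof.
move=> H Z W.
have := congr1 (fun h => T (tensW (atom Z) (atom A)) (tensW (atom B) (atom Z)) h
  W) (H Z).
by rewrite !TE /=.
Qed.

Lemma cpt_id : cpt a a '1_A.
Proof. by move=> Z; rewrite !tensm1 comp1f compf1. Qed.

Lemma cpt_comp f g : cpt b d g -> cpt a b f -> cpt a d (g \o f).
Proof. by move=> G F Z; rewrite tens1M tensM1 compA G -!compA F. Qed.

Lemma cpt_sum I r (P : pred I) (F : I -> hom A B) :
  (forall i, P i -> cpt a b (F i)) -> cpt a b (\sum_(i <- r | P i) F i).
Proof.
move=> H Z; rewrite tensm_sumr tensm_suml comp_sumr comp_suml.
by apply: eq_bigr => i Pi; apply: H.
Qed.

Lemma cpt_scale c (f : hom A B) : cpt a b f -> cpt a b (c *: f).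
Proof.
move=> H Z; rewrite (lin_scale (tensm_linr _)) (lin_scale (tensm_linl _)).
by rewrite (lin_scale (comp_linr _)) H (lin_scale (comp_linl _)).
Qed.

Lemma cpt_inv f g : g \o f = '1_A -> f \o g = '1_B -> cpt a b f -> cpt b a g.
Proof.
move=> gf fg H Z.
rewrite -[LHS]comp1f -(tensm1 A Z) -gf tensM1 -compA (compA (f \om _)) -H.
by rewrite -!compA -tens1M fg tensm1 compf1.
Qed.
End Cpt.

Lemma cpt_br (b : braiding M) A B (f : hom A B) : cpt (hbB b A) (hbB b B) f.
Proof. by move=> Z; exact: br_nat. Qed.

Lemma hbT_tail E E' (a : half_braiding E) (b : half_braiding E') J W :
  hbT a b J \@ W = tlm E (b J \@ W) \o a J \@ (tl E' W).
Proof. by rewrite /= /hbT_mor !TE. Qed.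

Lemma cpt_tens A A' B B' (a : half_braiding A) (a' : half_braiding A')
    (b : half_braiding B) (b' : half_braiding B') f g :
  cpt a a' f -> cpt b b' g -> cpt (hbT a b) (hbT a' b') (f \om g).
Proof.
move=> F G Z.
apply: (@T_inj _ _ (tensW (atom Z) (tensW (atom A) (atom B)))
   (tensW (tensW (atom A') (atom B')) (atom Z))).
rewrite /hbT /hbT_mor /= !TE /= !tens1M -!compA.
rewrite (compA (a' Z \@ _)) (cpt_tail F) -!compA (T_nat (a Z)) /=.
rewrite (compA ('1_A' \om _)) -(T_nat f) /= -!compA; congr (_ \o _).
by rewrite !compA -!tens1M (cpt_tail G).
Qed.

Lemma cpt_asc A B D (a : half_braiding A) (b : half_braiding B)
    (d : half_braiding D) :
  cpt (hbT (hbT a b) d) (hbT a (hbT b d)) (asc A B D).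
Proof.
move=> Z; apply: (@T_inj _ _ (tensW (atom Z) (tensW (tensW (atom A) (atom B))
  (atom D)))
   (tensW (tensW (atom A) (tensW (atom B) (atom D))) (atom Z))).
by rewrite /= /hbT_mor /= !TE /= ?tens1M ?tensm1 /= ?TE -?compA.
Qed.

Section HexagonTails.
Variables (b : braiding M).

Lemma br_hexl_tail (E E' F : word M) W :
  br b (E \ot E') F \@ W = br b E F \@ (tl E' W) \o tlm E (br b E' F \@ W).
Proof. by rewrite br_hexl !TE /=. Qed.
Lemma br_hexr_tail (F E E' : word M) W :
  br b F (E \ot E') \@ W = tlm E (br b F E' \@ W) \o br b F E \@ (tl E' W).
Proof. by rewrite br_hexr !TE /=. Qed.
End HexagonTails.

Lemma bri_hexl_tail b (E E' F : word M) W :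
  bri b (E \ot E') F \@ W = tlm E (bri b E' F \@ W) \o bri b E F \@ (tl E' W).
Proof. exact: (br_hexr_tail (bop b)). Qed.
Lemma bri_hexr_tail b (F E E' : word M) W :
  bri b F (E \ot E') \@ W = bri b F E \@ (tl E' W) \o tlm E (bri b F E' \@ W).
Proof. exact: (br_hexl_tail (bop b)). Qed.

(** [hb_one] for the opposite braiding trivializes the inverse crossing, hence the crossing
    itself. *)
Lemma br_unit b X : br b X (one M) = luni X \o run X.
Proof.
apply: (@T_inj _ _ (tensW (atom X) (oneW M)) (tensW (oneW M) (atom X))).
have N : bri b X (one M) \@ one M = '1_(X \ot one M) := hb_one (hbB (bop b) X) _.
have := T_iso (E := tensW (oneW M) (atom X)) (E' := tensW (atom X) (oneW M))
  (one M) (briK b X (one M)).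
by rewrite /= N compf1 !TE.
Qed.

Lemma br_one_tail b E W : br b E (one M) \@ W = '1_(tl E W).
Proof. by rewrite br_unit !TE. Qed.

Lemma br_unitl b X : br b (one M) X = runi X \o lun X.
Proof.
apply: (@T_inj _ _ (tensW (oneW M) (atom X)) (tensW (atom X) (oneW M))).
by rewrite (hb_one (hbB b X)) !TE.
Qed.

Lemma br_one_left_tail b E W : br b (one M) E \@ W = '1_(tl E W).
Proof. by rewrite br_unitl !TE. Qed.
Lemma bri_one_tail b E W : bri b (one M) E \@ W = '1_(tl E W).
Proof. exact: (br_one_tail (bop b)). Qed.
Lemma bri_one_left_tail b E W : bri b E (one M) \@ W = '1_(tl E W).
Proof. exact: (br_one_left_tail (bop b)). Qed.

Lemma cpt_luni (b : braiding M) B (g : half_braiding B) :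
  cpt g (hbT (hbB b (one M)) g) (luni B).
Proof.
move=> Z; apply: (@T_inj _ _ (tensW (atom Z) (atom B))
   (tensW (tensW (oneW M) (atom B)) (atom Z))).
by rewrite /= /hbT_mor /= !TE /= ?tensm1 ?TE br_one_tail !TE.
Qed.
End HalfBraidings.

(** * Ribbon structure and trace *)

Section BraidTails.
Variables (k : fieldType) (M : monoidal k) (b : braiding M).
Implicit Types (X Y Z W : M) (E : word M).
Local Open Scope cat_scope.

Lemma br_natl_tail Y E E' (f : hom E E') W :
  br b E' Y \@ W \o f \@ (Y \ot W) = ('1_Y \om f \@ W) \o br b E Y \@ W.
Proof. exact: (hb_word_nat (hbB b Y)). Qed.

Lemma br_natr_tail X E E' (f : hom E E') W :
  br b X E' \@ W \o ('1_X \om f \@ W) = f \@ (X \ot W) \o br b X E \@ W.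
Proof.
have := congr1 (fun h => T (tensW (atom X) E) (tensW E' (atom X)) h W)
  (br_nat b '1_X f).
by rewrite !TE /=.
Qed.

Lemma bri_natl_tail Y E E' (f : hom E E') W :
  bri b Y E' \@ W \o f \@ (Y \ot W) = ('1_Y \om f \@ W) \o bri b Y E \@ W.
Proof. exact: (hb_word_nat (hbB (bop b) Y)). Qed.

Lemma bri_natr_tail X E E' (f : hom E E') W :
  bri b E' X \@ W \o ('1_X \om f \@ W) = f \@ (X \ot W) \o bri b E X \@ W.
Proof.
have := congr1 (fun h => T (tensW (atom X) E) (tensW E' (atom X)) h W)
  (br_nat (bop b) '1_X f).
by rewrite !TE /=.
Qed.

Lemma brK_tail X Y W : bri b X Y \@ W \o br b X Y \@ W = '1_(X \ot (Y \ot W)).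
Proof. exact: (T_iso (E := tensW (atom X) (atom Y)) _ (brK b X Y)). Qed.
Lemma briK_tail X Y W : br b X Y \@ W \o bri b X Y \@ W = '1_(Y \ot (X \ot W)).
Proof. exact: (T_iso (E := tensW (atom Y) (atom X)) _ (briK b X Y)). Qed.
Lemma brK_tail_whisker V X Y W :
  ('1_V \om bri b X Y \@ W) \o ('1_V \om br b X Y \@ W) = '1__.
Proof. by rewrite -tens1M brK_tail tensm1. Qed.
Lemma briK_tail_whisker V X Y W :
  ('1_V \om br b X Y \@ W) \o ('1_V \om bri b X Y \@ W) = '1__.
Proof. by rewrite -tens1M briK_tail tensm1. Qed.
End BraidTails.

Lemma is_iso_monic (k : fieldType) (C : lincat k) (X Y W : C) (f : hom X Y) :
  is_iso f -> forall g h : hom W X, (f \o g = f \o h)%cat -> g = h.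
Proof.
move=> [f' [f'f _]] g h E; rewrite -(comp1f g) -(comp1f h) -f'f.
by rewrite -!compA E.
Qed.

Section Ribbon.
Variables (k : fieldType) (C : premodular k).
Implicit Types (X Y Z W : C).
Local Open Scope cat_scope.
Local Notation c := (pbr C).

Lemma zigzag1_tail X W : ('1_X \om ev X \@ W) \o coev X \@ (X \ot W) = '1_(X \ot W).
Proof.
by have := congr1 (fun h => h \@ W) (zigzag1 X); rewrite !TE /=.
Qed.

Lemma zigzag2_tail X W :
  ev X \@ (dual X \ot W) \o ('1_(dual X) \om coev X \@ W) = '1_(dual X \ot W).
Proof.
by have := congr1 (fun h => h \@ W) (zigzag2 X); rewrite !TE /=.
Qed.

(** [twist_tens] at two units and naturality along [lun] make this twist idempotent, and it is
    invertible. *)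
Lemma twist_one : twist (one C) = '1_(one C).
Proof.
have E W : twist (one C) \@ W = twist (one C) \@ W \o twist (one C) \@ W.
  have := congr1 (fun h => h \@ W) (twist_tens (one C) (one C)).
  have := congr1 (fun h => h \@ W) (twist_nat (lun (one C))).
  by rewrite !TE /= !br_one_tail /= !comp1f => H1 H2; rewrite {1}H1 H2.
have [g [g1 g2]] := twist_iso (one C).
have I := T_iso (E := oneW C) (E' := oneW C) (one C) g1.
have := congr1 (fun h => g \@ (one C) \o h) (E (one C));
  rewrite compA I comp1f => H.
apply: (@T_inj k C (oneW C) (oneW C) (twist _) '1__).
by rewrite T_id.
Qed.

Lemma ev_dualm X Y (f : hom X Y) W :
  ev X \@ W \o dualm f \@ (X \ot W) = ev Y \@ W \o ('1_(dual Y) \om f \@ W).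
Proof.
rewrite /dualm !TE /= ?tens1M -?compA.
rewrite compA -(T_nat (ev Y) (ev X \@ W)) /= -!compA; congr (_ \o _).
rewrite -!tens1M; congr (_ \om _).
by rewrite compA -(T_nat f) /= -compA zigzag1_tail compf1.
Qed.

Lemma coev_dualm X Y (f : hom X Y) W :
  ('1_Y \om dualm f \@ W) \o coev Y \@ W = f \@ (dual X \ot W) \o coev X \@ W.
Proof.
rewrite /dualm !TE /= ?tens1M -!compA.
rewrite -(T_nat (coev Y) (coev X \@ W)) /=.
rewrite (compA ('1_Y \om ('1__ \om f \@ _))) -(T_nat (coev Y) (f \@ _)) /= -compA.
by rewrite (compE2 (zigzag1_tail _ _)) comp1f.
Qed.

Lemma ev_twist X W :
  ev X \@ W \o ('1_(dual X) \om twist X \@ W) = ev X \@ W \o twist (dual X) \@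
    (X \ot W).
Proof. by rewrite twist_dual ev_dualm. Qed.

Lemma coev_twist X W : twist X \@ (dual X \ot W) \o coev X \@ W
  = ('1_X \om twist (dual X) \@ W) \o coev X \@ W.
Proof. by rewrite twist_dual coev_dualm. Qed.

Lemma twist_iso_tail E : exists g : hom E E, forall W,
 g \@ W \o twist E \@ W = '1_(tl E W) /\ twist E \@ W \o g \@ W = '1_(tl E W).
Proof.
have [g [g1 g2]] := twist_iso (E : C).
by exists g => W; split; apply: T_iso.
Qed.

Lemma twist_tens_tail X Y W : twist (X \ot Y) \@ W
  = br c Y X \@ W \o (br c X Y \@ W \o (twist X \@ (Y \ot W) \o ('1_X \om twist
    Y \@ W))).
Proof. by rewrite twist_tens !TE. Qed.

(** Naturality of the twist along [ev], the twist of the unit being trivial. *)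
Lemma ev_twist2 X W :
  ev X \@ W \o (br c X (dual X) \@ W \o (br c (dual X) X \@ W
   \o (twist (dual X) \@ (X \ot W) \o ('1_(dual X) \om twist X \@ W)))) = ev X \@ W.
Proof.
have := congr1 (fun h => h \@ W) (twist_nat (ev X)).
by rewrite twist_one !TE /= twist_tens_tail => <-.
Qed.

Lemma coev_twist2 X W :
  br c (dual X) X \@ W \o (br c X (dual X) \@ W
   \o (twist X \@ (dual X \ot W) \o (('1_X \om twist (dual X) \@ W) \o coev X \@
     W)))
  = coev X \@ W.
Proof.
have := congr1 (fun h => h \@ W) (twist_nat (coev X)).
by rewrite twist_one !TE /= twist_tens_tail -!compA => ->.
Qed.
End Ribbon.

(** * Right-handed duality and the quantum trace *)

Section Pivotal.
Variables (k : fieldType) (C : premodular k).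
Implicit Types X Y Z W : C.
Local Open Scope cat_scope.
Local Notation c := (pbr C).

(** Sliding the strand X across the braided cup leaves a crossing of X with itself; the hexagon
    merges it with the crossing at the cup, and sliding X past the cap leaves the plain zigzag. *)
Lemma braided_zigzag1 X W : ev X \@ (X \ot W) \o (br c X (dual X) \@ (X \ot W)
  \o ('1_X \om (bri c (dual X) X \@ W \o coev X \@ W))) = '1_(X \ot W).
Proof.
have H := br_hexr_tail c X (dual X) X W.
have N := br_natr_tail c X (bri c (dual X) X \o coev X) W.
rewrite H br_one_tail T_comp T_comp compf1 /= in N.
have {}N := congr1 (fun h => ('1_(dual X) \om bri c X X \@ W) \o h) N.
rewrite -!compA (compE2 (brK_tail_whisker _ _ _ _ _)) comp1f in N.
rewrite N !compA -(compA (ev X \@ _)) -(bri_hexl_tail c (dual X)).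
by rewrite -(bri_natr_tail c X (ev X)) bri_one_tail comp1f zigzag1_tail.
Qed.

Lemma braided_zigzag2 X W : ('1_(dual X) \om (ev X \@ W \o br c X (dual X) \@ W))
   \o (bri c (dual X) X \@ (dual X \ot W) \o coev X \@ (dual X \ot W)) =
     '1_(dual X \ot W).
Proof.
have H := br_hexl_tail c (dual X) X (dual X) W.
have N := br_natl_tail c (dual X) (bri c (dual X) X \o coev X) W.
rewrite H br_one_left_tail !T_comp compf1 /= in N.
have {}N := congr1 (fun h => bri c (dual X) (dual X) \@ (X \ot W) \o h) N.
rewrite -!compA (compE2 (brK_tail _ _ _ _)) comp1f in N.
rewrite tens1M -compA N tens1M (compA (bri _ _ _ \@ _)) -(bri_hexr_tail c (dual X)).
rewrite compA -(bri_natl_tail c (dual X) (ev X)) bri_one_left_tail comp1f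
  zigzag2_tail //.
Qed.

(* Locked copies of the right-handed duality morphisms, so that unification does
   not unfold them into composites. *)
Fact rdual_key : unit. Proof. by []. Qed.
Definition revt X := locked_with rdual_key (evt X).
Definition rcoev X := locked_with rdual_key (coevt X).
Lemma revtE X : evt X = revt X. Proof. by rewrite /revt unlock. Qed.
Lemma rcoevE X : coevt X = rcoev X. Proof. by rewrite /rcoev unlock. Qed.

Lemma revt_tail X W :
  revt X \@ W = ev X \@ W \o (br c X (dual X) \@ W \o twist X \@ (dual X \ot W)).
Proof. by rewrite -revtE /evt /cbr !TE /= ?tensm1 ?compf1. Qed.

Lemma rcoev_tail X W : rcoev X \@ W
  = ('1_(dual X) \om twist X \@ W) \o (br c X (dual X) \@ W \o coev X \@ W).
Proof. by rewrite -rcoevE /coevt /cbr !TE /= ?comp1f. Qed.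

(** Two descriptions of the right-handed cup, by the twist and by the inverse braiding, agree
    because [coev] absorbs a double crossing together with its twists. This reduces the right-handed
    zigzags to the braided ones. *)
Lemma twist_coevt X W : ('1_(dual X) \om twist X \@ W) \o rcoev X \@ W
  = bri c (dual X) X \@ W \o coev X \@ W.
Proof.
rewrite -[LHS]comp1f -(brK_tail c) -!compA rcoev_tail; congr (_ \o _).
rewrite (compA (br c (dual X) X \@ W)) br_natr_tail -!compA.
rewrite (compA (br c (dual X) X \@ W)) br_natr_tail -!compA.
rewrite -[RHS](coev_twist2 X W) -coev_twist.
rewrite (compA (br c X (dual X) \@ W) (twist X \@ _)) br_natl_tail -!compA.
rewrite (compA (br c (dual X) X \@ W) ('1__ \om _)) br_natr_tail -!compA;
  congr (_ \o _).
rewrite (compA (br c X (dual X) \@ W) (twist X \@ _)) br_natl_tail -!compA.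
by rewrite (compA (br c (dual X) X \@ W) ('1__ \om _)) br_natr_tail -!compA.
Qed.

Lemma right_zigzag1_tail X W : revt X \@ (X \ot W) \o ('1_X \om rcoev X \@ W) =
  '1_(X \ot W).
Proof.
(* A twist is put in front so that it can travel to the cup, where [twist_coevt] absorbs it. *)
apply: (is_iso_monic (f := twist X \@ W)).
  by have [g gP] := twist_iso_tail (atom X); exists (g \@ W); apply: gP.
rewrite compf1 revt_tail compA -!compA.
rewrite (compA (twist X \@ W)) -(T_nat (ev X) (twist X \@ W)) /= -!compA.
rewrite (compA ('1__ \om ('1__ \om _))) -(T_nat (br c X (dual X)) (twist X \@
  W)) /= -!compA.
rewrite (T_nat (twist X) (rcoev X \@ W)) /= (compA ('1__ \om ('1__ \om _))).
rewrite -tens1M twist_coevt.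
have := congr1 (fun h => h \o twist X \@ W) (braided_zigzag1 X W).
by rewrite -!compA comp1f.
Qed.

Lemma right_zigzag2_tail X W : ('1_(dual X) \om revt X \@ W) \o rcoev X \@ (dual
  X \ot W)
  = '1_(dual X \ot W).
Proof.
rewrite revt_tail !compA 1!tens1M -!compA twist_coevt.
exact: braided_zigzag2.
Qed.

Lemma ev_coevt X W : ev X \@ W \o rcoev X \@ W = revt X \@ W \o coev X \@ W.
Proof. by rewrite rcoev_tail revt_tail -!compA (compA (br _ _ _ \@ _))
  br_natl_tail -!compA. Qed.

Lemma evt_dualm X Y (g : hom X Y) W :
  revt X \@ W \o ('1_X \om dualm g \@ W) = revt Y \@ W \o g \@ (dual Y \ot W).
Proof.
rewrite !revt_tail -!compA (T_nat (twist X)) /= (compA (br _ _ _ \@ _))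
  br_natr_tail.
rewrite -compA (compA (ev X \@ _)) ev_dualm.
have := congr1 (fun h => T (atom X) (atom Y) h (dual Y \ot W)) (twist_nat g).
rewrite !T_comp => ->.
by rewrite (compA (br _ Y _ \@ _) (g \@ _)) (br_natl_tail c _ g) -!compA.
Qed.

(** [Tr] before the scalar is extracted, so that it can be manipulated as a diagram. *)
Definition tr X (f : hom X X) : hom (one C) (one C) :=
  revt X \o ((f \om '1_(dual X)) \o coev X).

Lemma tr_tail X (f : hom X X) W :
  tr f \@ W = revt X \@ W \o (f \@ (dual X \ot W) \o coev X \@ W).
Proof. by rewrite /tr !TE /= ?tensm1 ?compf1. Qed.

Lemma tr_cyc X Y (f : hom Y X) (g : hom X Y) : tr (f \o g) = tr (g \o f).
Proof.
apply: (@T_inj k C (oneW C) (oneW C)); rewrite !tr_tail !T_comp -!compA.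
rewrite -coev_dualm (compA (f \@ _)) (T_nat f) /= -compA.
by rewrite (compA (revt X \@ _)) evt_dualm -!compA.
Qed.

(* The trace may be computed with any dual D of V, through the Drinfeld
   isomorphism. *)
Lemma tr_dual V D (e : hom (D \ot V) (one C)) (h : hom (one C) (V \ot D)) f :
  run V \o (('1_V \om e) \o (asc V D V \o ((h \om '1_V) \o luni V))) = '1_V ->
  tr f = e \o (br c V D \o (((twist V \o f) \om '1_D) \o h)).
Proof.
move=> zig; apply: (@T_inj k C (oneW C) (oneW C)).
have {}zig W : ('1_V \om e \@ W) \o h \@ (V \ot W) = '1_(V \ot W).
  have := congr1 (fun h => T (atom V) (atom V) h W) zig.
  by rewrite !(TE, @T_tens _ _ (atom _) (atom _)).
pose phi := lun (dual V) \o ((e \om '1_(dual V)) \o (asci D V (dual V)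
  \o (('1_D \om coev V) \o runi D))).
have phiT W : phi \@ W = e \@ (dual V \ot W) \o ('1_D \om coev V \@ W).
  by rewrite /phi !TE.
have ev_phi W : ev V \@ W \o phi \@ (V \ot W) = e \@ W.
  rewrite phiT compA -(T_nat e (ev V \@ W)) /= -compA -!tens1M.
  by rewrite zigzag1_tail !tensm1 compf1.
have phi_coev W : ('1_V \om phi \@ W) \o h \@ W = coev V \@ W.
  rewrite phiT tens1M -compA -(T_nat h (coev V \@ W)) /= compA zig.
  by rewrite comp1f.
rewrite tr_tail -phi_coev (compA (f \@ _)) (T_nat f) /= revt_tail -!compA.
rewrite (compA (twist V \@ _)) (T_nat (twist V)) /= -!compA.
rewrite (compA (br c V (dual V) \@ _)) br_natr_tail /= -!compA compA ev_phi.
by rewrite !TE /= ?tensm1 ?compf1 -!compA.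
Qed.

(** The right-handed duality makes X a dual of [dual X], so [tr_dual] applies; the twists that
    appear are absorbed by [ev_twist2]. *)
Lemma tr_dualobj X : tr '1_(dual X) = tr '1_X.
Proof.
have zig : run (dual X) \o (('1_(dual X) \om revt X) \o (asc (dual X) X (dual X)
    \o ((rcoev X \om '1_(dual X)) \o luni (dual X)))) = '1_(dual X).
  apply: (@T_inj k C (atom (dual X)) (atom (dual X))).
  by rewrite !TE /= right_zigzag2_tail.
rewrite (tr_dual _ zig); apply: (@T_inj k C (oneW C) (oneW C)).
rewrite tr_tail !TE /= ?tensm1 ?compf1 ?comp1f -ev_coevt revt_tail !rcoev_tail.
set W := one C; rewrite -!compA.
have := congr1 (fun h => h \o (('1_(dual X) \om twist X \@ W) \o (br c X (dual
  X) \@ W \o coev X \@ W))) (ev_twist2 X W).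
rewrite -!compA => <-.
rewrite (compA (twist X \@ _)) -(br_natr_tail c (dual X) (twist X)) /= -!compA.
by rewrite (compA ('1__ \om _) (twist (dual X) \@ _)) -(T_nat (twist (dual X)))
  /= -!compA.
Qed.

(** The Drinfeld isomorphism is monoidal up to the double crossing of X and Y. In cap form: this
    crossing, the one produced by [twist_tens], turns the braided cap of the tensor product into
    nested braided caps. *)
Lemma drinfeld_tens X Y W :
  ev Y \@ W \o (('1_(dual Y) \om ev X \@ (Y \ot W)) \o
   (br c (X \ot Y) (dual Y \ot dual X) \@ W \o
    (br c Y X \@ (dual Y \ot (dual X \ot W)) \o br c X Y \@ (dual Y \ot (dual X
      \ot W)))))
  = ev X \@ W \o (br c X (dual X) \@ W \o
     ('1_X \om (ev Y \@ (dual X \ot W) \o br c Y (dual Y) \@ (dual X \ot W)))).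
Proof.
pose V := tensW (atom X) (atom Y).
pose g X := ev X \o br c X (dual X).
have gT Z U : g Z \@ U = ev Z \@ U \o br c Z (dual Z) \@ U by rewrite /g !TE.
have step1 : ev X \@ (Y \ot W) \o (br c V (dual X) \@ W \o br c Y X \@ (dual X
  \ot W))
    = '1_Y \om g X \@ W.
  rewrite (br_hexl_tail c _ _ (atom (dual X))) /= -!compA (compA (ev X \@ _))
    -gT -(br_hexr_tail c Y X (dual X)).
  by rewrite -(br_natr_tail c Y (g X)) br_one_tail comp1f.
have step2 := br_natl_tail c (dual Y) (br c Y X) (dual X \ot W).
have hx := br_hexr_tail c V (dual Y) (dual X) W.
rewrite hx -!compA (compA (br c V (dual Y) \@ _)) step2 -!compA.
rewrite (compA ('1__ \om br c V (dual X) \@ _)) -tens1M.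
rewrite (compA ('1__ \om ev X \@ _)) -tens1M step1.
rewrite (br_hexl_tail c _ _ (atom (dual Y))) /= -!compA (compA (ev Y \@ _)).
rewrite (T_nat (ev Y) (g X \@ W)) /= gT -!compA; do 2!congr (_ \o _).
have N := br_natr_tail c X (g Y) (dual X \ot W).
rewrite (br_hexr_tail c (atom X)) /= br_one_tail comp1f !gT -!compA in N.
by rewrite N.
Qed.

Lemma zigzag_tail (V D : word C) (e : hom (D \ot V) (one C)) (h : hom (one C) (V
  \ot D)) :
  (forall W, tlm V (e \@ W) \o h \@ (tl V W) = '1_(tl V W)) ->
  run V \o (('1_V \om e) \o (asc V D V \o ((h \om '1_V) \o luni V))) = '1_V.
Proof. by move=> zig; apply: (@T_inj k C V V); rewrite !TE /= zig. Qed.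

Lemma tr_tens X Y (h : hom (X \ot Y) (X \ot Y)) W :
  tr h \@ W = revt X \@ W \o (('1_X \om revt Y \@ (dual X \ot W)) \o (h \@ (dual
    Y \ot (dual X \ot W)) \o
   (('1_X \om coev Y \@ (dual X \ot W)) \o coev X \@ W))).
Proof.
(* Nested cups and caps make [dual Y \ot dual X] a dual of [X \ot Y], which [tr_dual] accepts in
   place of the chosen one. *)
pose e : hom ((dual Y \ot dual X) \ot (X \ot Y)) (one C) := ev Y \o (('1_(dual
  Y) \om
  (lun Y \o ((ev X \om '1_Y) \o asci (dual X) X Y)))
  \o asc (dual Y) (dual X) (X \ot Y)).
pose h' : hom (one C) ((X \ot Y) \ot (dual Y \ot dual X)) := asci X Y (dual Y
  \ot dual X) \o (('1_X \om
  (asc Y (dual Y) (dual X) \o ((coev Y \om '1_(dual X)) \o luni (dual X))))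
  \o coev X).
pose V := tensW (atom X) (atom Y).
have eT U : e \@ U = ev Y \@ U \o ('1_(dual Y) \om ev X \@ (Y \ot U)).
  by rewrite /e !TE.
have hT U : h' \@ U = ('1_X \om coev Y \@ (dual X \ot U)) \o coev X \@ U.
  by rewrite /h' !TE.
have zig := @zigzag_tail V (tensW (atom (dual Y)) (atom (dual X))) e h'.
rewrite (tr_dual h (zig _)) => [|U]; last first.
  rewrite eT hT /= (compA ('1_X \om _)) -tens1M (tens1M Y) -compA.
  rewrite -(T_nat (coev Y) (ev X \@ _)) /= (compA ('1_Y \om _)) zigzag1_tail comp1f.
  by rewrite zigzag1_tail.
clearbody e h'; rewrite !TE /= eT hT twist_tens_tail !revt_tail -!compA.
have := congr1 (fun u => u \o (twist X \@ (Y \ot (dual Y \ot (dual X \ot W))) \o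
  (('1_X \om twist Y \@ (dual Y \ot (dual X \ot W))) \o
  (h \@ (dual Y \ot (dual X \ot W)) \o
  (('1_X \om coev Y \@ (dual X \ot W)) \o coev X \@ W))))) (drinfeld_tens X Y W).
rewrite -!compA => ->.
rewrite (compA ('1_X \om (ev Y \@ _ \o _))) -(T_nat (twist X)) /= -!compA.
rewrite (compA ('1__ \om _) ('1__ \om twist Y \@ _)) -tens1M -!compA.
by [].
Qed.

End Pivotal.

(** * Schur's lemma *)

Section Eigen.
Import VectorInternalTheory.
Variables (k : closedFieldType) (V : vectType k).

Lemma linear_eigenvector (f : V -> V) (v : V) : linear f -> v != 0 ->
  exists a (u : V), u != 0 /\ f u = a *: u.
Proof.
move=> lf v0.
pose L := GRing.isLinear.Build _ _ _ _ f lf.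
pose g : {linear V -> V} := HB.pack f L.
pose A := lin1_mx (v2r \o g \o r2v).
(* The characteristic polynomial needs positive degree to have a root; the nonzero [v] provides
   it. *)
have n0 : (0 < dim V)%N.
  rewrite lt0n; apply: contraNneq v0 => d0.
  rewrite -(v2rK v) (_ : v2r v = 0) ?linear0 //.
  by apply/rowP => -[m lt_m]; have := lt_m; rewrite {1}d0.
have /closed_rootP[a] : size (char_poly A) != 1%N by
  rewrite size_char_poly eqSS -lt0n.
rewrite -eigenvalue_root_char => /eigenvalueP[u /esym uA u0].
exists a, (r2v u); split.
  by apply: contraNneq u0 => e; rewrite -(r2vK u) e linear0.
by apply: (can_inj v2rK); rewrite linearZ /= r2vK uA mul_rV_lin1.
Qed.
End Eigen.

Section Schur.
Variables (k : closedFieldType) (C : lincat k) (ab : abelian C).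
Implicit Types X Y S : C.
Local Open Scope cat_scope.

Lemma comp_subr X Y Z (g : hom Y Z) (f f' : hom X Y) :
  g \o (f - f') = (g \o f) - (g \o f').
Proof.
by rewrite -scaleN1r addrC comp_linr scaleN1r addrC.
Qed.

Lemma compZl X Y Z a (g : hom Y Z) (f : hom X Y) : (a *: g) \o f = a *: (g \o f).
Proof. exact: (lin_scale (comp_linl f)). Qed.
Lemma compZr X Y Z a (g : hom Y Z) (f : hom X Y) : g \o (a *: f) = a *: (g \o f).
Proof. exact: (lin_scale (comp_linr g)). Qed.

Lemma simple_mono S Y (f : hom S Y) : simple S -> f <> 0 -> mono f.
Proof.
move=> [_ Ss] f0; have [kers _ _ _] := ab.
have [K [m [fm mP]]] := kers _ _ f.
have mono_m : mono m.
  move=> W g h e; have [u [_ uU]] := mP W (m \o g) (etrans (compA _ _ _) (etrans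
    (congr1 (fun x => x \o g) fm) (comp0l _ _))).
  by rewrite -(uU g) // -(uU h).
case: (Ss K m mono_m) => [K0 | [m' [_ mm']]]; last first.
  by case: f0; rewrite -[f]compf1 -mm' compA fm comp0l.
move=> W g h e.
have gh0 : f \o (g - h) = 0 by rewrite comp_subr e subrr.
have [u [um _]] := mP W _ gh0.
by apply/eqP; rewrite -subr_eq0 -um -[u]comp1f K0 comp0l comp0r.
Qed.

Lemma schur_iso S S' (f : hom S S') : simple S -> simple S' -> f <> 0 -> is_iso f.
Proof.
move=> Ss Ss' f0; case: (Ss'.2 _ _ (simple_mono Ss f0)) => // S0.
by case: Ss.1.
Qed.

(** Postcomposition with [f] on the endomorphisms of S has an eigenvector [g]; then [f - a] kills
    [g], so it is not mono and must vanish. *)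
Lemma schur S : simple S -> forall f : hom S S, exists a, f = a *: '1_S.
Proof.
move=> Ss f; have S0 : '1_S != 0 by apply/eqP; case: Ss.
have [a [g [g0 fg]]] := linear_eigenvector (comp_linr f) S0.
exists a; apply/eqP; rewrite -subr_eq0; apply/eqP.
case: (eqVneq (f - a *: '1_S) 0) => // /eqP h0.
have hm := simple_mono Ss h0.
case/eqP: g0; apply: hm; rewrite comp0r.
by rewrite -scaleNr addrC comp_linl comp1f fg scaleNr addrC subrr.
Qed.

End Schur.

Lemma isomorphic_sym (k : fieldType) (C : lincat k) (X Y : C) :
  isomorphic X Y -> isomorphic Y X.
Proof. by move=> [f [g [gf fg]]]; exists g, f. Qed.

Lemma isomorphic_trans (k : fieldType) (C : lincat k) (X Y Z : C) :
  isomorphic X Y -> isomorphic Y Z -> isomorphic X Z.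
Proof.
move=> [f [g [gf fg]]] [f' [g' [gf' fg']]]; exists (comp f' f), (comp g g'); split.
  by rewrite -compA (compA g') gf' comp1f.
by rewrite -compA (compA f) fg comp1f.
Qed.

(** * Semisimplicity and the representatives of the simple objects *)

Section SemisimpleFusion.
Variables (k : closedFieldType) (C : premodular k).
Implicit Types X Y S : C.
Local Open Scope cat_scope.

Lemma simple_decomposition X : exists n (S : 'I_n -> C)
   (u : forall a, hom (S a) X) (v : forall a, hom X (S a)),
   [/\ forall a, simple (S a), \sum_a (u a \o v a) = '1_X &
       forall a, v a \o u a = '1_(S a)].
Proof.
have [n [S [Ss [f [g [gf fg]]]]]] := fsemisimple (X : C).
exists n, S, (fun a => g \o dinj _ S a), (fun a => dproj _ S a \o f); split=> //.
  transitivity (g \o ((\sum_a (dinj (bip C) S a \o dproj (bip C) S a)) \o f)).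
    rewrite comp_suml comp_sumr; apply: eq_bigr => a _; by rewrite -!compA.
  by rewrite dsum_id comp1f.
by move=> a; rewrite -!compA (compA f) fg comp1f dproj_inj.
Qed.

Lemma simple_jointly_monic X Y (f g : hom Y X) :
  (forall S (w : hom X S), simple S -> w \o f = w \o g) -> f = g.
Proof.
move=> H; have [n [S [u [v [Ss uv _]]]]] := simple_decomposition X.
rewrite -[f]comp1f -[g]comp1f -uv !comp_suml; apply: eq_bigr => a _.
by rewrite -!compA H.
Qed.

Lemma irr_hom_neq (i j : 'I_(rk C)) (f : hom (irr i) (irr j)) : i <> j -> f = 0.
Proof.
move=> ij; case: (eqVneq f 0) => // /eqP f0; case: ij; apply: irr_distinct.
by exists f; apply: (schur_iso (fabelian C)) => //; apply: irr_simple.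
Qed.

Lemma irr_schur (i : 'I_(rk C)) (f : hom (irr i) (irr i)) : exists a,
  f = a *: '1_(irr i).
Proof. exact: (schur (fabelian C) (irr_simple i)). Qed.

Lemma one_neq0 : '1_(one C) != 0.
Proof. by apply/eqP; case: (one_simple C). Qed.

Lemma scal_id a : scal (a *: '1_(one C)) = a.
Proof.
have fr : free [tuple '1_(one C)] by rewrite seq1_free one_neq0.
by rewrite /scal linearZ /= (coord_free ord0 ord0 fr) eqxx mulr1.
Qed.

Lemma scalE (f : hom (one C) (one C)) : f = scal f *: '1_(one C).
Proof.
by have [a ->] := schur (fabelian C) (one_simple C) f; rewrite scal_id.
Qed.

End SemisimpleFusion.

(** * Partial traces and the S-matrix *)

Section PartialTrace.
Variables (k : fieldType) (C : premodular k).
Implicit Types A B X Y Z W J : C.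
Local Open Scope cat_scope.

Lemma ev_inj A X (g h : hom A (dual X)) :
  ev X \o (g \om '1_X) = ev X \o (h \om '1_X) -> g = h.
Proof.
move=> E; apply: (@T_inj k C (atom A) (atom (dual X))).
have {}E W := congr1 (fun u => T (tensW (atom A) (atom X)) (oneW C) u W) E.
rewrite -[LHS]comp1f -[RHS]comp1f -zigzag2_tail -!compA -!(T_nat _ (coev X \@
  one C)) /= !compA.
congr (_ \o _); have := E (dual X \ot one C).
by rewrite !TE /= ?tensm1 ?compf1.
Qed.

Lemma ev_repr X Y (h : hom (dual X \ot Y) (one C)) :
  exists g : hom Y X, h = ev X \o ('1_(dual X) \om g).
Proof.
exists (run X \o (('1_X \om h) \o (asc X (dual X) Y \o ((coev X \om '1_Y) \o
  luni Y)))).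
apply: (@T_inj k C (tensW (atom (dual X)) (atom Y)) (oneW C)).
rewrite !TE /= tens1M compA (T_nat (ev X) (h \@ one C)) /= -compA.
by rewrite zigzag2_tail compf1.
Qed.

(** [t] is the transpose of [f] under the right-handed duality of A; bending it back with [revt]
    recovers [f]. *)
Lemma rev_inj A S (f : hom A (dual S)) (t : hom S (dual A)) :
  (forall W, t \@ W = ('1_(dual A) \om (ev S \@ W \o f \@ (S \ot W))) \o rcoev A
    \@ (S \ot W)) ->
  t = 0 -> f = 0.
Proof.
move=> tE t0; apply: ev_inj; apply: (@T_inj k C (tensW (atom A) (atom S)) (oneW C)).
set W := one C; transitivity (0 : hom (tl (tensW (atom A) (atom S)) W) W).
  rewrite !TE /= ?tensm1 ?compf1.
  have := congr1 (fun h => revt A \@ W \o ('1_A \om h)) (tE W).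
  rewrite t0 (lin0 (@T_linear k C (atom S) (atom (dual A)) W)) tensm0r comp0r.
  rewrite [X in _ = _ \o X -> _]tens1M compA.
  rewrite (T_nat (revt A) (ev S \@ W \o f \@ (S \ot W))) /= -compA.
  by rewrite right_zigzag1_tail compf1 => <-.
symmetry; rewrite !TE /= ?tensm1 ?compf1.
by rewrite (lin0 (@T_linear k C (atom A) (atom (dual S)) _)) comp0r.
Qed.

Definition ptr_def A B J (D : hom (A \ot J) (B \ot J)) : hom A B :=
  run B \o (('1_B \om evt J) \o (asc B J (dual J) \o ((D \om '1_(dual J))
  \o (asci A J (dual J) \o (('1_A \om coev J) \o runi A))))).
Definition ptr := locked_with rdual_key ptr_def.

Lemma ptr_tail A B J (D : hom (A \ot J) (B \ot J)) W : T (atom A) (atom B) (ptr D) W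
  = ('1_B \om revt J \@ W) \o (D \@ (dual J \ot W) \o ('1_A \om coev J \@ W)).
Proof. by rewrite /ptr unlock /ptr_def revtE !TE /= ?tensm1 ?compf1. Qed.

Lemma tr_ptr X Y (h : hom (X \ot Y) (X \ot Y)) : tr (ptr h) = tr h.
Proof.
apply: (@T_inj k C (oneW C) (oneW C)).
by rewrite tr_tail tr_tens ptr_tail -!compA.
Qed.

Lemma tr_linear X : linear (@tr k C X).
Proof. by move=> a f g; rewrite /tr tensm_linl comp_linl comp_linr. Qed.
End PartialTrace.

Section Modular.
Variables (k : closedFieldType) (C : premodular k).
Implicit Types A B X Y Z W J : C.
Local Open Scope cat_scope.

Lemma TrE X (f : hom X X) : Tr f = scal (tr f).
Proof. by rewrite /tr -revtE. Qed.

Lemma qdimE X : tr '1_X = qdim X *: '1_(one C).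
Proof. by rewrite /qdim TrE -scalE. Qed.

Lemma ptr_id A J : ptr '1_(A \ot J) = qdim J *: '1_A.
Proof.
apply: (@T_inj k C (atom A) (atom A)); rewrite ptr_tail T_id comp1f T_scale T_id.
rewrite -tens1M -(tensm1 A) -(lin_scale (tensm_linr _)); congr (_ \om _).
have := congr1 (fun h => h \@ one C) (qdimE J).
by rewrite tr_tail !TE T_scale T_id => <-.
Qed.

Definition dblbr X Y := cbr Y X \o cbr X Y.
Definition transparent X := forall Z, dblbr X Z = '1_(X \ot Z).

Lemma dblbr_nat X X' Y (f : hom X X') :
  dblbr X' Y \o (f \om '1_Y) = (f \om '1_Y) \o dblbr X Y.
Proof. by rewrite /dblbr -compA br_nat compA br_nat -compA. Qed.

Lemma transparent_iso X X' : isomorphic X X' -> transparent X -> transparent X'.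
Proof.
move=> [f [g [gf fg]]] tX Z.
rewrite -[LHS]compf1 -(tensm1 X' Z) -fg tensM1 compA dblbr_nat tX compf1.
by rewrite -tensM1 fg.
Qed.

Lemma transparent_one : transparent (one C).
Proof.
move=> Z; rewrite /dblbr /cbr br_unit br_unitl.
by rewrite -!compA (compE2 (runiK _)) comp1f lunK.
Qed.

Hypothesis C_modular : modular C.
Local Notation d i := (qdim (irr (i : 'I_(rk C)))).

Definition Smx := \matrix_(i, j) Tr (cbr (irr j) (irr i) \o cbr (irr i) (irr j))
  : 'M[k]_(rk C).

Lemma Smx_inj (v : 'rV[k]_(rk C)) : v *m Smx = 0 -> v = 0.
Proof. by move=> vS; rewrite -(mulmxK C_modular v) [X in X *m _]vS mul0mx. Qed.

Lemma ptr_dblbr i J : exists r, ptr (dblbr (irr i) J) = r *: '1_(irr i)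
  /\ Tr (dblbr (irr i) J) = r * d i.
Proof.
have [r rE] := irr_schur (ptr (dblbr (irr i) J)); exists r; split=> //.
have : tr (dblbr (irr i) J) = (r * d i) *: '1_(one C).
  by rewrite -tr_ptr rE (lin_scale (@tr_linear _ _ _)) qdimE scalerA.
by move=> E; rewrite TrE E scal_id.
Qed.

(** By [ptr_dblbr] every entry of row i of the S-matrix is a multiple of [d i], and an invertible
    matrix has no zero row. *)
Lemma qdim_neq0 i : d i != 0.
Proof.
apply/negP => /eqP di0.
have : row i Smx = 0.
  apply/rowP => j; rewrite !mxE.
  by have [r [_]] := ptr_dblbr i (irr j); rewrite di0 mulr0.
move=> /(congr1 (mulmxr (invmx Smx))); rewrite /= mul0mx -row_mul mulmxV //.
move=> /rowP /(_ i); rewrite !mxE eqxx => /eqP; by rewrite oner_eq0.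
Qed.

Lemma transparent_Smx i j : transparent (irr i) -> Smx i j = d i * d j.
Proof.
move=> ti; rewrite mxE -/(dblbr _ _) ti TrE -tr_ptr ptr_id.
by rewrite (lin_scale (@tr_linear _ _ _)) qdimE scalerA scal_id mulrC.
Qed.

Lemma transparent_irr i j : transparent (irr i) -> transparent (irr j) -> i = j.
Proof.
move=> ti tj; apply/eqP; apply: contraT => ij.
(* The rows of two transparent simples have entries [d i * d l] and [d j * d l], so they are
   proportional; [v] is the resulting relation. *)
pose v : 'rV[k]_(rk C) := d j *: delta_mx 0 i - d i *: delta_mx 0 j.
have v0 : v = 0.
  apply: Smx_inj; rewrite mulmxBl -!scalemxAl -!rowE.
  apply/rowP => l; rewrite [LHS]mxE [X in X + _]mxE [X in _ + X]mxE.
  rewrite [X in - X]mxE ![row _ _ _ _]mxE !transparent_Smx // mxE.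
  by rewrite mulrCA mulrA (mulrC (d i)) -mulrA subrr.
have := congr1 (fun u : 'rV_(rk C) => u 0 i) v0.
rewrite !mxE !eqxx (negbTE ij) /= mulr0 subr0 mulr1 => /eqP.
by rewrite (negbTE (qdim_neq0 j)).
Qed.

Lemma transparent_simple S : simple S -> transparent S -> isomorphic S (one C).
Proof.
move=> Ss tS; have [i Si] := irr_exhaust Ss; have [j uj] := irr_exhaust
  (one_simple C).
have ij : i = j.
  apply: transparent_irr; first exact: transparent_iso tS.
  exact: transparent_iso uj transparent_one.
by apply: isomorphic_trans Si _; rewrite ij; apply: isomorphic_sym.
Qed.
End Modular.

(** * Dual bases *)

Section DualBases.
Variables (k : closedFieldType) (C : premodular k).
Implicit Types A B X Y Z W J : C.
Local Open Scope cat_scope.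
Local Notation dirr i := (dual (irr (i : 'I_(rk C)))).
Local Notation d i := (qdim (irr (i : 'I_(rk C)))).

(** Simplicity of the dual is not at hand; transposition through [ev] reduces the claim to
    endomorphisms of [irr i]. *)
Lemma dirr_schur i (g : hom (dirr i) (dirr i)) : exists a, g = a *: '1_(dirr i).
Proof.
have [g' gE] := ev_repr (ev (irr i) \o (g \om '1_(irr i))).
have [a aE] := irr_schur g'; exists a; apply: ev_inj.
rewrite gE aE (lin_scale (tensm_linr _)) (lin_scale (tensm_linl _)).
by rewrite !compZr.
Qed.

Lemma dirr_hom_neq i j (g : hom (dirr i) (dirr j)) : i <> j -> g = 0.
Proof.
move=> ij; have [g' gE] := ev_repr (ev (irr j) \o (g \om '1_(irr j))).
apply: ev_inj; rewrite gE (irr_hom_neq g'); last exact/nesym.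
by rewrite tensm0l tensm0r !comp0r.
Qed.

(** The representatives are the [irr i], whereas the dual bases involve their duals. A simple
    summand of [dual S], isomorphic to some [irr i], transposes to a nonzero map from S to
    [dual (irr i)], hence to a mono. *)
Lemma simple_to_dirr S : simple S -> exists i (t : hom S (dirr i)), mono t.
Proof.
move=> Ss; have [n [S' [u [v [S's uv vu]]]]] := simple_decomposition (dual S).
case: n S' u v S's uv vu => [|n] S' u v S's uv vu.
  (* Without any summand [dual S] would be zero, and the zigzag would make S zero. *)
  case: Ss => S0 _; case: S0; apply: (@T_inj k C (atom S) (atom S)).
  rewrite big_ord0 in uv; rewrite T_id.
  have z : '1_(dual S \ot (S \ot one C)) = 0.
    by rewrite -tensm1 -uv tensm0l.
  rewrite /= -(zigzag1_tail S (one C)) -[ev S \@ _]compf1 z comp0r tensm0r comp0l.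
  by rewrite (lin0 (@T_linear k C (atom S) (atom S) _)).
have [i [f [g [gf fg]]]] := irr_exhaust (S's ord0).
pose t : hom S (dirr i) := run (dirr i) \o (('1_(dirr i) \om (ev S \o ((u ord0
  \o g) \om '1_S)))
  \o (asc (dirr i) (irr i) S \o ((rcoev (irr i) \om '1_S) \o luni S))).
exists i, t; apply: (simple_mono (fabelian C) Ss) => t0.
have ug : u ord0 \o g = 0.
  apply: rev_inj t0 => W; rewrite /t !TE /= ?tensm1 ?compf1 //.
case: (S's ord0) => S0 _; case: S0.
by rewrite -vu -[u ord0]compf1 -gf (compA (u _)) ug comp0l comp0r.
Qed.

Variable bs : dual_bases C.
Hypothesis C_modular : modular C.

(** The composite is a scalar, determined by its trace; the division in [pairing] removes the factor
    [d i]. *)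
Lemma lower_upper_id X i (a b : 'I_(dbn bs X i)) :
  tnth (lower bs X i) a \o tnth (upper bs X i) b = (a == b)%:R *: '1_(dirr i).
Proof.
have [c cE] := dirr_schur (tnth (lower bs X i) a \o tnth (upper bs X i) b).
rewrite cE -(lower_upper a b) /pairing TrE -tr_cyc cE.
rewrite (lin_scale (@tr_linear _ _ _)) tr_dualobj qdimE scalerA scal_id.
by rewrite mulfK // qdim_neq0.
Qed.

Lemma lower_span X i (w : hom X (dirr i)) :
  w = \sum_a coord (lower bs X i) a w *: tnth (lower bs X i) a.
Proof.
rewrite {1}(coord_basis (lower_basis bs X i) (memvf w)).
by apply: eq_bigr => a _; rewrite (tnth_nth 0).
Qed.

Lemma upper_span X i (w : hom (dirr i) X) :
  w = \sum_a coord (upper bs X i) a w *: tnth (upper bs X i) a.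
Proof.
rewrite {1}(coord_basis (upper_basis bs X i) (memvf w)).
by apply: eq_bigr => a _; rewrite (tnth_nth 0).
Qed.

(** Maps to a simple object embed into maps to some [dual (irr i)], which the lower basis spans;
    against a basis element only its own term survives. *)
Lemma dual_bases_sum X : \sum_i \sum_(a < dbn bs X i)
  (tnth (upper bs X i) a \o tnth (lower bs X i) a) = '1_X.
Proof.
set E := \sum_i _; apply: simple_jointly_monic => S w Ss.
have [i [t tm]] := simple_to_dirr Ss; apply: tm; rewrite !compA compf1.
rewrite (lower_span (t \o w)) comp_suml; apply: eq_bigr => a _.
rewrite compZl; congr (_ *: _); rewrite comp_sumr (bigD1 i) //= comp_sumr.
rewrite (bigD1 a) //= compA lower_upper_id eqxx scale1r comp1f.
rewrite !big1 ?addr0 //.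
  move=> j /eqP ji; rewrite comp_sumr big1 // => b _.
  by rewrite compA (dirr_hom_neq (_ \o _)) ?comp0l.
move=> b ba; rewrite compA lower_upper_id eq_sym (negbTE ba).
by rewrite scale0r comp0l.
Qed.

Section Bend.
Variables (l j Z : C).

Definition bendv_def (y : hom (dual l \ot Z) (dual j)) : hom (Z \ot j) l :=
  run l \o (('1_l \om (ev j \o ((y \om '1_j) \o asci (dual l) Z j)))
  \o (asc l (dual l) (Z \ot j) \o ((coev l \om '1_(Z \ot j)) \o luni (Z \ot j)))).

(** Frobenius reciprocity, as for [bendv_def]: the factors [dual l] and [dual j] are traded for [l]
    and [j] across the arrow. *)
Definition bendu_def (x : hom (dual j) (dual l \ot Z)) : hom l (Z \ot j) :=
  lun (Z \ot j) \o ((revt l \om '1_(Z \ot j)) \o (asci l (dual l) (Z \ot j)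
  \o (('1_l \om (asc (dual l) Z j \o ((x \om '1_j) \o rcoev j))) \o runi l))).

Definition bendv := locked_with rdual_key bendv_def.
Definition bendu := locked_with rdual_key bendu_def.

Lemma bendv_tail y W : bendv y \@ W =
  ('1_l \om (ev j \@ W \o y \@ (j \ot W))) \o coev l \@ (Z \ot (j \ot W)).
Proof. by rewrite /bendv unlock /bendv_def !TE /= ?tensm1 ?compf1. Qed.

Lemma bendu_tail x W : bendu x \@ W =
  revt l \@ (Z \ot (j \ot W)) \o ('1_l \om (x \@ (j \ot W) \o rcoev j \@ W)).
Proof. by rewrite /bendu unlock /bendu_def !TE /= ?tensm1 ?compf1. Qed.

Lemma bendv_linear : linear bendv.
Proof.
by move=> a f g; rewrite /bendv unlock /bendv_def tensm_linl comp_linl comp_linr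
  tensm_linr comp_linl comp_linr.
Qed.

Lemma coev_bendv (y : hom (dual l \ot Z) (dual j)) W : ('1_l \om y \@ W) \o coev
  l \@ (Z \ot W)
  = bendv y \@ (dual j \ot W) \o ('1_Z \om coev j \@ W).
Proof.
rewrite bendv_tail -compA (T_nat (coev l) ('1_Z \om coev j \@ W)) /= compA -tens1M.
by rewrite -compA (T_nat y (coev j \@ W)) /= compA zigzag2_tail comp1f.
Qed.

Lemma revt_bendu (x : hom (dual j) (dual l \ot Z)) W : revt l \@ (Z \ot W) \o
  ('1_l \om x \@ W)
  = ('1_Z \om revt j \@ W) \o bendu x \@ (dual j \ot W).
Proof.
rewrite bendu_tail compA -(T_nat (revt l) ('1_Z \om revt j \@ W)) /= -compA -tens1M.
by rewrite compA -(T_nat x (revt j \@ W)) /= -compA right_zigzag2_tail compf1.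
Qed.

Lemma bendv_surj (w : hom (Z \ot j) l) : exists y, w = bendv y.
Proof.
exists (lun (dual j) \o (((ev l \o ('1_(dual l) \om w)) \om '1_(dual j))
  \o (asci (dual l) (Z \ot j) (dual j) \o (('1_(dual l) \om (asci Z j (dual j) \o
   (('1_Z \om coev j) \o runi Z))))))).
apply: (@T_inj k C (tensW (atom Z) (atom j)) (atom l)); rewrite bendv_tail !TE /=.
set W := one C; rewrite -!compA (compA (ev j \@ _)).
rewrite -(T_nat (ev l) (ev j \@ W)) /= -!compA -!tens1M.
have -> : ('1_l \om ev j \@ W) \o (w \@ (dual j \ot (j \ot W)) \o ('1_Z \om coev
  j \@ (j \ot W))) = w \@ W.
  by rewrite compA -(T_nat w (ev j \@ W)) /= -compA -tens1M zigzag1_tail !tensm1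
    compf1.
rewrite tens1M -compA -(T_nat (coev l) (w \@ W)) /= compA zigzag1_tail comp1f //.
Qed.
End Bend.

(** Both products are the value of one closed diagram, read as a loop along [l] or along [j]. *)
Lemma bend_scalar (l j : C) Z (x : hom (dual j) (dual l \ot Z)) (y : hom (dual l
  \ot Z) (dual j)) a c :
  y \o x = c *: '1_(dual j) -> bendv y \o @bendu l j Z x = a *: '1_l ->
  a * qdim l = c * qdim j.
Proof.
move=> yx vu.
have H : ev l \@ one C \o (('1_(dual l) \om (bendv y \o bendu x) \@ one C) \o
  rcoev l \@ one C)
  = ev j \@ one C \o ((y \o x) \@ (j \ot one C) \o rcoev j \@ one C).
  set W := one C.
  rewrite !T_comp tens1M -!compA.
  have -> : ev l \@ W \o (('1_(dual l) \om bendv y \@ W) \o (('1_(dual l) \om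
    bendu x \@ W) \o rcoev l \@ W))
    = (ev l \@ W \o ('1_(dual l) \om bendv y \@ W)) \o (('1_(dual l) \om bendu x
      \@ W) \o rcoev l \@ W).
    by rewrite !compA.
  have -> : ev l \@ W \o ('1_(dual l) \om bendv y \@ W) = ev j \@ W \o y \@ (j
    \ot W).
    rewrite bendv_tail (tens1M _ ('1_l \om _)) compA (T_nat (ev l) (ev j \@ W \o
      y \@ (j \ot W))) /=.
    by rewrite -compA zigzag2_tail compf1.
  have -> : ('1_(dual l) \om bendu x \@ W) \o rcoev l \@ W = x \@ (j \ot W) \o
    rcoev j \@ W.
    rewrite bendu_tail (tens1M _ (revt l \@ _)) -compA -(T_nat (rcoev l) (x \@
      (j \ot W) \o rcoev j \@ W)) /=.
    by rewrite compA right_zigzag2_tail comp1f.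
  by rewrite -!compA.
rewrite vu yx !T_scale !T_id (lin_scale (tensm_linr _)) tensm1 !compZl !comp1f
  !compZr !ev_coevt in H.
have E X : revt X \@ one C \o coev X \@ one C = qdim X *: '1_(one C).
  have := congr1 (fun h => h \@ one C) (qdimE X).
  by rewrite tr_tail !T_id comp1f T_scale T_id.
rewrite !E !scalerA in H.
by have := congr1 (@scal k C) H; rewrite !scal_id.
Qed.

(** A resolution of the identity by rotated bases: by [bend_scalar] these are dual only up to the
    ratio [d j / d l], which the weights [d l] compensate. *)
Lemma bend_sum (j : 'I_(rk C)) Z : \sum_l \sum_(b < dbn bs (dual (irr l) \ot Z) j)
   d l *: (bendu (tnth (upper bs (dual (irr l) \ot Z) j) b)
     \o bendv (tnth (lower bs (dual (irr l) \ot Z) j) b)) = d j *: '1_(Z \ot irr j).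
Proof.
pose v l b := bendv (tnth (lower bs (dual (irr l) \ot Z) j) b).
pose u l b := bendu (tnth (upper bs (dual (irr l) \ot Z) j) b).
set E := \sum_l _; apply: simple_jointly_monic => S w Ss.
have [l [f [g [gf fg]]]] := irr_exhaust Ss.
suff H (w' : hom (Z \ot irr j) (irr l)) : w' \o E = d j *: w'.
  by rewrite compZr compf1 -[w]comp1f -gf -!compA (compA f w) H compZr.
have [y ->] := bendv_surj w'.
have vu a b : v l a \o u l b = ((a == b)%:R * (d j / d l)) *: '1_(irr l).
  have [c cE] := irr_schur (v l a \o u l b).
  have := bend_scalar (lower_upper_id a b) cE; rewrite cE mulrA => <-.
  by rewrite mulfK ?qdim_neq0.
rewrite (lower_span y) (lin_sum (@bendv_linear _ _ _)) comp_suml scaler_sumr.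
apply: eq_bigr => a _; rewrite (lin_scale (@bendv_linear _ _ _)) compZl.
rewrite !scalerA mulrC -scalerA; congr (_ *: _).
rewrite comp_sumr (bigD1 l) //= comp_sumr (bigD1 a) //= compZr compA.
rewrite vu eqxx mul1r compZl comp1f scalerA mulrC divfK ?qdim_neq0 //.
rewrite !big1 ?addr0 //.
  move=> l' /eqP ll'; rewrite comp_sumr big1 // => b _.
  by rewrite compZr compA (irr_hom_neq (_ \o _)) ?comp0l ?scaler0 //.
move=> b /eqP ba; rewrite compZr compA vu.
case: eqP => [ab|_]; first by case: ba.
by rewrite mul0r scale0r comp0l scaler0.
Qed.
End DualBases.

(** * Averaging over rings *)

Section Averaging.
Variables (k : closedFieldType) (C : premodular k).
Implicit Types (A B X Y Z W J : C) (E : word C).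
Local Open Scope cat_scope.
Local Notation dirr i := (dual (irr (i : 'I_(rk C)))).
Local Notation d i := (qdim (irr (i : 'I_(rk C)))).

Section HandleSlide.
Variables (A B : C) (D : forall J, hom (A \ot J) (B \ot J)).
Hypothesis Dnat : forall J K (g : hom J K), D K \o ('1_A \om g) = ('1_B \om g)
  \o D J.

Lemma natural_family_tail E E' (g : hom E E') W :
  T (tensW (atom A) E') (tensW (atom B) E') (D E') W \o ('1_A \om g \@ W)
  = ('1_B \om g \@ W) \o T (tensW (atom A) E) (tensW (atom B) E) (D E) W.
Proof.
have := congr1 (fun h => T (tensW (atom A) E) (tensW (atom B) E') h W) (Dnat g).
by rewrite !TE /=.
Qed.

Variable bs : dual_bases C.
Hypothesis C_modular : modular C.

(** [bend_sum] cuts [Z \ot irr j] into pieces through [irr l]; naturality of [D] moves one half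
    through, [revt_bendu] and [coev_bendv] slide the halves along the ring, and the dual bases of
    [dirr l \ot Z] resum to the identity. *)
Lemma handle_slide Z W :
  \sum_j d j *: (('1_B \om ('1_Z \om revt (irr j) \@ W)) \o
    (D (Z \ot irr j) \@ (dirr j \ot W) \o ('1_A \om ('1_Z \om coev (irr j) \@ W))))
  = \sum_l d l *: ptr (D (irr l)) \@ (Z \ot W).
Proof.
pose x l j b := tnth (upper bs (dirr l \ot Z) j) b.
pose y l j b := tnth (lower bs (dirr l \ot Z) j) b.
transitivity (\sum_j \sum_l \sum_(b < dbn bs (dirr l \ot Z) j) d l *:
  (('1_B \om ('1_Z \om revt (irr j) \@ W)) \o
    (D (Z \ot irr j) \@ (dirr j \ot W) \o
     (('1_A \om (bendu (x l j b) \o bendv (y l j b)) \@ (dirr j \ot W))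
     \o ('1_A \om ('1_Z \om coev (irr j) \@ W)))))).
  apply: eq_bigr => j _.
  have H := bend_sum bs C_modular j Z.
  have {}H := congr1 (fun h => T (tensW (atom Z) (atom (irr j)))
     (tensW (atom Z) (atom (irr j))) h (dirr j \ot W)) H.
  rewrite T_scale T_id T_sum in H.
  have -> : ('1_A \om ('1_Z \om coev (irr j) \@ W)) =
    '1_(A \ot (Z \ot (irr j \ot (dirr j \ot W)))) \o ('1_A \om ('1_Z \om coev
      (irr j) \@ W)).
    by rewrite comp1f.
  rewrite -2!compZr -compZl -(tensm1 A) -(lin_scale (tensm_linr _)) /= -H.
  rewrite tensm_sumr comp_suml !comp_sumr; apply: eq_bigr => l _.
  rewrite T_sum tensm_sumr comp_suml !comp_sumr; apply: eq_bigr => b _.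
  by rewrite T_scale (lin_scale (tensm_linr _)) compZl !compZr tensm1 comp1f.
rewrite exchange_big /=; apply: eq_bigr => l _.
under eq_bigr do rewrite -scaler_sumr; rewrite -scaler_sumr; congr (_ *: _).
have := congr1 (fun h => T (tensW (atom (dirr l)) (atom Z))
     (tensW (atom (dirr l)) (atom Z)) h W) (dual_bases_sum bs C_modular (dirr l
       \ot Z)).
rewrite T_id T_sum => H.
rewrite ptr_tail -[coev (irr l) \@ _]comp1f -(tensm1 (irr l)) /= -H.
rewrite tensm_sumr comp_suml tensm_sumr !comp_sumr; apply: eq_bigr => j _.
rewrite T_sum tensm_sumr comp_suml tensm_sumr !comp_sumr; apply: eq_bigr => b _.
rewrite (T_comp (E := tensW (atom Z) (atom (irr j))) (E' := atom (irr l))).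
rewrite (T_comp (E := tensW (atom (dirr l)) (atom Z)) (E' := atom (dirr j))).
rewrite -/(x l j b) -/(y l j b).
rewrite (tens1M A (bendu _ \@ _)) -!compA (compA (D (Z \ot irr j) \@ _)).
rewrite (natural_family_tail (E := atom (irr l)) (bendu (x l j b))) -!compA.
rewrite /= (compA ('1_B \om ('1_Z \om _))) -(tens1M B ('1_Z \om _)) -revt_bendu
  -(tens1M A (bendv _ \@ _)) -coev_bendv.
rewrite (tens1M B) -!compA; congr (_ \o _).
rewrite compA -(T_nat (D (irr l)) (x l j b \@ W)) /= -!compA -tens1M.
by rewrite compA -tens1M.
Qed.
End HandleSlide.

Definition loop A B (a : half_braiding A) (b : half_braiding B) (f : hom A B) J
  : hom A B :=
  run B \o (('1_B \om evt J) \o (asc B J (dual J) \o (((b J \o ('1_J \om f)) \om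
    '1_(dual J))
  \o (asci J A (dual J) \o (('1_J \om a (dual J)) \o (asc J (dual J) A
  \o ((coev J \om '1_A) \o luni A))))))).

Definition ring_sum A B (a : half_braiding A) (b : half_braiding B) f : hom A B :=
  \sum_j d j *: loop a b f (irr j).

Definition avg A B (a : half_braiding A) (b : half_braiding B) f : hom A B :=
  (dimOmega C)^-1 *: ring_sum a b f.

Lemma loop_tail (E F : word C) (a : half_braiding E) (b : half_braiding F) (f :
  hom E F) J W :
  loop a b f J \@ W = tlm F (revt J \@ W) \o (b J \@ (dual J \ot W) \o
    (('1_J \om f \@ (dual J \ot W)) \o (('1_J \om a (dual J) \@ W) \o coev J \@
      (tl E W)))).
Proof. by rewrite /loop revtE !TE /= ?tlm1 ?compf1 -!compA. Qed.

Section Loops.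
Variables (A B : C) (a : half_braiding A) (b : half_braiding B).
Implicit Types f : hom A B.

(** Tensoriality and naturality along [coev] express [a] at [dual J] by the inverse of [a] at J. *)
Lemma hbi_coev J W : hbi a J \@ (dual J \ot W) \o ('1_A \om coev J \@ W)
  = ('1_J \om a (dual J) \@ W) \o coev J \@ (A \ot W).
Proof.
symmetry; apply/hbi_move.
have := hb_word_nat a (coev J) W; rewrite hb_one compf1 => <-.
by rewrite hb_word_tens /= -!compA.
Qed.

(** The dual of J disappears from the crossings, and the ring becomes the partial trace of a family
    natural in J, as [handle_slide] requires. *)
Lemma loopE f J : loop a b f J = ptr (b J \o (('1_J \om f) \o hbi a J)).
Proof.
apply: (@T_inj k C (atom A) (atom B)); rewrite ptr_tail /loop revtE !TE /=
  ?tensm1 ?compf1.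
by rewrite -!compA hbi_coev.
Qed.

Lemma hbi_word_tens E E' W :
  hbi a (E \ot E') \@ W = tlm E (hbi a E' \@ W) \o hbi a E \@ (tl E' W).
Proof.
have := hb_word_tens a E E' W; set u := _ \@ W => uE.
apply: (@inv_unique _ _ _ _ u); first exact: (T_iso (E := tensW (tensW E E')
  (atom A)) _ (hbiK a _)).
rewrite uE -!compA (compA (tlm E _)) -tlmM.
by rewrite (T_iso (E := tensW (atom A) E') _ (hbKi a E')) tlm1 comp1f (T_iso (E
  := tensW (atom A) E) _ (hbKi a E)).
Qed.

Lemma ring_sum_cpt (bs : dual_bases C) (C_modular : modular C) f :
  cpt a b (ring_sum a b f).
Proof.
move=> Z; apply: (@T_inj k C (tensW (atom Z) (atom A)) (tensW (atom B) (atom Z))).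
set W := one C; rewrite !TE /=.
pose D J := b J \o (('1_J \om f) \o hbi a J).
have Dnat J K (g : hom J K) : D K \o ('1_A \om g) = ('1_B \om g) \o D J.
  by rewrite /D -!compA hbi_nat (compA ('1_K \om f)) tens_swap -!compA compA
    hb_nat -!compA.
rewrite /ring_sum !T_sum; under [in RHS]eq_bigr do rewrite T_scale loopE.
rewrite -(handle_slide Dnat bs C_modular Z W) tensm_sumr comp_sumr comp_suml.
apply: eq_bigr => j _; rewrite T_scale (lin_scale (tensm_linr _)) compZr compZl.
(* By tensoriality the crossings with Z split off: the inverse of [a Z] cancels against [a Z], and
   [b Z] comes out past the cap. *)
congr (_ *: _); rewrite loopE ptr_tail /D !TE /= hb_word_tens hbi_word_tens /=
  -!compA.
rewrite -(T_nat (a Z) (coev (irr j) \@ W)) /=.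
rewrite (compE2 (hbiK_tail a Z _)) comp1f !compA -(T_nat (b Z) (revt (irr j) \@
  W)) /=.
by rewrite -!compA -!tens1M.
Qed.

Lemma avg_cpt (bs : dual_bases C) (C_modular : modular C) f : cpt a b (avg a b f).
Proof. by apply: cpt_scale; apply: ring_sum_cpt. Qed.

(** For central [f] the two crossings cancel, and the ring comes off as a closed loop. *)
Lemma loop_cpt f J : cpt a b f -> loop a b f J = qdim J *: f.
Proof.
move=> F; rewrite loopE compA F -compA hbKi compf1.
apply: (@T_inj k C (atom A) (atom B)); rewrite ptr_tail T_scale !TE /= ?tensm1
  ?compf1.
rewrite compA -(T_nat f) /= -compA -tens1M.
have := congr1 (fun h => h \@ one C) (qdimE J).
rewrite tr_tail T_id comp1f T_scale T_id => ->.
by rewrite (lin_scale (tensm_linr _)) tensm1 compZr compf1.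
Qed.

Hypothesis dimOmega_neq0 : dimOmega C != 0.

Lemma avg_id f : cpt a b f -> avg a b f = f.
Proof.
move=> F; rewrite /avg /ring_sum; under eq_bigr do rewrite loop_cpt // scalerA.
by rewrite -scaler_suml scalerA mulVf // scale1r.
Qed.

End Loops.

Lemma avg_compr A A' B (a : half_braiding A) (a' : half_braiding A')
    (b : half_braiding B) (f : hom A B) (h : hom A' A) : cpt a' a h ->
  avg a b f \o h = avg a' b (f \o h).
Proof.
move=> H; rewrite /avg /ring_sum compZl comp_suml; congr (_ *: _);
  apply: eq_bigr => j _.
rewrite compZl; congr (_ *: _).
apply: (@T_inj k C (atom A') (atom B)).
rewrite (T_comp (E' := atom A)) !loop_tail (T_comp (E' := atom A)) -!compA.
rewrite (T_nat (coev (irr j)) (h \@ _)) /=.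
rewrite (compA ('1__ \om a _ \@ _)) -tens1M (cpt_tail H) (tens1M _ (h \@ _)).
by rewrite (tens1M _ (f \@ _)) -!compA.
Qed.

Lemma avg_compl A B B' (a : half_braiding A)
    (b : half_braiding B) (b' : half_braiding B') (f : hom A B) (h : hom B B') :
      cpt b b' h ->
  h \o avg a b f = avg a b' (h \o f).
Proof.
move=> H; rewrite /avg /ring_sum compZr comp_sumr; congr (_ *: _);
  apply: eq_bigr => j _.
rewrite compZr; congr (_ *: _).
apply: (@T_inj k C (atom A) (atom B')).
rewrite (T_comp (E' := atom B)) !loop_tail (T_comp (E' := atom B)) (tens1M _ (h
  \@ _)).
rewrite compA (T_nat h) /= -!compA; congr (_ \o _).
by rewrite (compA (h \@ _)) -(cpt_tail H) -!compA.
Qed.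

(** Around Y the ring enters and leaves by the same half-braiding, so naturality along [revt] pulls
    it off Y. *)
Lemma avg_tens A B Y (a : half_braiding A) (b : half_braiding B) (y :
  half_braiding Y)
    (f : hom A B) :
  avg (hbT a y) (hbT b y) (f \om '1_Y) = avg a b f \om '1_Y.
Proof.
rewrite /avg /ring_sum (lin_scale (tensm_linl _)) tensm_suml; congr (_ *: _).
apply: eq_bigr => j _; rewrite (lin_scale (tensm_linl _)); congr (_ *: _).
apply: (@T_inj k C (tensW (atom A) (atom Y)) (tensW (atom B) (atom Y))).
rewrite [in RHS]T_tens T_id tlm1 compf1 !loop_tail T_tens T_id /= !tensm1
  !compf1 !hbT_tail /= -!compA.
set J := irr j; set W := one C.
rewrite (tens1M J ('1_A \om _)) -!compA (compA ('1_J \om f \@ _)) -(tens1M J (f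
  \@ _)).
rewrite (T_nat f (y (dual J) \@ W)) /= (tens1M J ('1_B \om _)) -!compA.
rewrite (compA (b J \@ _)) (T_nat (b J) (y (dual J) \@ W)) /= -!compA.
rewrite (compA ('1_B \om y J \@ _)) -(tens1M B (y J \@ _)).
rewrite (compA ('1_B \om ('1_Y \om _))) -(tens1M B ('1_Y \om _)).
have := hb_word_nat y (revt J) W; rewrite hb_one comp1f hb_word_tens /= => <-.
by [].
Qed.
End Averaging.

(** * Averages between the two braidings *)

Section Killing.
Variables (k : closedFieldType) (C : premodular k).
Implicit Types (A B X Y Z W J V : C) (E : word C).
Local Open Scope cat_scope.
Local Notation c := (pbr C).
Local Notation dirr i := (dual (irr (i : 'I_(rk C)))).
Local Notation d i := (qdim (irr (i : 'I_(rk C)))).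
Variable bs : dual_bases C.
Hypothesis C_modular : modular C.

Lemma hbi_br V J : hbi (hbB (bop c) V) J = cbr V J.
Proof. exact: (@inv_unique _ _ _ _ (bri c V J) _ _ (hbiK (hbB (bop c) V) J) (brK
  c V J)). Qed.

Lemma transparent_of_cpt_bop_br V r : r != 0 -> 
  cpt (hbB (bop c) V) (hbB c V) (r *: '1_V) -> transparent V.
Proof.
move=> r0 H Z; have := H Z.
rewrite (lin_scale (tensm_linr _)) (lin_scale (tensm_linl _)) !tensm1.
rewrite compZl compZr comp1f compf1 /= => /(scalerI r0) E.
by rewrite /dblbr /cbr E brK.
Qed.

Lemma transparent_of_cpt_br_bop V r : r != 0 -> 
  cpt (hbB c V) (hbB (bop c) V) (r *: '1_V) -> transparent V.
Proof.
move=> r0 H Z; have := H Z.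
rewrite (lin_scale (tensm_linr _)) (lin_scale (tensm_linl _)) !tensm1.
rewrite compZl compZr comp1f compf1 /= => /(scalerI r0) E.
by rewrite /dblbr /cbr -E brK.
Qed.

(** If [dimOmega] vanished, the vector of dimensions would lie in the kernel of the S-matrix: entry
    i of the product is [d i * r], with r the scalar of a ring sum on [irr i], and a nonzero r makes
    [irr i] transparent, so that the entry is [d i * dimOmega]. The unnormalized [ring_sum] is used
    because [avg] divides by [dimOmega]. *)
Lemma dimOmega_neq0 : dimOmega C != 0.
Proof.
apply/negP => /eqP O0.
have [j0 _] := irr_exhaust (one_simple C).
pose v : 'cV[k]_(rk C) := \col_j d j.
suff v0 : v = 0.
  have := congr1 (fun u : 'cV_(rk C) => u j0 0) v0; rewrite !mxE => /eqP.
  by rewrite (negbTE (qdim_neq0 C_modular j0)).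
suff Sv : Smx C *m v = 0 by rewrite -(mulKmx C_modular v) [X in _ *m X]Sv mulmx0.
apply/colP => i; rewrite !mxE.
have [r rE] := irr_schur (ring_sum (hbB (bop c) (irr i)) (hbB c (irr i)) '1_(irr
  i)).
have cr := ring_sum_cpt (hbB (bop c) (irr i)) (hbB c (irr i)) bs C_modular
  '1_(irr i).
have SE : \sum_j Smx C i j * v j 0 = d i * r.
  have := congr1 (fun f => scal (tr f)) rE.
  rewrite (lin_scale (@tr_linear _ _ _)) qdimE scalerA scal_id mulrC => <-.
  rewrite /ring_sum (lin_sum (@tr_linear _ _ _)).
  rewrite (_ : \sum_i0 _ = (\sum_j d j * Smx C i j) *: '1_(one C)) ?scal_id.
    by apply: eq_bigr => j _; rewrite !mxE mulrC.
  rewrite scaler_suml; apply: eq_bigr => j _.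
  rewrite (lin_scale (@tr_linear _ _ _)) mxE -scalerA; congr (_ *: _).
  by rewrite loopE tensm1 comp1f hbi_br tr_ptr /= TrE -scalE.
case: (eqVneq r 0) SE => [->|r0 _]; first by rewrite mulr0.
rewrite rE in cr; have ti := transparent_of_cpt_bop_br r0 cr.
under eq_bigr do rewrite (transparent_Smx _ ti) mxE -mulrA -expr2.
by rewrite -mulr_sumr -/(dimOmega C) O0 mulr0.
Qed.

Lemma avg_simple S : simple S ->
  avg (hbB c S) (hbB (bop c) S) '1_S = 0 \/ isomorphic S (one C).
Proof.
move=> Ss; have [r rE] := schur (fabelian C) Ss (avg (hbB c S) (hbB (bop c) S)
  '1_S).
rewrite rE; case: (eqVneq r 0) => [->|r0]; first by left; rewrite scale0r.
right; have cr := avg_cpt (hbB c S) (hbB (bop c) S) bs C_modular '1_S.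
rewrite rE in cr; apply: transparent_simple Ss _ => //.
exact: transparent_of_cpt_br_bop r0 cr.
Qed.

Lemma avg_one : avg (hbB c (one C)) (hbB (bop c) (one C)) '1_(one C) = '1_(one C).
Proof.
apply: (avg_id dimOmega_neq0) => Z; rewrite !tensm1 comp1f compf1 /=.
exact: etrans (br_unit (bop c) Z) (esym (br_unit c Z)).
Qed.

(** Every morphism is central for either braiding, so this average is an endomorphism of the
    identity functor. *)
Lemma avg_conj A B (u : hom A B) :
  avg (hbB c B) (hbB (bop c) B) '1_B \o u = u \o avg (hbB c A) (hbB (bop c) A) '1_A.
Proof.
rewrite (avg_compr _ _ (cpt_br c u)) (avg_compl _ _ (cpt_br (bop c) u)).
by rewrite comp1f compf1.
Qed.

Lemma hom_one_dual X Y (h : hom (one C) (X \ot dual Y)) :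
  exists g : hom Y X, h = (g \om '1_(dual Y)) \o coev Y.
Proof.
exists (run X \o (('1_X \om ev Y) \o (asc X (dual Y) Y \o ((h \om '1_Y) \o luni
  Y)))).
apply: (@T_inj k C (oneW C) (tensW (atom X) (atom (dual Y)))).
rewrite !TE /= ?tensm1 ?compf1 -!compA (T_nat h (coev Y \@ one C)) /= compA -tens1M.
by rewrite zigzag2_tail tensm1 comp1f.
Qed.

Lemma hom_dual_one X Y (h : hom (X \ot dual Y) (one C)) :
  exists g : hom X Y, h = revt Y \o (g \om '1_(dual Y)).
Proof.
exists (lun Y \o ((h \om '1_Y) \o (asci X (dual Y) Y \o (('1_X \om rcoev Y) \o
  runi X)))).
apply: (@T_inj k C (tensW (atom X) (atom (dual Y))) (oneW C)).
rewrite !TE /= ?tensm1 ?compf1 compA -(T_nat h (revt Y \@ one C)) /= -compA -tens1M.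
by rewrite right_zigzag2_tail tensm1 compf1.
Qed.

Lemma avg_unit S : isomorphic S (one C) ->
  avg (hbB c S) (hbB (bop c) S) '1_S = '1_S.
Proof.
move=> [f [g [gf _]]]; have E := congr1 (fun h => h \o f) (avg_conj g).
by rewrite avg_one compf1 -compA gf compf1 in E.
Qed.

(** By [avg_conj] the average acts summand by summand, and [avg_simple] leaves only the summands
    isomorphic to the unit. *)
Lemma avg_through_unit V : exists n (x : 'I_n -> hom (one C) V) (y : 'I_n -> hom
  V (one C)),
  avg (hbB c V) (hbB (bop c) V) '1_V = \sum_a (x a \o y a).
Proof.
have [n [S [u [v [Ss uv vu]]]]] := simple_decomposition V.
have H a : {xy : hom (one C) V * hom V (one C) |
   avg (hbB c V) (hbB (bop c) V) '1_V \o (u a \o v a) == xy.1 \o xy.2}.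
  apply: sigW; rewrite compA avg_conj.
  case: (avg_simple (Ss a)) => [-> | iso].
    by exists (0, 0); rewrite comp0r !comp0l.
  rewrite avg_unit //; case: iso => f [g [gf fg]].
  exists (u a \o g, f \o v a) => /=; apply/eqP.
  by rewrite compf1 -compA (compA g) gf comp1f.
exists n, (fun a => (sval (H a)).1), (fun a => (sval (H a)).2).
transitivity (avg (hbB c V) (hbB (bop c) V) '1_V \o \sum_a (u a \o v a)).
  by rewrite uv compf1.
rewrite comp_sumr; apply: eq_bigr => a _.
by apply/eqP; apply: (svalP (H a)).
Qed.

Lemma avg_irr_neq i i' : i <> i' ->
  avg (hbB c (irr i \ot dirr i')) (hbB (bop c) (irr i \ot dirr i')) '1__ = 0.
Proof.
move=> ii'; have [n [x [y ->]]] := avg_through_unit (irr i \ot dirr i').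
rewrite big1 // => a _; have [g ->] := hom_one_dual (x a).
by rewrite (irr_hom_neq g) ?tensm0l ?comp0l //; apply/nesym.
Qed.

Lemma avg_irr i :
  avg (hbB c (irr i \ot dirr i)) (hbB (bop c) (irr i \ot dirr i)) '1__
  = (d i)^-1 *: (coev (irr i) \o revt (irr i)).
Proof.
have [n [x [y E]]] := avg_through_unit (irr i \ot dirr i).
have [z zE] : exists z, avg (hbB c (irr i \ot dirr i)) (hbB (bop c) (irr i \ot
  dirr i)) '1__
    = z *: (coev (irr i) \o revt (irr i)).
  rewrite E; elim/big_ind: _; first by exists 0; rewrite scale0r.
    by move=> _ _ [z1 ->] [z2 ->]; exists (z1 + z2); rewrite scalerDl.
  move=> a _; have [g ->] := hom_one_dual (x a); have [h ->] := hom_dual_one (y a).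
  have [z1 ->] := irr_schur g; have [z2 ->] := irr_schur h; exists (z1 * z2).
  rewrite !(lin_scale (tensm_linl _)) !tensm1 !compZl compZr comp1f compf1 compZr.
  by rewrite scalerA.
have re : revt (irr i) \o coev (irr i) = d i *: '1_(one C).
  by rewrite -qdimE /tr tensm1 comp1f.
(* The scalar is read off on [coev], which comes from the unit and so is fixed by the average;
   composing with [revt] gives [z * d i * d i = d i]. *)
have := avg_conj (coev (irr i)); rewrite avg_one compf1 zE compZl -compA re.
move=> /(congr1 (fun h => revt (irr i) \o h));
  rewrite compZr compA re !compZr !compZl.
rewrite compf1 !scalerA => /(congr1 (@scal k C)); rewrite !scal_id => /eqP.
rewrite -subr_eq0 -{3}(mul1r (d i)) -mulrBl mulf_eq0 (negbTE (qdim_neq0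
  C_modular i)) orbF.
rewrite subr_eq0 => /eqP zd; congr (_ *: _).
by rewrite -[z]mulr1 -(mulfV (qdim_neq0 C_modular i)) mulrA zd mul1r.
Qed.
End Killing.

(** * The projectors Gamma *)

Section GammaProjector.
Variables (k : closedFieldType) (C : premodular k).
Implicit Types (X Y : center C) (i : 'I_(rk C)).
Local Open Scope cat_scope.
Local Notation c := (pbr C).
Local Notation dirr i := (dual (irr (i : 'I_(rk C)))).
Local Notation d i := (qdim (irr (i : 'I_(rk C)))).
Variable bs : dual_bases C.
Hypothesis C_modular : modular C.

Definition ihb i X := hbT (hbB c (irr i)) (zhb X).
Definition ohb i X := hbB (bop c) (irr i \ot zob X).

Lemma Gamma_avg i X : Gamma i X = avg (ihb i X) (ohb i X) '1__.
Proof.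
rewrite /Gamma /avg /ring_sum; congr (_ *: _); apply: eq_bigr => j _;
  congr (_ *: _).
by rewrite /Gamma_loop /loop /= /hbT_mor tensm1 compf1 !tens1M -!compA.
Qed.

Lemma Gamma_cpt i X : cpt (ihb i X) (ohb i X) (Gamma i X).
Proof. by rewrite Gamma_avg; apply: avg_cpt. Qed.

Lemma Gamma_in i X A (a : half_braiding A) (f : hom A (irr i \ot zob X)) :
  cpt a (ihb i X) f -> Gamma i X \o f = avg a (ohb i X) f.
Proof. by move=> H; rewrite Gamma_avg (avg_compr _ _ H) comp1f. Qed.

Lemma Gamma_out i X A (f : hom (irr i \ot zob X) A) :
  f \o Gamma i X = avg (ihb i X) (hbB (bop c) A) f.
Proof. by rewrite Gamma_avg (avg_compl _ _ (cpt_br (bop c) f)) compf1. Qed.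

Lemma Gamma_fix_in i X A (f : hom A (irr i \ot zob X)) :
  cpt (hbB (bop c) A) (ihb i X) f -> Gamma i X \o f = f.
Proof.
move=> H; rewrite (Gamma_in H) avg_id //; first exact: dimOmega_neq0.
exact: cpt_br.
Qed.

Lemma Gamma_fix_out i X A (f : hom (irr i \ot zob X) A) :
  cpt (ihb i X) (hbB (bop c) A) f -> f \o Gamma i X = f.
Proof. by move=> H; rewrite Gamma_out avg_id //; exact: dimOmega_neq0. Qed.

Lemma Gamma_idem i X : Gamma i X \o Gamma i X = Gamma i X.
Proof. exact: Gamma_fix_out (@Gamma_cpt i X). Qed.

Lemma ihb_cpt i X Y (f : hom (zob X) (zob Y)) :
  cpt (zhb X) (zhb Y) f -> cpt (ihb i X) (ihb i Y) ('1_(irr i) \om f).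
Proof. by move=> H; apply: cpt_tens H; apply: cpt_id. Qed.

Lemma Gamma_nat i X Y (f : hom (zob X) (zob Y)) : cpt (zhb X) (zhb Y) f ->
  ('1_(irr i) \om f) \o Gamma i X = Gamma i Y \o ('1_(irr i) \om f).
Proof. by move=> H; rewrite (Gamma_in (ihb_cpt _ H)) Gamma_out. Qed.

Variable I : images C.

(** An idempotent splits through its image: the outer [imiota] and [impi] can be cancelled. *)
Lemma impi_iota i X : impi I i X \o imiota I i X = '1_(im I i X).
Proof.
apply: (@impi_epi _ _ I i X); apply: (@imiota_mono _ _ I i X).
by rewrite comp1f -!compA -(imE I) compA -(imE I) Gamma_idem.
Qed.

Lemma impi_Gamma i X : impi I i X \o Gamma i X = impi I i X.
Proof. by rewrite (imE I) compA impi_iota comp1f. Qed.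
Lemma Gamma_imiota i X : Gamma i X \o imiota I i X = imiota I i X.
Proof. by rewrite (imE I) -compA impi_iota compf1. Qed.

Lemma G_diag X Y (phi : chom X Y) i :
  impi I i Y \o (Gamma i Y \o (('1_(irr i) \om zmor phi) \o (Gamma i X \o imiota
    I i X)))
  = impi I i Y \o (('1_(irr i) \om zmor phi) \o imiota I i X).
Proof. by rewrite Gamma_imiota compA impi_Gamma. Qed.

Lemma functor_G_is_functor : is_functor (functor_G I).
Proof.
split=> [X | X Y Z g f]; apply: functional_extensionality_dep => i;
  apply: functional_extensionality_dep => j; rewrite /= /G_mor /did /dcomp /=.
  case: (i =P j) => [<- | ij]; last by rewrite !on_diag_neq.
  by rewrite !on_diag_eq (G_diag (cid X)) /= tensm1 comp1f impi_iota.
rewrite (bigD1 i) //= big1 ?addr0 => [|b /eqP bi]; last first.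
  by rewrite (on_diag_neq _ _ (nesym bi)) (lin0 (@tcomp_linr _ _ _ _ _ _ _ _ _ _)).
rewrite on_diag_eq; case: (i =P j) => [<- | ij]; last first.
  by rewrite !on_diag_neq // (lin0 (@tcomp_linl _ _ _ _ _ _ _ _ _ _)).
rewrite !on_diag_eq tcomp_pure comp1f !G_diag (G_diag (ccomp g f));
  congr (tpure _ _).
(* The middle [imiota \o impi] is [Gamma], which moves past the central [f] and is absorbed by
   [imiota]. *)
rewrite -!compA (compA (imiota I i Y)) -(imE I) (compA (Gamma i Y)).
rewrite -(Gamma_nat _ (zmorP f)) -(compA _ (Gamma i X)) Gamma_imiota.
by rewrite /= tens1M -!compA.
Qed.

End GammaProjector.

(** * The transformations d and q *)

Section DQ.
Variables (k : closedFieldType) (C : premodular k).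
Implicit Types (P Q : deligne C C) (i : 'I_(rk C)).
Local Open Scope cat_scope.
Local Notation c := (pbr C).
Local Notation dirr i := (dual (irr (i : 'I_(rk C)))).
Local Notation d i := (qdim (irr (i : 'I_(rk C)))).
Local Notation FF P := (functor_F C P).
Local Notation inj P a := (dinj (bip C) (fun a => dfst P a \ot dsnd P a) a).
Local Notation prj P a := (dproj (bip C) (fun a => dfst P a \ot dsnd P a) a).
Variable bs : dual_bases C.
Hypothesis C_modular : modular C.

(** [tau] and [sigma] are the second legs of [d] and [q] before [impi] and [imiota] are applied. *)
Definition tau P a i (h : hom (dirr i) (dfst P a)) : hom (dsnd P a) (irr i \ot
  zob (FF P)) :=
  ('1_(irr i) \om inj P a) \o (asc (irr i) (dfst P a) (dsnd P a) \o
    (((('1_(irr i) \om h) \o coev (irr i)) \om '1_(dsnd P a)) \o luni (dsnd P a))).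

Definition sigma P a i (h : hom (dfst P a) (dirr i)) : hom (irr i \ot zob (FF
  P)) (dsnd P a) :=
  lun (dsnd P a) \o (((evt (irr i) \o ('1_(irr i) \om h)) \om '1_(dsnd P a))
   \o (asci (irr i) (dfst P a) (dsnd P a) \o ('1_(irr i) \om prj P a))).

Lemma cpt_hbB_tens (X Y : C) : cpt (hbB c (X \ot Y)) (hbT (hbB c X) (hbB c Y))
  '1_(X \ot Y).
Proof.
move=> Z; rewrite !tensm1 comp1f compf1.
apply: (@T_inj k C (tensW (atom Z) (tensW (atom X) (atom Y)))
  (tensW (tensW (atom X) (atom Y)) (atom Z))).
by rewrite (br_hexr_tail c) /= /hbT_mor !TE /=.
Qed.

Lemma cpt_bop_tens (X Y : C) :
  cpt (hbT (hbB (bop c) X) (hbB (bop c) Y)) (hbB (bop c) (X \ot Y)) '1_(X \ot Y).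
Proof.
move=> Z; rewrite !tensm1 comp1f compf1.
apply: (@T_inj k C (tensW (atom Z) (tensW (atom X) (atom Y)))
  (tensW (tensW (atom X) (atom Y)) (atom Z))).
by rewrite /= (bri_hexl_tail c) /= /hbT_mor !TE /=.
Qed.

Definition Pin_def P a i :=
  ('1_(irr i) \om inj P a) \o asc (irr i) (dfst P a) (dsnd P a).
Definition Qout_def P a i :=
  asci (irr i) (dfst P a) (dsnd P a) \o ('1_(irr i) \om prj P a).
Definition Pin P := locked_with rdual_key (@Pin_def P).
Definition Qout P := locked_with rdual_key (@Qout_def P).
Lemma PinE P a i : Pin a i = @Pin_def P a i. Proof. by rewrite /Pin unlock. Qed.
Lemma QoutE P a i : Qout a i = @Qout_def P a i. Proof. by rewrite /Qout unlock. Qed.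

(** By the hexagon [irr i] and [dfst P a] merge into one object with the braiding [c], next to
    [dsnd P a] with the inverse braiding. In this form [Gamma] becomes an average between the two
    braidings of the first factor alone. *)
Lemma Pin_cpt P a i :
  cpt (hbT (hbB c (irr i \ot dfst P a)) (hbB (bop c) (dsnd P a))) (ihb i (FF P))
    (Pin a i).
Proof.
rewrite PinE; apply: (cpt_comp (b := hbT (hbB c (irr i)) (F1_hb (dfst P a) (dsnd
  P a)))).
  apply: cpt_tens; first exact: cpt_id.
  by move=> Z; exact: hbS_injr.
rewrite -[asc _ _ _]compf1 -tensm1; apply: cpt_comp; first exact: cpt_asc.
by apply: cpt_tens; [exact: cpt_hbB_tens | exact: cpt_id].
Qed.

Lemma Qout_cpt P a i :
  cpt (ihb i (FF P)) (hbT (hbB c (irr i \ot dfst P a)) (hbB (bop c) (dsnd P a)))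
    (Qout a i).
Proof.
rewrite QoutE; apply: (cpt_comp (b := hbT (hbB c (irr i)) (F1_hb (dfst P a)
  (dsnd P a)))).
  apply: (cpt_inv (f := asc (irr i) (dfst P a) (dsnd P a)));
    rewrite ?ascK ?asciK //.
  rewrite -[asc _ _ _]compf1 -tensm1; apply: cpt_comp; first exact: cpt_asc.
  by apply: cpt_tens; [exact: cpt_hbB_tens | exact: cpt_id].
apply: cpt_tens; first exact: cpt_id.
by move=> Z; rewrite /= hbS_projl.
Qed.

Lemma tauE P a i h : @tau P a i h = Pin a i \o
  (((('1_(irr i) \om h) \o coev (irr i)) \om '1_(dsnd P a)) \o luni (dsnd P a)).
Proof. by rewrite /tau PinE /Pin_def -!compA. Qed.

Lemma sigmaE P a i h : @sigma P a i h = lun (dsnd P a) \o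
  (((revt (irr i) \o ('1_(irr i) \om h)) \om '1_(dsnd P a)) \o Qout a i).
Proof. by rewrite /sigma revtE QoutE. Qed.

Lemma tau_cpt P a i h : cpt (hbB (bop c) (dsnd P a)) (ihb i (FF P)) (@tau P a i h).
Proof.
rewrite tauE; apply: cpt_comp (Pin_cpt a i) _.
apply: (cpt_comp (b := hbT (hbB c (one C)) (hbB (bop c) (dsnd P a))));
  last exact: cpt_luni.
by apply: cpt_tens; [exact: cpt_br | exact: cpt_id].
Qed.

Lemma sigma_cpt P a i h : cpt (ihb i (FF P)) (hbB (bop c) (dsnd P a)) (@sigma P
  a i h).
Proof.
rewrite sigmaE compA; apply: cpt_comp (Qout_cpt a i).
apply: (cpt_comp (b := hbT (hbB c (one C)) (hbB (bop c) (dsnd P a)))).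
  by apply: (cpt_inv (f := luni (dsnd P a))); rewrite ?lunK ?luniK //;
    exact: cpt_luni.
by apply: cpt_tens; [exact: cpt_br | exact: cpt_id].
Qed.

Lemma QPin P a i : Qout a i \o @Pin P a i = '1__.
Proof.
rewrite QoutE PinE /Qout_def /Pin_def -!compA (compA ('1__ \om _)) -tens1M
  dproj_inj tensm1 comp1f.
by rewrite ascK.
Qed.

Lemma QPin_neq P a b i : a <> b -> Qout b i \o @Pin P a i = 0.
Proof.
move=> ab; rewrite QoutE PinE /Qout_def /Pin_def -!compA (compA ('1__ \om _))
  -tens1M dproj_inj0 //.
by rewrite tensm0r comp0l comp0r.
Qed.

Lemma sigma_tau P a i h' h r : h' \o h = r *: '1_(dirr i) ->
  sigma h' \o @tau P a i h = (r * d i) *: '1_(dsnd P a).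
Proof.
move=> hr; rewrite sigmaE tauE -!compA (compA (Qout _ _)) QPin comp1f.
rewrite (compA (_ \om '1__)) -tensM1 -compA (compA ('1__ \om h')) -tens1M hr.
rewrite (lin_scale (tensm_linr _)) tensm1 compZl comp1f compZr.
have -> : revt (irr i) \o coev (irr i) = d i *: '1_(one C).
  by rewrite -qdimE /tr tensm1 comp1f.
rewrite scalerA (lin_scale (tensm_linl _)) tensm1 compZl comp1f compZr.
by rewrite luniK.
Qed.

Lemma sigma_tau_neq P a b i h' h : a <> b -> @sigma P b i h' \o @tau P a i h = 0.
Proof.
move=> ab; rewrite sigmaE tauE -!compA (compA (Qout _ _)) QPin_neq //.
by rewrite comp0l !comp0r.
Qed.

Lemma id_PQ P i : \sum_a (@Pin P a i \o Qout a i) = '1_(irr i \ot zob (FF P)).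
Proof.
rewrite -[RHS]tensm1 -dsum_id tensm_sumr; apply: eq_bigr => a _.
by rewrite PinE QoutE /Qout_def /Pin_def -!compA (compE2 (asciK _ _ _)) comp1f
  -tens1M.
Qed.

(** The factor [dsnd P a] carries the inverse braiding at both ends, so [avg_tens] confines the
    average to [irr i \ot V]. Factoring through V lets V be the dual of an irreducible. *)
Lemma Gamma_Pin P a i (V : C) (u : hom V (dfst P a)) (v : hom (dfst P a) V) :
  Gamma i (FF P) \o (Pin a i \o ((('1_(irr i) \om (u \o v)) \om '1__) \o Qout a i))
  = Pin a i \o (((('1_(irr i) \om u) \o (avg (hbB c (irr i \ot V)) (hbB (bop c)
    (irr i \ot V)) '1__
     \o ('1_(irr i) \om v))) \om '1__) \o Qout a i).
Proof.
have E : avg (hbT (hbB c (irr i \ot V)) (hbB (bop c) (dsnd P a))) (hbB (bop c)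
  ((irr i \ot V) \ot dsnd P a)) '1__
   = avg (hbB c (irr i \ot V)) (hbB (bop c) (irr i \ot V)) '1__ \om '1_(dsnd P a).
  rewrite -(avg_tens _ _ (hbB (bop c) (dsnd P a))) tensm1 -[RHS]comp1f.
  by rewrite (avg_compl _ _ (@cpt_bop_tens (irr i \ot V) (dsnd P a))) comp1f.
have U : cpt (hbT (hbB c (irr i \ot V)) (hbB (bop c) (dsnd P a))) (ihb i (FF P))
   (Pin a i \o (('1_(irr i) \om u) \om '1__)).
  by apply: cpt_comp (Pin_cpt a i) _; apply: cpt_tens;
    [exact: cpt_br | exact: cpt_id].
rewrite tens1M tensM1 -compA compA (compA (Pin a i)) (compA (Gamma _ _)).
rewrite (Gamma_in U) -{1}(compf1 (Pin a i \o _)).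
rewrite -(avg_compl _ _ (cpt_br (bop c) _)) E -!compA; congr (_ \o _).
by rewrite !compA -!tensM1 -!compA.
Qed.

(** The identity of each [dfst P a] is expanded in dual bases; [avg_irr_neq] kills the labels other
    than i, and [avg_irr] opens the remaining terms into a cup after a cap, that is [tau] after
    [sigma]. *)
Lemma Gamma_F P i : Gamma i (FF P) = \sum_a \sum_(l < dbn bs (dfst P a) i)
  (d i)^-1 *: (tau (tnth (upper bs (dfst P a) i) l) \o sigma (tnth (lower bs
    (dfst P a) i) l)).
Proof.
rewrite -[LHS]compf1 -id_PQ comp_sumr; apply: eq_bigr => a _.
transitivity (\sum_i' \sum_(l < dbn bs (dfst P a) i')
  (Gamma i (FF P) \o (Pin a i \o ((('1_(irr i) \om (tnth (upper bs (dfst P a) i') l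
    \o tnth (lower bs (dfst P a) i') l)) \om '1__) \o Qout a i)))).
  rewrite -[Qout a i in LHS]comp1f -!tensm1 -(dual_bases_sum bs C_modular (dfst
    P a)).
  rewrite tensm_sumr tensm_suml comp_suml !comp_sumr; apply: eq_bigr => i' _.
  rewrite tensm_sumr tensm_suml comp_suml !comp_sumr; apply: eq_bigr => l _.
  by [].
rewrite (bigD1 i) //= [X in _ + X]big1 ?addr0 => [|i' /eqP ii']; last first.
  rewrite big1 // => l _; rewrite Gamma_Pin avg_irr_neq //; last exact/nesym.
  by rewrite comp0l comp0r tensm0l comp0l comp0r.
apply: eq_bigr => l _; rewrite Gamma_Pin avg_irr // tauE sigmaE.
rewrite -!compA (compE2 (lunK _)) comp1f (compA (_ \om '1__) (_ \om '1__)) -tensM1.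
rewrite compZl compZr (lin_scale (tensm_linl _)) compZl compZr.
by rewrite -!compA.
Qed.

End DQ.

Lemma natural_inverse (A B : category) (F G : prefunctor A B) (s : transf F G)
    (t : transf G F) : natural s -> mutually_inverse s t -> natural t.
Proof.
move=> N [ts st] X Y f.
rewrite -[LHS]ccompf1 -(st X) ccompA -(ccompA (t Y)) -N ccompA ts.
by rewrite ccomp1f.
Qed.

(** * Invertibility and naturality of [d] and [q] *)

Section DQIso.
Variables (k : closedFieldType) (C : premodular k).
Implicit Types (P Q : deligne C C) (i : 'I_(rk C)).
Local Open Scope cat_scope.
Local Notation c := (pbr C).
Local Notation dirr i := (dual (irr (i : 'I_(rk C)))).
Local Notation d i := (qdim (irr (i : 'I_(rk C)))).
Local Notation FF P := (functor_F C P).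
Local Notation inj P a := (dinj (bip C) (fun a => dfst P a \ot dsnd P a) a).
Local Notation prj P a := (dproj (bip C) (fun a => dfst P a \ot dsnd P a) a).
Variables (bs : dual_bases C) (I : images C) (sq : 'I_(rk C) -> k).
Hypothesis C_modular : modular C.
Hypothesis sq_dim : forall i, sq i ^+ 2 = d i.

Lemma sq_neq0 i : sq i != 0.
Proof.
by apply: contraNneq (qdim_neq0 C_modular i) => si; rewrite -sq_dim si expr0n.
Qed.

Lemma trans_dE P a i : trans_d I bs sq P a i = (sq i)^-1 *:
  \sum_(l < dbn bs (dfst P a) i) tpure (tnth (lower bs (dfst P a) i) l)
     (impi I i (FF P) \o tau (tnth (upper bs (dfst P a) i) l)).
Proof. by []. Qed.

Lemma trans_qE P i a : trans_q I bs sq P i a = (sq i)^-1 *: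
  \sum_(l < dbn bs (dfst P a) i) tpure (tnth (upper bs (dfst P a) i) l)
     (sigma (tnth (lower bs (dfst P a) i) l) \o imiota I i (FF P)).
Proof.
congr (_ *: _); apply: eq_bigr => l _; congr (tpure _ _).
by rewrite /sigma -!compA.
Qed.

Lemma tpure0l (U V : vectType k) (v : V) : tpure (0 : U) v = 0.
Proof. exact: (lin0 ((tpure_bilin U V).1 v)). Qed.
Lemma tpure0r (U V : vectType k) (u : U) : tpure u (0 : V) = 0.
Proof. exact: (lin0 ((tpure_bilin U V).2 u)). Qed.
Lemma tpureZl (U V : vectType k) a (u : U) (v : V) : tpure (a *: u) v = a *:
  tpure u v.
Proof. exact: (lin_scale ((tpure_bilin U V).1 v)). Qed.
Lemma tpureZr (U V : vectType k) a (u : U) (v : V) : tpure u (a *: v) = a *: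
  tpure u v.
Proof. exact: (lin_scale ((tpure_bilin U V).2 u)). Qed.
Lemma tpure_suml (U V : vectType k) J r (p : pred J) (F : J -> U) (v : V) :
  tpure (\sum_(j <- r | p j) F j) v = \sum_(j <- r | p j) tpure (F j) v.
Proof. exact: (lin_sum ((tpure_bilin U V).1 v)). Qed.
Lemma tpure_sumr (U V : vectType k) J r (p : pred J) (u : U) (F : J -> V) :
  tpure u (\sum_(j <- r | p j) F j) = \sum_(j <- r | p j) tpure u (F j).
Proof. exact: (lin_sum ((tpure_bilin U V).2 u)). Qed.

Section TcompLinear.
Variables (X X' X'' Y Y' Y'' : C).
Implicit Types (s : tprod (hom X' X'') (hom Y' Y'')) (t : tprod (hom X X') (hom
  Y Y')).
Lemma tcompZl a s t : tcomp (a *: s) t = a *: tcomp s t.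
Proof. exact: (lin_scale (tcomp_linl t)). Qed.
Lemma tcompZr a s t : tcomp s (a *: t) = a *: tcomp s t.
Proof. exact: (lin_scale (tcomp_linr s)). Qed.
Lemma tcomp_suml t J r (p : pred J) (F : J -> tprod (hom X' X'') (hom Y' Y'')) :
  tcomp (\sum_(j <- r | p j) F j) t = \sum_(j <- r | p j) tcomp (F j) t.
Proof. exact: (lin_sum (tcomp_linl t)). Qed.
Lemma tcomp_sumr s J r (p : pred J) (F : J -> tprod (hom X X') (hom Y Y')) :
  tcomp s (\sum_(j <- r | p j) F j) = \sum_(j <- r | p j) tcomp s (F j).
Proof. exact: (lin_sum (tcomp_linr s)). Qed.
Lemma tcomp0r s : tcomp s (0 : tprod (hom X X') (hom Y Y')) = 0.
Proof. exact: (lin0 (tcomp_linr s)). Qed.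
Lemma tcomp0l t : tcomp (0 : tprod (hom X' X'') (hom Y' Y'')) t = 0.
Proof. exact: (lin0 (tcomp_linl t)). Qed.
End TcompLinear.

Lemma trans_qd P : ccomp (trans_q I bs sq P) (trans_d I bs sq P) = cid P.
Proof.
apply: functional_extensionality_dep => a; apply: functional_extensionality_dep
  => b.
rewrite /= /dcomp /did.
have E i : tcomp (trans_q I bs sq P i b) (trans_d I bs sq P a i) =
   (d i)^-1 *: \sum_m \sum_l tpure (tnth (upper bs (dfst P b) i) m \o tnth
     (lower bs (dfst P a) i) l)
      (sigma (tnth (lower bs (dfst P b) i) m) \o tau (tnth (upper bs (dfst P a)
        i) l)).
  rewrite trans_qE trans_dE tcompZl tcompZr scalerA -expr2 exprVn sq_dim.
  congr (_ *: _); rewrite tcomp_suml; apply: eq_bigr => m _.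
  rewrite tcomp_sumr; apply: eq_bigr => l _; rewrite tcomp_pure; congr (tpure _ _).
  (* [imiota \o impi] is [Gamma], which fixes the central [tau]; what remains is a closed loop along
     [irr i]. *)
  rewrite -compA (compA (imiota I i _)) -(imE I).
  by rewrite (Gamma_fix_in bs C_modular (@tau_cpt _ _ _ _ _ _)).
under eq_bigr do rewrite E.
case: (a =P b) E => [<- | ab] E; last first.
  rewrite on_diag_neq // big1 // => i _; rewrite big1 ?scaler0 // => m _.
  by rewrite big1 // => l _; rewrite sigma_tau_neq // tpure0r.
rewrite on_diag_eq -(dual_bases_sum bs C_modular (dfst P a)) tpure_suml.
apply: eq_bigr => i _; rewrite tpure_suml scaler_sumr; apply: eq_bigr => m _.
rewrite (bigD1 m) //= big1 ?addr0 => [|l lm]; last first.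
  rewrite (sigma_tau (r := 0)) ?mul0r ?scale0r ?tpure0r //.
  by rewrite lower_upper_id // eq_sym (negbTE lm) scale0r.
rewrite (sigma_tau (r := 1)); last by rewrite lower_upper_id // eqxx.
by rewrite mul1r tpureZr scalerA mulVf ?scale1r // qdim_neq0.
Qed.

Lemma trans_dq P : ccomp (trans_d I bs sq P) (trans_q I bs sq P) = cid
  (functor_G I (FF P)).
Proof.
apply: functional_extensionality_dep => i; apply: functional_extensionality_dep
  => j.
rewrite /= /dcomp /did.
have E a : tcomp (trans_d I bs sq P a j) (trans_q I bs sq P i a) =
   ((sq j)^-1 * (sq i)^-1) *: \sum_l \sum_m tpure (tnth (lower bs (dfst P a) j)
     l \o tnth (upper bs (dfst P a) i) m)
      ((impi I j (FF P) \o tau (tnth (upper bs (dfst P a) j) l)) \o (sigma (tnth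
        (lower bs (dfst P a) i) m) \o imiota I i (FF P))).
  rewrite trans_qE trans_dE tcompZl tcompZr scalerA.
  congr (_ *: _); rewrite tcomp_suml; apply: eq_bigr => m _.
  by rewrite tcomp_sumr; apply: eq_bigr => l _; rewrite tcomp_pure.
under eq_bigr do rewrite E.
case: (i =P j) E => [<- | ij] E; last first.
  rewrite on_diag_neq // big1 // => a _; rewrite big1 ?scaler0 // => l _.
  by rewrite big1 // => m _; rewrite (dirr_hom_neq (_ \o _)) // tpure0l.
(* The identity of the image is written as [impi \o Gamma \o imiota], so that [Gamma_F] expands
   it. *)
rewrite on_diag_eq -(impi_iota bs C_modular I).
rewrite -[X in _ = tpure _ (_ \o X)](Gamma_imiota bs C_modular I).
rewrite (Gamma_F bs C_modular) comp_suml comp_sumr tpure_sumr; apply: eq_bigr =>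
  a _.
rewrite -expr2 exprVn sq_dim comp_suml comp_sumr tpure_sumr scaler_sumr.
apply: eq_bigr => l _; rewrite (bigD1 l) //= big1 ?addr0 => [|m ml]; last first.
  by rewrite lower_upper_id // eq_sym (negbTE ml) scale0r tpure0l.
rewrite lower_upper_id // eqxx scale1r compZl compZr tpureZr;
  congr (_ *: tpure _ _).
by rewrite -!compA.
Qed.

Definition tau0 (X Y : C) i (h : hom (dirr i) X) : hom Y (irr i \ot (X \ot Y)) :=
  asc (irr i) X Y \o (((('1_(irr i) \om h) \o coev (irr i)) \om '1_Y) \o luni Y).

Lemma tau_tau0 P a i h : @tau k C P a i h = ('1_(irr i) \om inj P a) \o tau0
  (dsnd P a) h.
Proof. by []. Qed.

Lemma tau0_linear (X Y : C) i : linear (@tau0 X Y i).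
Proof.
move=> x f g; rewrite /tau0 tensm_linr comp_linl tensm_linl comp_linl.
by rewrite comp_linr.
Qed.

Lemma luni_nat (X Y : C) (g : hom X Y) : luni Y \o g = ('1_(one C) \om g) \o luni X.
Proof. by rewrite -[RHS]comp1f -lunK -!compA (compA (lun Y)) lun_nat -!compA
  luniK compf1. Qed.

Lemma tau0_nat (X X' Y Y' : C) i (f : hom X X') (g : hom Y Y') (h : hom (dirr i)
  X) :
  ('1_(irr i) \om (f \om g)) \o tau0 Y h = tau0 Y' (f \o h) \o g.
Proof.
rewrite /tau0 -!compA luni_nat (compA (_ \om '1_Y')) -tensmM compf1 comp1f.
rewrite (compA _ (asc _ _ _)) -asc_nat -!compA; congr (_ \o _).
by rewrite compA -tensmM compf1 tens1M !compA.
Qed.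

(** Naturality of the canonical element: precomposition with [f] on the lower bases and
    postcomposition on the upper ones have the same matrix, both being read off from a lower element
    after [f] after an upper one. *)
Lemma dual_bases_exchange (X X' : C) (V : vectType k) i (f : hom X X')
    (F : hom (dirr i) X' -> V) : linear F ->
  \sum_m tpure (tnth (lower bs X' i) m \o f) (F (tnth (upper bs X' i) m))
  = \sum_l tpure (tnth (lower bs X i) l) (F (f \o tnth (upper bs X i) l)).
Proof.
move=> lF.
pose x m l := coord (lower bs X i) l (tnth (lower bs X' i) m \o f).
pose y m l := coord (upper bs X' i) m (f \o tnth (upper bs X i) l).
have xy m l : x m l = y m l.
  have E1 : tnth (lower bs X' i) m \o f \o tnth (upper bs X i) l = x m l *: '1__.
    rewrite (lower_span bs (_ \o f)) comp_suml (bigD1 l) //= big1 ?addr0 =>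
      [|l' nl].
      by rewrite compZl lower_upper_id // eqxx scale1r.
    by rewrite compZl lower_upper_id // (negbTE nl) scale0r scaler0.
  have E2 : tnth (lower bs X' i) m \o (f \o tnth (upper bs X i) l) = y m l *: '1__.
    rewrite (upper_span bs (f \o _)) comp_sumr (bigD1 m) //= big1 ?addr0 =>
      [|l' nl].
      by rewrite compZr lower_upper_id // eqxx scale1r.
    by rewrite compZr lower_upper_id // eq_sym (negbTE nl) scale0r scaler0.
  rewrite compA E1 in E2; have := congr1 (fun h => scal (tr h)) E2.
  rewrite !(lin_scale (@tr_linear _ _ _)) tr_dualobj qdimE !scalerA !scal_id.
  by apply/mulIf/qdim_neq0.
transitivity (\sum_m \sum_l x m l *: tpure (tnth (lower bs X i) l) (F (tnth
  (upper bs X' i) m))).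
  apply: eq_bigr => m _; rewrite {1}(lower_span bs (_ \o f)) tpure_suml.
  by apply: eq_bigr => l _; rewrite tpureZl.
rewrite exchange_big /=; apply: eq_bigr => l _.
rewrite [in RHS](upper_span bs (f \o _)) (lin_sum lF) tpure_sumr.
by apply: eq_bigr => m _; rewrite (lin_scale lF) tpureZr xy.
Qed.

Lemma trans_d_block P Q a b i (t : tprod (hom (dfst P a) (dfst Q b)) (hom (dsnd
  P a) (dsnd Q b))) :
  \sum_m tcomp (tpure (tnth (lower bs (dfst Q b) i) m)
     (impi I i (FF Q) \o tau (tnth (upper bs (dfst Q b) i) m))) t
  = \sum_l tpure (tnth (lower bs (dfst P a) i) l) (impi I i (FF Q) \o
     (('1_(irr i) \om (inj Q b \o F1_mor t)) \o tau0 (dsnd P a) (tnth (upper bs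
       (dfst P a) i) l))).
Proof.
move: t; apply: tens_ext.
- move=> x s t; rewrite scaler_sumr -big_split /=; apply: eq_bigr => m _.
  exact: tcomp_linr.
- move=> x s t; rewrite scaler_sumr -big_split /=; apply: eq_bigr => l _.
  have -> : F1_mor (x *: s + t) = x *: F1_mor s + F1_mor t by apply: tlift_linear.
  by rewrite comp_linr tensm_linr comp_linl comp_linr (tpure_bilin _ _).2.
move=> f g; under eq_bigr do rewrite tcomp_pure.
rewrite /F1_mor tlift_pure; last exact: tensm_bilin.
rewrite (dual_bases_exchange f (F := fun h => (impi I i (FF Q) \o tau h) \o g)).
  apply: eq_bigr => l _; congr (tpure _ _); rewrite -compA; congr (_ \o _).
  by rewrite tau_tau0 tens1M -!compA tau0_nat /tau0 -!compA.
move=> x h h'; rewrite !tau_tau0 tau0_linear.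
by rewrite !comp_linr comp_linl.
Qed.

Lemma trans_d_natural : natural (trans_d I bs sq).
Proof.
move=> P Q f; apply: functional_extensionality_dep => a.
apply: functional_extensionality_dep => i; rewrite /= /dcomp.
rewrite [RHS](bigD1 i) //= [X in _ = _ + X]big1 ?addr0; last first.
  by move=> j /eqP ji; rewrite /G_mor on_diag_neq // tcomp0l.
rewrite /G_mor on_diag_eq (G_diag bs C_modular I (fmor (functor_F C) f)).
rewrite trans_dE tcompZr tcomp_sumr.
have E b : tcomp (trans_d I bs sq Q b i) (f a b) = (sq i)^-1 *:
    \sum_l tpure (tnth (lower bs (dfst P a) i) l) (impi I i (FF Q) \o
     (('1_(irr i) \om (inj Q b \o F1_mor (f a b))) \o tau0 (dsnd P a) (tnth
       (upper bs (dfst P a) i) l))).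
  rewrite trans_dE tcompZl tcomp_suml; congr (_ *: _).
  exact: trans_d_block.
under eq_bigr do rewrite E; rewrite -scaler_sumr; congr (_ *: _).
rewrite exchange_big /=; apply: eq_bigr => l _;
  rewrite tcomp_pure comp1f -tpure_sumr.
congr (tpure _ _); rewrite -(compA (impi I i _)) -(compA ('1__ \om _)).
rewrite (compA (imiota I i _)) -(imE I i (FF P)).
rewrite (Gamma_fix_in bs C_modular (@tau_cpt _ _ _ _ _ _)) -comp_sumr;
  congr (_ \o _).
rewrite tau_tau0 (compA ('1__ \om F_mor0 f)) -tens1M -comp_suml -tensm_sumr.
congr ((_ \om _) \o _); rewrite /F_mor0 comp_suml (bigD1 a) //= [X in _ = _ +
  X]big1 ?addr0.
  rewrite comp_suml; apply: eq_bigr => b _.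
  by rewrite -!compA dproj_inj compf1.
move=> a' /eqP aa'; rewrite comp_suml big1 // => b _.
by rewrite -!compA dproj_inj0 ?comp0r //; apply/nesym.
Qed.

Lemma trans_q_natural : natural (trans_q I bs sq).
Proof.
by apply: natural_inverse trans_d_natural _; split=> P;
  [exact: trans_qd | exact: trans_dq].
Qed.

Lemma trans_dq_isos : inverse_nat_isos (trans_d I bs sq) (trans_q I bs sq).
Proof.
split; [exact: trans_d_natural | exact: trans_q_natural |].
by split=> P; [exact: trans_qd | exact: trans_dq].
Qed.
End DQIso.

(** * The transformations b and p *)

Section LeftTrace.
Variables (k : closedFieldType) (C : premodular k).
Implicit Types (X Y V W J : C) (E : word C).
Local Open Scope cat_scope.
Local Notation c := (pbr C).
Local Notation d i := (qdim (irr (i : 'I_(rk C)))).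

(** The unit is its own dual, with unitors as cup and cap, and [tr_dual] may be used with this
    dual. *)
Lemma qdim_one : qdim (one C) = 1.
Proof.
have zig : run (one C) \o (('1_(one C) \om lun (one C)) \o (asc (one C) (one C)
  (one C)
    \o ((luni (one C) \om '1_(one C)) \o luni (one C)))) = '1_(one C).
  by apply: (@T_inj k C (oneW C) (oneW C)); rewrite !TE /= ?TE.
have := qdimE (one C); rewrite (tr_dual _ zig) twist_one compf1 tensm1 comp1f.
rewrite br_unit -!compA (compE2 (luniK _)) comp1f -lun_run1 luniK => E.
by rewrite -(scal_id C (qdim (one C))) -E -[RHS](scal_id C) scale1r.
Qed.

Lemma revt_twist X W : revt X \@ W \o (br c (dual X) X \@ W \o ('1_(dual X) \om
  twist X \@ W))
  = ev X \@ W.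
Proof.
rewrite revt_tail -!compA (compA (twist X \@ _)) -(br_natr_tail c (dual X)
  (twist X)) /= -!compA.
rewrite -[RHS](ev_twist2 X W).
rewrite (compA (br c (dual X) X \@ W) ('1__ \om _)) br_natr_tail /= -!compA.
rewrite (compA (br c X (dual X) \@ W) (twist X \@ _)) br_natl_tail /= -!compA.
rewrite (compA (ev X \@ W)) ev_twist -!compA.
rewrite (compA (twist (dual X) \@ _) (br _ _ _ \@ _)) -(br_natr_tail c X (twist
  (dual X))) /= -!compA.
by rewrite (compA ('1_X \om _) (br _ _ _ \@ _)) -(br_natl_tail c X (twist (dual
  X))) /= -!compA.
Qed.

(** The loop on the left of J swings over to its right. A twist arises at the cup and is absorbed at
    the cap; on [irr i] it is a scalar, so it can pass [h]. *)
Lemma ltr_ptr (i : 'I_(rk C)) J (h : hom (irr i \ot J) (irr i \ot J)) W :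
  ev (irr i) \@ (J \ot W) \o (('1__ \om h \@ W) \o rcoev (irr i) \@ (J \ot W))
  = ptr (br c (irr i) J \o (h \o bri c (irr i) J)) \@ W.
Proof.
set X := irr i.
have A1 : bri c X J \@ (dual X \ot W) \o ('1_J \om coev X \@ W)
   = ('1_X \om br c (dual X) J \@ W) \o coev X \@ (J \ot W).
  have := br_natl_tail c J (coev X) W; rewrite br_one_left_tail compf1
    (br_hexl_tail c _ _ (atom J)) /= => <-.
  by rewrite -!compA (compE2 (brK_tail _ _ _ _)) comp1f.
have A2 : ('1_J \om revt X \@ W) \o br c X J \@ (dual X \ot W)
   = revt X \@ (J \ot W) \o ('1_X \om bri c (dual X) J \@ W).
  have := br_natl_tail c J (revt X) W; rewrite br_one_left_tail comp1f
    (br_hexl_tail c _ _ (atom J)) /= => ->.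
  by rewrite -!compA briK_tail_whisker compf1.
have A3 : ('1_X \om bri c (dual X) J \@ W) \o (h \@ (dual X \ot W) \o ('1_X \om
  br c (dual X) J \@ W))
   = br c (dual X) X \@ (J \ot W) \o (('1_(dual X) \om h \@ W) \o bri c (dual X)
     X \@ (J \ot W)).
  have := br_natr_tail c (dual X) h W; rewrite (br_hexr_tail c (atom (dual X)))
    /= => N.
  have {}N := congr1 (fun u => ('1_X \om bri c (dual X) J \@ W) \o (u \o bri c
    (dual X) X \@ (J \ot W))) N.
  rewrite -!compA briK_tail compf1 (compE2 (brK_tail_whisker _ _ _ _ _)) comp1f
    in N.
  by rewrite N.
rewrite ptr_tail !T_comp -!compA A1 (compA ('1_J \om _)) A2 -!compA.
rewrite (compA (h \@ _)) (compA ('1_X \om bri _ _ _ \@ _)) A3 -!compA -twist_coevt.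
have [t tE] : exists t, twist X = t *: '1_X by exact: irr_schur.
have := revt_twist X (J \ot W).
rewrite tE T_scale T_id (lin_scale (tensm_linr _)) tensm1 compZl comp1f !compZr
  compf1 => <-.
by rewrite compZl -!compA.
Qed.
End LeftTrace.

(** * Centrality of [b] and the two inverse laws for [b] and [p] *)

Section BP.
Variables (k : closedFieldType) (C : premodular k).
Implicit Types (X Y : center C) (i j : 'I_(rk C)) (W : C) (E F : word C).
Local Open Scope cat_scope.
Local Notation c := (pbr C).
Local Notation dirr i := (dual (irr (i : 'I_(rk C)))).
Local Notation d i := (qdim (irr (i : 'I_(rk C)))).
Variables (bs : dual_bases C) (I : images C) (sq : 'I_(rk C) -> k).
Hypothesis C_modular : modular C.
Hypothesis sq_dim : forall i, sq i ^+ 2 = d i.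
Local Notation FG X := (functor_F C (functor_G I X)).
Local Notation inj X i := (dinj (bip C) (fun x => dual (irr x) \ot im I x X) i).
Local Notation prj X i := (dproj (bip C) (fun x => dual (irr x) \ot im I x X) i).

Lemma ptr_word_tail E F J (D : hom (E \ot J) (F \ot J)) W :
  ptr D \@ W = tlm F (revt J \@ W) \o (D \@ (dual J \ot W) \o tlm E (coev J \@ W)).
Proof. by rewrite /ptr unlock /ptr_def revtE !TE /= ?tlm1 ?compf1. Qed.

Lemma hbi_brl (X J : C) : hbi (hbB c X) J = bri c J X.
Proof. exact: (@inv_unique _ _ _ _ (br c J X) _ _ (hbiK (hbB c X) J) (briK c J
  X)). Qed.

Lemma hbi_hbT_tail (A B : C) (a : half_braiding A) (b : half_braiding B) J W :
  T (tensW (tensW (atom A) (atom B)) (atom J)) (tensW (atom J) (tensW (atom A)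
    (atom B)))
    (hbi (hbT a b) J) W
  = hbi a J \@ (B \ot W) \o ('1_A \om hbi b J \@ W).
Proof.
have H := T_iso (E := tensW (atom J) (tensW (atom A) (atom B)))
  (E' := tensW (tensW (atom A) (atom B)) (atom J)) W (hbiK (hbT a b) J).
apply: (@inv_unique _ _ _ _ _ _ _ H).
rewrite /= /hbT_mor !TE /= -!compA (compE2 (hbKi_tail a J _)) comp1f.
by rewrite -tens1M hbKi_tail tensm1.
Qed.

Definition bin X i : hom (zob X) (dirr i \ot im I i X) :=
  ('1_(dirr i) \om (impi I i X \o Gamma i X)) \o (asc (dirr i) (irr i) (zob X)
     \o ((rcoev (irr i) \om '1_(zob X)) \o luni (zob X))).

Definition pout X i : hom (dirr i \ot im I i X) (zob X) :=
  lun (zob X) \o ((ev (irr i) \om '1_(zob X)) \o (asci (dirr i) (irr i) (zob X)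
     \o ('1_(dirr i) \om (Gamma i X \o imiota I i X)))).

Lemma b_morE X : b_mor I sq X = \sum_i sq i *: (inj X i \o bin X i).
Proof. by apply: eq_bigr => i _; rewrite rcoevE compZr. Qed.

Lemma p_morE X : p_mor I sq X = \sum_i sq i *: (pout X i \o prj X i).
Proof. by apply: eq_bigr => i _; rewrite compZl. Qed.

Lemma prj_b X i : prj X i \o b_mor I sq X = sq i *: bin X i.
Proof.
rewrite b_morE comp_sumr (bigD1 i) //= compZr compA dproj_inj comp1f.
rewrite big1 ?addr0 // => j /eqP ji.
by rewrite compZr compA dproj_inj0 // comp0l scaler0.
Qed.

Lemma bin_cpt X i : cpt (zhb X) (F1_hb (dirr i) (im I i X)) (bin X i).
Proof.
rewrite /bin; apply: (cpt_comp (b := hbT (hbB c (dirr i)) (ihb i X))).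
  apply: cpt_tens; first exact: cpt_id.
  apply: (cpt_comp (b := ohb i X)); first exact: (cpt_br (bop c)).
  exact: Gamma_cpt.
apply: (cpt_comp (b := hbT (hbB c (dirr i \ot irr i)) (zhb X))).
  rewrite -[asc _ _ _]compf1 -tensm1; apply: cpt_comp; first exact: cpt_asc.
  by apply: cpt_tens; [exact: cpt_hbB_tens | exact: cpt_id].
apply: (cpt_comp (b := hbT (hbB c (one C)) (zhb X))); last exact: cpt_luni.
by apply: cpt_tens; [exact: cpt_br | exact: cpt_id].
Qed.

Lemma b_mor_cpt X : zcompat (X := X) (Y := FG X) (b_mor I sq X).
Proof.
rewrite b_morE; apply: cpt_sum => i _; apply: cpt_scale.
apply: cpt_comp (@bin_cpt X i); move=> Z; exact: hbS_injr.
Qed.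

Lemma pout_bin X i : pout X i \o bin X i = lun (zob X) \o ((ev (irr i) \om
  '1_(zob X))
  \o (asci (dirr i) (irr i) (zob X) \o (('1_(dirr i) \om Gamma i X)
  \o (asc (dirr i) (irr i) (zob X) \o ((rcoev (irr i) \om '1_(zob X)) \o luni
    (zob X)))))).
Proof.
rewrite /pout /bin -!compA; do 3!congr (_ \o _).
rewrite compA -tens1M; congr ((_ \om _) \o _).
by rewrite -compA (compA (imiota I i X)) -(imE I) !Gamma_idem.
Qed.

Lemma p_b_sum X : p_mor I sq X \o b_mor I sq X = \sum_i d i *: (pout X i \o bin
  X i).
Proof.
rewrite p_morE comp_suml; apply: eq_bigr => i _.
by rewrite compZl -compA prj_b compZr scalerA -expr2 sq_dim.
Qed.

(** The crossings of the ring with [irr i] are separated from those with X, so that the strand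
    [irr i] can be closed around the ring alone. *)
Lemma loop_ihb_tail X i j W :
  T (tensW (atom (irr i)) (atom (zob X))) (tensW (atom (irr i)) (atom (zob X)))
    (loop (ihb i X) (ohb i X) '1__ (irr j)) W
  = ('1_(irr i) \om ('1_(zob X) \om revt (irr j) \@ W)) \o
    (('1_(irr i) \om bri c (zob X) (irr j) \@ (dirr j \ot W)) \o
    ((bri c (irr i) (irr j) \o bri c (irr j) (irr i)) \@ (zob X \ot (dirr j \ot
      W)) \o
    (('1_(irr i) \om hbi (zhb X) (irr j) \@ (dirr j \ot W)) \o
     ('1_(irr i) \om ('1_(zob X) \om coev (irr j) \@ W))))).
Proof.
rewrite loopE ptr_word_tail tensm1 comp1f /ihb /ohb.
rewrite (T_comp (E' := tensW (atom (irr j)) (tensW (atom (irr i)) (atom (zob X))))).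
rewrite hbi_hbT_tail hbi_brl /= (bri_hexl_tail c (atom (irr i))) /=.
by rewrite (T_comp (E' := tensW (atom (irr j)) (atom (irr i)))) -!compA.
Qed.

(** In this composite [irr i] is a closed loop linked only with the ring j. It slides onto the
    strand j, where [ltr_ptr] makes it a partial trace. *)
Lemma pout_bin_tail X i W : T (atom (zob X)) (atom (zob X)) (pout X i \o bin X i) W
  = (dimOmega C)^-1 *: \sum_j d j *: (('1_(zob X) \om revt (irr j) \@ W) \o
     (bri c (zob X) (irr j) \@ (dirr j \ot W) \o
     (ptr (br c (irr i) (irr j) \o ((bri c (irr i) (irr j) \o bri c (irr j) (irr
       i)) \o bri c (irr i) (irr j)))
        \@ (zob X \ot (dirr j \ot W)) \o
     (hbi (zhb X) (irr j) \@ (dirr j \ot W) \o ('1_(zob X) \om coev (irr j) \@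
       W))))).
Proof.
rewrite pout_bin Gamma_avg; set D := avg _ _ _.
have DT : T (tensW (atom (irr i)) (atom (zob X))) (tensW (atom (irr i)) (atom
  (zob X))) D W
  = (dimOmega C)^-1 *: \sum_j d j *: T (tensW (atom (irr i)) (atom (zob X)))
     (tensW (atom (irr i)) (atom (zob X))) (loop (ihb i X) (ohb i X) '1__ (irr
       j)) W.
  by rewrite /D T_scale T_sum; congr (_ *: _); apply: eq_bigr => j _;
    rewrite T_scale.
rewrite !TE /= DT (lin_scale (tensm_linr _)) compZl compZr; congr (_ *: _).
rewrite tensm_sumr comp_suml comp_sumr; apply: eq_bigr => j _.
rewrite (lin_scale (tensm_linr _)) compZl compZr; congr (_ *: _).
rewrite -ltr_ptr; set R := ev (irr i).
set A1 := '1_(zob X) \om revt _ \@ _; set A2 := bri c (zob X) _ \@ _.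
set A4 := hbi _ _ \@ _; set A5 := '1_(zob X) \om coev _ \@ _.
rewrite loop_ihb_tail -/A1 -/A2 -/A4 -/A5.
rewrite -(tens1M _ A4 A5) (compA ('1_(irr i) \om A1)) -(tens1M _ A1 A2).
rewrite (tens1M (dirr i) ('1_(irr i) \om (A1 \o A2))).
rewrite (tens1M (dirr i) ((bri c (irr i) (irr j) \o bri c (irr j) (irr i)) \@
  _)) -!compA.
rewrite -(T_nat (rcoev (irr i)) (A4 \o A5)) /=.
by rewrite compA (T_nat R (A1 \o A2)) /= -!compA.
Qed.

(** The composite crossing is natural in S and trivial at the unit. *)
Lemma unit_dbl X S : isomorphic S (one C) -> bri c (zob X) S \o hbi (zhb X) S =
  '1__.
Proof.
move=> [f [g [gf fg]]].
pose D J := bri c (zob X) J \o hbi (zhb X) J.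
have Dnat J K (u : hom J K) : D K \o ('1_(zob X) \om u) = ('1_(zob X) \om u) \o D J.
  by rewrite /D -compA hbi_nat !compA bri_nat.
have D1 : D (one C) = '1__.
  apply: (@T_inj k C (tensW (atom (zob X)) (oneW C)) (tensW (atom (zob X)) (oneW
    C))).
  have H := T_iso (E := tensW (oneW C) (atom (zob X))) (E' := tensW (atom (zob
    X)) (oneW C))
    (one C) (hbiK (zhb X) (one C)).
  rewrite hb_one compf1 in H.
  by rewrite /D (T_comp (E' := tensW (oneW C) (atom (zob X)))) bri_one_left_tail
    H !T_id comp1f.
have N := Dnat _ _ g; rewrite D1 compf1 in N.
have {}N := congr1 (fun h => h \o ('1_(zob X) \om f)) N.
by rewrite -(compA (D S)) -tens1M gf tensm1 compf1 in N.
Qed.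

Lemma p_b X : p_mor I sq X \o b_mor I sq X = '1_(zob X).
Proof.
apply: (@T_inj k C (atom (zob X)) (atom (zob X))); set W := one C.
rewrite p_b_sum T_sum; under eq_bigr do rewrite T_scale pout_bin_tail scalerA
  mulrC -scalerA.
rewrite -scaler_sumr; under eq_bigr do rewrite scaler_sumr.
rewrite exchange_big /=.
(* Once the sums are exchanged, the sum over i with weights [d i] is a ring around the strand j, and
   the factor [dimOmega^-1] turns it into the average between the two braidings of [irr j]. *)
pose Y j := ('1_(zob X) \om revt (irr j) \@ W) \o (bri c (zob X) (irr j) \@
  (dirr j \ot W) \o
     ((avg (hbB c (irr j)) (hbB (bop c) (irr j)) '1_(irr j)) \@ (zob X \ot (dirr
       j \ot W)) \o
     (hbi (zhb X) (irr j) \@ (dirr j \ot W) \o ('1_(zob X) \om coev (irr j) \@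
       W)))).
have O0 := dimOmega_neq0 bs C_modular.
transitivity (\sum_j d j *: Y j).
  rewrite scaler_sumr; apply: eq_bigr => j _.
  rewrite /Y /avg T_scale T_sum !(compZl, compZr) scalerA mulrC -scalerA;
    congr (_ *: _).
  rewrite comp_suml !comp_sumr scaler_sumr; apply: eq_bigr => i _.
  rewrite T_scale compZl !compZr !scalerA mulrC; congr (_ *: _).
  do 2!congr (_ \o _); congr (_ \o _).
  by rewrite loopE tensm1 comp1f hbi_brl -!compA (compE2 (briK _ _ _)) comp1f.
have [j0 iso0] := irr_exhaust (one_simple C).
have d1 : d j0 = 1.
  have [f [g [gf fg]]] := iso0; apply: etrans (qdim_one C).
  rewrite -(scal_id C (d j0)) -(scal_id C (qdim (one C))) -!qdimE.
  by rewrite -fg tr_cyc gf.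
(* Only the representative of the unit contributes; its ring has dimension 1 and crosses X
   trivially. *)
rewrite (bigD1 j0) //= big1 ?addr0 => [|j /eqP jj0].
  rewrite d1 scale1r /Y avg_unit //; last exact: isomorphic_sym.
  rewrite T_id comp1f (compA (bri _ _ _ \@ _)).
  rewrite -(T_comp (E := tensW (atom (zob X)) (atom (irr j0))) (E' := tensW
    (atom (irr j0)) (atom (zob X)))
    (E'' := tensW (atom (zob X)) (atom (irr j0)))).
  rewrite unit_dbl; last exact: isomorphic_sym.
  rewrite !T_id comp1f -tens1M -(tensm1 (zob X)); congr (_ \om _).
  have := congr1 (fun h => h \@ W) (qdimE (irr j0)).
  by rewrite tr_tail T_id comp1f d1 scale1r T_id.
case: (avg_simple bs C_modular (irr_simple j)) => [z | iso].
  by rewrite /Y z (lin0 (@T_linear _ _ _ _ _)) comp0l !comp0r scaler0.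
by case: jj0; apply: irr_distinct; apply: isomorphic_trans iso iso0.
Qed.

Lemma Gamma_impi_nat X Y i (f : hom (zob X) (zob Y)) : cpt (zhb X) (zhb Y) f ->
  (impi I i Y \o (('1_(irr i) \om f) \o imiota I i X)) \o (impi I i X \o Gamma i X)
  = (impi I i Y \o Gamma i Y) \o ('1_(irr i) \om f).
Proof.
move=> F; rewrite -!compA (compA (imiota I i X)) -(imE I) Gamma_idem //.
by rewrite (Gamma_nat i F).
Qed.

Lemma bin_nat X Y i (f : hom (zob X) (zob Y)) : cpt (zhb X) (zhb Y) f ->
  ('1_(dirr i) \om (impi I i Y \o (('1_(irr i) \om f) \o imiota I i X))) \o bin X i
  = bin Y i \o f.
Proof.
move=> F; rewrite /bin (compA ('1__ \om _)) -tens1M Gamma_impi_nat // tens1M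
  -!compA.
congr (_ \o _); rewrite (compA ('1__ \om ('1__ \om f))) -asc_nat tensm1 -!compA.
congr (_ \o _); rewrite luni_nat (compA (_ \om f)) tens_swap -!compA //.
Qed.

Lemma F_G_mor X Y (f : chom X Y) : F_mor0 (fmor (functor_G I) f) = \sum_i
  (inj Y i \o (('1_(dirr i) \om (impi I i Y \o (('1_(irr i) \om zmor f) \o
    imiota I i X)))
    \o prj X i)).
Proof.
rewrite /F_mor0; apply: eq_bigr => i _; rewrite (bigD1 i) //= big1 ?addr0.
  rewrite /G_mor on_diag_eq /F1_mor tlift_pure; last exact: tensm_bilin.
  by rewrite (G_diag bs C_modular).
move=> j /eqP ji; rewrite /G_mor on_diag_neq; last exact/nesym.
by rewrite /F1_mor (lin0 (@tlift_linear _ _ _ _ _)) comp0l comp0r.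
Qed.

Definition b_trans : transf (idF (center C)) (compF (functor_F C) (functor_G I)) :=
  fun X => ZHom (@b_mor_cpt X).

Lemma b_natural : natural b_trans.
Proof.
move=> X Y f; apply: zhom_eq; rewrite /= F_G_mor comp_suml.
rewrite b_morE comp_suml; apply: eq_bigr => i _.
rewrite -!compA prj_b !compZr compZl; congr (_ *: _).
by rewrite -compA (bin_nat _ (zmorP f)).
Qed.

Lemma p_cpt X : cpt (zhb (FG X)) (zhb X) (avg (zhb (FG X)) (zhb X) (p_mor I sq X)).
Proof. exact: avg_cpt. Qed.

(** The average supplies the centrality that [p_mor] is not yet known to have; [p_transE] recovers
    [p_mor] afterwards. *)
Definition p_trans : transf (compF (functor_F C) (functor_G I)) (idF (center C)) :=
  fun X => ZHom (@p_cpt X).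

Lemma p_b_trans X : ccomp (p_trans X) (b_trans X) = cid X.
Proof.
apply: zhom_eq; rewrite /= (avg_compr _ _ (@b_mor_cpt X)) p_b avg_id //.
  exact: dimOmega_neq0.
exact: cpt_id.
Qed.
(** Right-handed zigzag: bending [irr i] back undoes the cup in [bin]. *)
Lemma revt_bin X i : lun (im I i X) \o ((revt (irr i) \om '1_(im I i X)) \o
   (asci (irr i) (dirr i) (im I i X) \o ('1_(irr i) \om bin X i))) = impi I i X
     \o Gamma i X.
Proof.
rewrite /bin; move: (impi I i X \o _) => h.
apply: (@T_inj k C (tensW (atom (irr i)) (atom (zob X))) (atom (im I i X))).
rewrite !TE /= ?TE /= (tens1M _ ('1_(dirr i) \om _)) (compA (revt (irr i) \@ _)).
by rewrite (T_nat (revt (irr i)) (h \@ _)) /= -compA right_zigzag1_tail compf1.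
Qed.

(** For [dirr i] the resolution of the identity reduces to the label i, where each lower element is
    a scalar and can be moved across the tensor sign. *)
Lemma dual_bases_self (V : vectType k) i (F : hom (dirr i) (dirr i) -> V) :
  linear F ->
  \sum_l tpure (tnth (upper bs (dirr i) i) l) (F (tnth (lower bs (dirr i) i) l))
  = tpure '1_(dirr i) (F '1_(dirr i)).
Proof.
move=> lF; rewrite -{1}(dual_bases_sum bs C_modular (dirr i)) (bigD1 i) //=.
rewrite [X in _ = tpure (_ + X) _]big1 ?addr0 => [|j /eqP ji]; last first.
  by rewrite big1 // => l _; rewrite (dirr_hom_neq (tnth _ _)) ?comp0l.
rewrite tpure_suml; apply: eq_bigr => l _.
have [x ->] := dirr_schur (tnth (lower bs (dirr i) i) l).
by rewrite (lin_scale lF) tpureZr compZr compf1 tpureZl.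
Qed.

Lemma trans_q_G_b X :
  ccomp (trans_q I bs sq (functor_G I X)) (fmor (functor_G I) (b_trans X)) = cid
    (functor_G I X).
Proof.
apply: functional_extensionality_dep => i; apply: functional_extensionality_dep
  => a.
rewrite /= /dcomp (bigD1 i) //= big1 ?addr0 => [|j /eqP ji]; last first.
  by rewrite /G_mor on_diag_neq ?tcomp0r //; apply/nesym.
rewrite /G_mor on_diag_eq (G_diag bs C_modular I (b_trans X)) trans_qE tcompZl
  tcomp_suml.
have E l : tcomp (tpure (tnth (upper bs (dirr a) i) l)
    (sigma (P := functor_G I X) (a := a) (tnth (lower bs (dirr a) i) l) \o
      imiota I i (FG X)))
    (tpure '1_(dirr i) (impi I i (FG X) \o (('1_(irr i) \om b_mor I sq X) \o
      imiota I i X)))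
  = tpure (tnth (upper bs (dirr a) i) l)
     (sq a *: (lun (im I a X) \o (((revt (irr i) \o ('1_(irr i) \om tnth (lower
       bs (dirr a) i) l)) \om '1_(im I a X))
       \o (asci (irr i) (dirr a) (im I a X) \o (('1_(irr i) \om bin X a) \o
         imiota I i X))))).
  rewrite tcomp_pure compf1; congr (tpure _ _).
  (* [imiota \o impi] is [Gamma] on [FG X], absorbed by the central [sigma]. *)
  rewrite -compA (compA (imiota I i _)) -(imE I i (FG X)) compA.
  rewrite (Gamma_fix_out bs C_modular (@sigma_cpt _ _ _ _ _ _)).
  rewrite /sigma revtE -!compA (compA ('1__ \om prj X a)) -tens1M prj_b.
  by rewrite (lin_scale (tensm_linr _)) !(compZl, compZr).
under eq_bigr do rewrite E.
case: (i =P a) E => [<- | ia] E; last first.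
  rewrite /did on_diag_neq // big1 ?scaler0 // => l _.
  by rewrite (dirr_hom_neq (tnth _ _)) // tpure0l.
rewrite /did on_diag_eq.
rewrite (dual_bases_self (F := fun h => sq i *: (lun (im I i X) \o (((revt (irr
  i) \o ('1_(irr i) \om h)) \om '1_(im I i X))
       \o (asci (irr i) (dirr i) (im I i X) \o (('1_(irr i) \om bin X i) \o
         imiota I i X)))))); last first.
  move=> x g h; rewrite tensm_linr comp_linr tensm_linl comp_linl comp_linr
    scalerDr.
  by rewrite !scalerA mulrC.
rewrite tensm1 compf1 tpureZr scalerA mulVf ?(sq_neq0 C_modular sq_dim) // scale1r.
congr (tpure _ _); rewrite -[RHS](impi_iota bs C_modular I) -[in
  RHS](Gamma_imiota bs C_modular I).
by rewrite (compA (impi I i X)) -revt_bin -!compA.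
Qed.

Lemma b_p_trans X : ccomp (b_trans X) (p_trans X) = cid (compF (functor_F C)
  (functor_G I) X).
Proof.
have [FG1 FGM] := functor_F_is_functor C.
have [G1 GM] := functor_G_is_functor bs C_modular I.
have GbE : fmor (functor_G I) (b_trans X) = trans_d I bs sq (functor_G I X).
  by rewrite -[LHS]ccomp1f -(trans_dq bs I C_modular sq_dim) -ccompA trans_q_G_b
    ccompf1.
have GpE : fmor (functor_G I) (p_trans X) = trans_q I bs sq (functor_G I X).
  rewrite -[LHS]ccompf1 -(trans_dq bs I C_modular sq_dim) -GbE ccompA -GM.
  by rewrite p_b_trans G1 ccomp1f.
(* Naturality of [b_trans] at the composite of [p_trans X] and [b_trans X], an endomorphism of
   [FG X] that G sends to the identity; the outer [b_trans] is then cancelled by its left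
   inverse. *)
have N : ccomp (b_trans (FG X)) (ccomp (b_trans X) (p_trans X))
    = ccomp (fmor (functor_F C) (fmor (functor_G I) (ccomp (b_trans X) (p_trans
      X))))
        (b_trans (FG X)) := b_natural _.
rewrite GM GbE GpE (trans_dq bs I C_modular sq_dim) FG1 ccomp1f in N.
have := congr1 (ccomp (p_trans _)) N.
by rewrite ccompA p_b_trans ccomp1f.
Qed.

Lemma p_transE X : zmor (p_trans X) = p_mor I sq X.
Proof.
have := congr1 (fun f => p_mor I sq X \o zmor f) (b_p_trans X).
by rewrite /= compA p_b comp1f compf1.
Qed.

Lemma trans_bp_isos : inverse_nat_isos b_trans p_trans.
Proof.
have bp : mutually_inverse b_trans p_trans.
  by split=> X; [exact: p_b_trans | exact: b_p_trans].
by split=> //; [exact: b_natural | exact: natural_inverse b_natural bp].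
Qed.
End BP.

Theorem theorem3p6 (k : closedFieldType) (char0 : [pchar k] =i pred0)
    (C : premodular k) (C_modular : modular C)
    (sq : 'I_(rk C) -> k) (sq_dim : forall i, sq i ^+ 2 = qdim (irr i))
    (I : images C) (A : dual_bases C) :
  factorization (functor_G I)
  /\ inverse_nat_isos (trans_d I A sq) (trans_q I A sq)
  /\ exists (b : transf (idF (center C)) (compF (functor_F C) (functor_G I)))
            (p : transf (compF (functor_F C) (functor_G I)) (idF (center C))),
       (forall X, zmor (b X) = b_mor I sq X)
       /\ (forall X, zmor (p X) = p_mor I sq X)
       /\ inverse_nat_isos b p.
Proof.
have dq := trans_dq_isos A I C_modular sq_dim.
have bp := trans_bp_isos A I C_modular sq_dim.
split; last split=> //.
  split; first exact: functor_G_is_functor A C_modular I.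
    by exists (trans_d I A sq), (trans_q I A sq).
  by exists (b_trans A I sq C_modular), (p_trans A I sq C_modular).
exists (b_trans A I sq C_modular), (p_trans A I sq C_modular).
by split=> [X //|]; split=> // X; apply: p_transE sq_dim _.
Qed.
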